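(* Suppose $\boldsymbol\gamma=\{\gamma_n\}_{n=0}^\infty$ is an H-indeterminate Stieltjes moment sequence. Set $t_0=\inf\mathrm{supp}(\beta)$, where $\beta$ is the Friedrichs measure of $\boldsymbol\gamma$ if $\boldsymbol\gamma$ is S-indeterminate, and $\beta$ is the unique S-representing measure of $\boldsymbol\gamma$ otherwise. Then (i) if $\boldsymbol\gamma$ is S-determinate, then $t_0=0$ and $\beta\in\mathscr M_e^+(\boldsymbol\gamma)$, (ii) if $\boldsymbol\gamma$ is S-indeterminate, then $t_0>0$, (iii) for every $t\in(-\infty,t_0]$ there exists a unique $\nu_t\in\mathscr M_e(\boldsymbol\gamma)$ such that $\inf\mathrm{supp}(\nu_t)=t$, (iv) the mapping $(-\infty,t_0]\ni t\mapsto\nu_t\in\mathscr M_e(\boldsymbol\gamma)$ is a bijection, (v) $\mathscr M_e^+(\boldsymbol\gamma)=\{\nu_t:t\in[0,t_0]\}$, (vi) the closed support of each N-extremal measure of $\boldsymbol\gamma$ is bounded from below, (vii) $\mathrm{supp}(\nu_t)\cap(-\infty,t_0]=\{t\}$ for every $t\in(-\infty,t_0]$, (viii) $[0,t_0]\subsetneq\bigcup_{\mu\in\mathscr M_e^+(\boldsymbol\gamma)}\mathrm{supp}(\mu)$ and $\mathrm{card}\big(\mathbb R_+\setminus\bigcup_{\mu\in\mathscr M_e^+(\boldsymbol\gamma)}\mathrm{supp}(\mu)\big)=\mathfrak c$ (the cardinality of the continuum).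
   Context: $\mathbb Z_+=\{0,1,2,\ldots\}$, $\mathbb R_+=[0,\infty)$; all measures are positive; $\mathrm{supp}(\nu)$ is the closed support of $\nu$. Let $\mathscr M$ be the set of Borel measures $\nu$ on $\mathbb R$ with $\int|t|^n\,d\nu<\infty$ for all $n\in\mathbb Z_+$, and $\mathscr M^+=\{\nu\in\mathscr M:\mathrm{supp}(\nu)\subseteq\mathbb R_+\}$. A real sequence $\{\gamma_n\}_{n=0}^\infty$ is a Hamburger (resp. Stieltjes) moment sequence if there is $\nu\in\mathscr M$ (resp. $\mathscr M^+$) with $\gamma_n=\int t^n\,d\nu(t)$ for all $n\in\mathbb Z_+$; such $\nu$ are its H-representing (resp. S-representing) measures. It is H-determinate (resp. S-determinate) if there is exactly one H-representing (resp. S-representing) measure; otherwise H-indeterminate (resp. S-indeterminate). An H-representing measure $\nu$ of an H-indeterminate Hamburger moment sequence $\boldsymbol\gamma$ is N-extremal if the complex polynomials are dense in $L^2(\nu)$; $\mathscr M_e(\boldsymbol\gamma)$ is the set of all N-extremal measures of $\boldsymbol\gamma$ and $\mathscr M_e^+(\boldsymbol\gamma)=\mathscr M_e(\boldsymbol\gamma)\cap\mathscr M^+$. If $\boldsymbol\gamma$ is an S-indeterminate Stieltjes moment sequence, there exist distinct $\alpha,\beta\in\mathscr M_e^+(\boldsymbol\gamma)$, uniquely determined by the requirement that $0=\inf\mathrm{supp}(\alpha)<\inf\mathrm{supp}(\rho)<\inf\mathrm{supp}(\beta)$ for every $\rho\in\mathscr M_e^+(\boldsymbol\gamma)\setminus\{\alpha,\beta\}$;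 $\alpha$ is the Krein measure and $\beta$ the Friedrichs measure of $\boldsymbol\gamma$. *)

(* Defs.v *)
From HB Require Import structures.
From mathcomp Require Import all_boot all_order all_algebra.
From mathcomp Require Import complex.
From mathcomp Require Import all_classical all_reals all_analysis.
Set Implicit Arguments.
Unset Strict Implicit.
Unset Printing Implicit Defensive.
Import Order.TTheory GRing.Theory Num.Theory.
Import numFieldNormedType.Exports.
Local Open Scope classical_set_scope.
Local Open Scope ring_scope.

(* The library's measures are functions on all sets, unconstrained outside the
   sigma-algebra.  Fixing the value 0 on non-Borel sets makes Leibniz equality
   coincide with equality of Borel measures ([borelMeasureP]), without losing
   any measure ([borelMeasure_repr]). *)
Record borelMeasure (R : realType) := BorelMeasure {
  borel_measure :> {measure set (measurableTypeR R) -> \bar R};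
  _ : forall A, ~ measurable A -> borel_measure A = 0%E }.

Lemma borelMeasureP (R : realType) (mu nu : borelMeasure R) :
  (forall A, measurable A -> mu A = nu A) <-> mu = nu.
Proof.
split=> [|-> //]; case: mu nu => [mu mu0] [nu nu0] /= E.
have e : mu = nu.
  apply: eq_measure; apply/funext => A.
  by case: (pselect (measurable A)) => mA; [exact: E | rewrite mu0 ?nu0].
by case: _ / e in nu0 E *; congr BorelMeasure; exact: Prop_irrelevance.
Qed.

Section canonical_representative.
Context (R : realType) (mu : {measure set (measurableTypeR R) -> \bar R}).

Definition mborel (A : set (measurableTypeR R)) : \bar R :=
  if pselect (measurable A) then mu A else 0%E.

Lemma mborelE A : measurable A -> mborel A = mu A.
Proof. by rewrite /mborel; case: pselect. Qed.

Let mborel0 : mborel set0 = 0%E.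
Proof. by rewrite mborelE. Qed.

Let mborel_ge0 A : (0 <= mborel A)%E.
Proof. by rewrite /mborel; case: pselect. Qed.

Let mborel_sigma_additive : semi_sigma_additive mborel.
Proof.
move=> F mF tF mUF; rewrite mborelE //.
rewrite (_ : (fun n => _) = (fun n => (\sum_(0 <= i < n) mu (F i))%E)).
  exact: measure_semi_sigma_additive.
by apply/funext => n; apply: eq_bigr => i _; rewrite mborelE.
Qed.

HB.instance Definition _ := isMeasure.Build _ _ _ mborel
  mborel0 mborel_ge0 mborel_sigma_additive.

Lemma borelMeasure_repr : 
  exists nu : borelMeasure R, forall A, measurable A -> nu A = mu A.
Proof.
have h A : ~ measurable A -> mborel A = 0%E by rewrite /mborel; case: pselect.
by exists (BorelMeasure h) => A mA /=; exact: mborelE.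
Qed.

End canonical_representative.

Section moment_problem.
Context (R : realType).
Implicit Types (nu alpha beta rho : borelMeasure R) (gamma : nat -> R).

Definition supp nu : set R :=
  [set x | forall U : set R, open_nbhs x U -> (0 < nu U)%E].

(* Extended-real infimum: the real [inf] returns 0 on sets that are empty or
   not bounded from below. *)
Definition inf_supp nu : \bar R := ereal_inf (EFin @` supp nu).

Definition moment_measures : set (borelMeasure R) :=
  [set nu : borelMeasure R | forall n, (\int[nu]_t (`|t : R| ^+ n)%:E < +oo)%E].

Definition moment_measures_plus : set (borelMeasure R) :=
  [set nu : borelMeasure R | moment_measures nu /\ supp nu `<=` `[0, +oo[].

Definition has_moments gamma nu :=
  forall n, (\int[nu]_t ((t : R) ^+ n)%:E)%E = (gamma n)%:E.

Definition H_representing gamma : set (borelMeasure R) :=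
  [set nu : borelMeasure R | moment_measures nu /\ has_moments gamma nu].

Definition S_representing gamma : set (borelMeasure R) :=
  [set nu : borelMeasure R | moment_measures_plus nu /\ has_moments gamma nu].

Definition Hamburger_seq gamma := H_representing gamma !=set0.

Definition Stieltjes_seq gamma := S_representing gamma !=set0.

Definition H_determinate gamma := exists! nu, H_representing gamma nu.

Definition S_determinate gamma := exists! nu, S_representing gamma nu.

Definition H_indeterminate gamma := Hamburger_seq gamma /\ ~ H_determinate gamma.

Definition S_indeterminate gamma := Stieltjes_seq gamma /\ ~ S_determinate gamma.

(* ||f||_2 for a complex-valued f; R[i] carries no sigma-algebra in the
   library, so measurability is that of the real and imaginary parts. *)
Definition L2norm nu (f : R -> R[i]) : \bar R :=
  'N[nu]_2%:E[EFin \o @Normc.normc R \o f].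

Definition L2 nu : set (R -> R[i]) :=
  [set f | [/\ measurable_fun [set: measurableTypeR R] (fun t => complex.Re (f t)),
               measurable_fun [set: measurableTypeR R] (fun t => complex.Im (f t))
             & (L2norm nu f < +oo)%E]].

Definition polynomials_dense nu :=
  forall f, L2 nu f -> forall e : R, 0 < e ->
    exists p : {poly R[i]}, (L2norm nu (fun t => (f t - p.[t%:C%C])%R) < e%:E)%E.

Definition N_extremal gamma : set (borelMeasure R) :=
  [set nu : borelMeasure R | [/\ H_indeterminate gamma, H_representing gamma nu
              & polynomials_dense nu]].

Definition N_extremal_plus gamma : set (borelMeasure R) :=
  N_extremal gamma `&` moment_measures_plus.

Definition Krein_Friedrichs gamma alpha beta :=
  [/\ N_extremal_plus gamma alpha, N_extremal_plus gamma beta, alpha <> beta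
    & forall rho, (N_extremal_plus gamma `\` [set alpha; beta]) rho ->
        [/\ inf_supp alpha = 0%E, (inf_supp alpha < inf_supp rho)%E
          & (inf_supp rho < inf_supp beta)%E]].

Definition Friedrichs_measure gamma beta :=
  exists alpha, Krein_Friedrichs gamma alpha beta.

End moment_problem.

(* Main.v *)
Require Import Defs.
From HB Require Import structures.
From mathcomp Require Import all_boot all_order all_algebra.
From mathcomp Require Import complex.
From mathcomp Require Import all_classical all_reals all_analysis.
From mathcomp Require Import measurable_realfun ring lra zify.
Set Implicit Arguments.
Unset Strict Implicit.
Unset Printing Implicit Defensive.
Import Order.TTheory GRing.Theory Num.Theory.
Import numFieldNormedType.Exports.
Local Open Scope classical_set_scope.
Local Open Scope ring_scope.

(** N-extremal solutions are the solutions that put the largest possible mass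
    at some point, and the theorem follows from how the supports of such
    solutions are placed on the line.

    Let [L] be [mlin gamma], the integral of polynomials against any solution,
    and let [rho gamma t] be the infimum of [L (p ^ 2)] over the polynomials
    with [p(t) = 1]; it bounds the mass of every solution at [t].  If there are
    two solutions, their difference annihilates polynomials and its Cauchy
    transform is nonzero at some point above [t].  This bounds the value of a
    polynomial there by its L2 norm ([nonreal_evaluation]), and Fejer-Riesz
    factors carry the bound down to the real line, uniformly near [t]
    ([fejer_riesz], [local_evaluation_bound]).  Hence [rho] is positive.  Four
    facts result.

    - Existence ([extremal_mass_exists]): the Hahn-Banach theorem extends [L]
      to a positive functional on the polynomially bounded functions, with the
      largest possible value on the indicator of [t], which is at least
      [rho gamma t].  The right-continuous version of its distribution function
      defines a solution with at least this mass at [t].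
    - Density ([indic_approximable], [dense_of_indic]): if a solution has mass
      [rho gamma t] at [t], almost minimal polynomials approach the indicator
      of [t], and a difference quotient of their Fejer-Riesz factors at
      [z = t + i y] approaches [1 / (x - z)].  These kernels generate all Borel
      indicators under linear combinations and bounded limits ([hull_indic]).
      So the solution is N-extremal.  Conversely, N-extremal solutions have
      extremal mass at each support point ([mass_of_supp]).
    - Uniqueness ([extremal_eq]): the polynomials approaching the kernels
      depend on [t] and [gamma] only, so two N-extremal solutions with a common
      support point are equal.
    - Interlacing ([interlacing]): the closed interval between two support
      points of an N-extremal solution meets the support of every solution.

    Each real number is thus in the support of exactly one N-extremal solution.
    Interlacing shows that the numbers that are least in their support form a
    half-line [ ]-oo, t1] ] ([lowest_max]), and a solution supported in
    [ [0, +oo[ ] allows an N-extremal one only one negative support point, so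
    that [t1 >= 0].  Every N-extremal solution has a least support point, the
    only one in [ ]-oo, t1] ].  If there is only one solution on [ [0, +oo[ ],
    those with least points [0] and [t1] agree and [t1 = 0]; otherwise the
    requirement on the Friedrichs measure forces its least point to be [t1].
    Finally each solution with negative least point has a further support
    point, above [t1]; these points are pairwise distinct and outside all
    supports of the N-extremal solutions on [ [0, +oo[ ]. *)

(** * Nonnegative polynomials as sums of two squares *)

Section fejer_riesz.
Context (R : realType).
Implicit Types (p g h : {poly R}) (t y a b : R).

(** [|x - z| ^ 2] for [z = t + i y].  A remainder [e + o (X - t)] modulo [quadp]
    stands for the value [e + i y o] of a polynomial at [z]. *)
Definition quadp t y : {poly R} := ('X - t%:P) ^+ 2 + (y ^+ 2)%:P.

Lemma quadpE t y x : (quadp t y).[x] = (x - t) ^+ 2 + y ^+ 2.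
Proof. by rewrite /quadp !hornerE. Qed.

Lemma size_quadp t y : size (quadp t y) = 3.
Proof.
by rewrite /quadp size_polyDl size_exp_XsubC// (leq_ltn_trans (size_polyC_leq1 _)).
Qed.

Lemma divp_quadp p t y :
  exists q e o, p = q * quadp t y + e%:P + o%:P * ('X - t%:P).
Proof.
elim/poly_ind: p => [|p c [q [e [ o ->]]]].
  by exists 0, 0, 0; rewrite !(mul0r, polyC0, addr0).
exists (q * 'X + o%:P), (e * t - o * y ^+ 2 + c), (e + o * t).
by rewrite /quadp; ring.
Qed.

Definition cev p (z : R[i]) := (map_poly (real_complex R) p).[z].

Lemma cevD p h z : cev (p + h) z = cev p z + cev h z.
Proof. by rewrite /cev rmorphD hornerD. Qed.

Lemma cevN p z : cev (- p) z = - cev p z.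
Proof. by rewrite /cev rmorphN hornerN. Qed.

Lemma cevM p h z : cev (p * h) z = cev p z * cev h z.
Proof. by rewrite /cev rmorphM hornerM. Qed.

Lemma cevC a z : cev a%:P z = a%:C%C.
Proof. by rewrite /cev map_polyC hornerC. Qed.

Lemma cevX z : cev 'X z = z.
Proof. by rewrite /cev map_polyX hornerX. Qed.

Lemma cev_quadp t y : cev (quadp t y) (t +i* y)%C = 0.
Proof.
rewrite /quadp !(expr2, cevD, cevM, cevN, cevC, cevX); simpc.
by congr Complex; ring.
Qed.

Lemma cev_rem q e o t y :
  cev (q * quadp t y + e%:P + o%:P * ('X - t%:P)) (t +i* y)%C = (e +i* (o * y))%C.
Proof.
rewrite cevD cevD cevM cev_quadp !(cevD, cevM, cevN, cevC, cevX); simpc.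
by congr Complex; ring.
Qed.

Lemma horner_ge0_right p a : (forall x, a < x -> 0 <= p.[x]) -> 0 <= p.[a].
Proof.
move=> h; rewrite leNgt; apply/negP => pa.
have /cvgrPdist_lt/(_ (- p.[a])) := @continuous_horner _ p a.
rewrite oppr_gt0 => /(_ pa)/nbhs_ballP[d /= d0] /(_ (a + d / 2)).
have d2 : 0 < d / 2 by rewrite divr_gt0.
rewrite /ball/= opprD addNKr normrN gtr0_norm//.
rewrite ltr_pdivrMr// mulr_natr mulr2n ltrDl => /(_ d0).
have := h (a + d / 2); rewrite ltrDl => /(_ d2).
by rewrite distrC => ? /ltr_normlW; lra.
Qed.

Definition sqn (z : R[i]) : R := complex.Re z ^+ 2 + complex.Im z ^+ 2.

Lemma sqnM z w : sqn (z * w) = sqn z * sqn w.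
Proof. by case: z w => [a b] [c d]; rewrite /sqn /=; ring. Qed.

(** A root [a + i b] splits off a factor [(X - a) ^ 2 + b ^ 2] with nonnegative
    cofactor, by which [g + i h] acquires the factor [X - a + i |b|].  All roots
    of [g + i h] then lie in the closed lower half plane, so that its modulus
    increases along upward vertical half-lines. *)
Lemma fejer_riesz_complex p : (forall x, 0 <= p.[x]) ->
  exists g h, p = g ^+ 2 + h ^+ 2 /\
    forall t y, 0 <= y ->
      p.[t] <= sqn (cev g (t +i* y)%C + (0 +i* 1)%C * cev h (t +i* y)%C).
Proof.
have [n] := ubnP (size p); elim: n p => [//|n IH] p /ltnSE pn p0.
have [sp|sp] := leqP (size p) 1.
  have [c pc] : exists c, p = c%:P by exists p`_0; exact: size1_polyC.
  have c0 : 0 <= c by have := p0 0; rewrite pc hornerC.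
  exists (Num.sqrt c)%:P, 0; split=> [|t y y0].
    by rewrite pc expr0n /= addr0 -polyC_exp sqr_sqrtr.
  rewrite pc hornerC -polyC0 !cevC /sqn; simpc => /=.
  by rewrite expr0n addr0 sqr_sqrtr.
have [w rw] : exists w, root (map_poly (real_complex R) p) w.
  by apply/closed_rootP; rewrite size_map_poly neq_ltn sp orbT.
have {rw} pw : cev p w = 0 by apply/eqP.
case: w pw => a b pw.
have [q [e [ o pE]]] := divp_quadp p a b.
have : cev p (a +i* b)%C = (e +i* (o * b))%C by rewrite pE cev_rem.
rewrite pw => -[e0 /esym/eqP]; rewrite mulf_eq0 => /orP ob.
have {e0 ob} pq : p = q * quadp a b.
  (* At a real root the cofactor of [X - a] changes sign, so it vanishes. *)
  suff o0 : o = 0 by rewrite pE -e0 o0 polyC0 mul0r !addr0.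
  case: ob => [/eqP //|/eqP b0].
  have pE' x : p.[x] = (q.[x] * (x - a) + o) * (x - a).
    by rewrite pE -e0 b0 /quadp !hornerE; ring.
  have pg x : x < a -> q.[x] * (x - a) + o <= 0.
    by move=> xa; have := p0 x; rewrite pE' nmulr_lge0// subr_lt0.
  have pl x : a < x -> 0 <= q.[x] * (x - a) + o.
    by move=> xa; have := p0 x; rewrite pE' pmulr_lge0// subr_gt0.
  pose r := q * ('X - a%:P) + o%:P.
  have rE x : r.[x] = q.[x] * (x - a) + o by rewrite /r !hornerE.
  have ra : r.[a] = o by rewrite rE subrr mulr0 add0r.
  clearbody r; apply/eqP; rewrite -ra eq_le; apply/andP; split; last first.
    by apply: horner_ge0_right => x /pl; rewrite rE.
  (* The left limit at [a] is the right limit of the reflected polynomial. *)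
  rewrite -oppr_ge0 (_ : - r.[a] = (- (r \Po ((2 * a)%:P - 'X))).[a]).
    apply: horner_ge0_right => x ax; rewrite hornerN horner_comp oppr_ge0.
    rewrite rE !(hornerD, hornerN, hornerC, hornerX); apply: pg; lra.
  rewrite hornerN horner_comp !(hornerD, hornerN, hornerC, hornerX).
  by congr (- r.[_]); ring.
have q0 x : 0 <= q.[x].
  have q0' : forall x, x != a -> 0 <= q.[x].
    move=> z za; have := p0 z; rewrite pq hornerM quadpE pmulr_lge0//.
    by rewrite ltr_wpDr ?sqr_ge0// exprn_even_gt0//= subr_eq0.
  have [->|/q0'//] := eqVneq x a.
  by apply: horner_ge0_right => z az; apply: q0'; rewrite gt_eqF.
have qneq0 : q != 0.
  by apply: contraTneq sp => q0'; rewrite pq q0' mul0r size_poly0.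
have sq : (size q < n)%N.
  have D0 : quadp a b != 0 by rewrite -size_poly_eq0 size_quadp.
  by move: pn; rewrite pq size_mul// size_quadp; move: (size q); lia.
have [g [h [qE qle]]] := IH q sq q0.
exists (('X - a%:P) * g - `|b|%:P * h), (('X - a%:P) * h + `|b|%:P * g); split.
  rewrite pq /quadp qE -(real_normK (num_real b)).
  by rewrite polyC_exp; ring.
move=> t y y0.
rewrite !(cevD, cevM, cevN, cevC, cevX).
set G := cev g _; set H := cev h _; set z := (t +i* y)%C.
have -> : (z + - a%:C%C) * G + - (`|b|%:C%C * H) +
    (0 +i* 1)%C * ((z + - a%:C%C) * H + `|b|%:C%C * G) =
    (z - a%:C%C + (0 +i* 1)%C * `|b|%:C%C) * (G + (0 +i* 1)%C * H).
  have i2 : (0 +i* 1)%C * (0 +i* 1)%C = -1 :> R[i] by rewrite -expr2 sqr_i.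
  by rewrite -(mulN1r (_ * H)) -i2; ring.
rewrite sqnM pq hornerM mulrC ler_pM ?qle//.
  by rewrite quadpE addr_ge0 ?sqr_ge0.
rewrite quadpE /sqn /z; simpc => /=.
rewrite lerD2l -(real_normK (num_real b)) lerXn2r ?nnegrE ?addr_ge0//.
by rewrite lerDr.
Qed.

(** Reading the value of [g + i h] at [t + i y] off remainders keeps the bound
    within real polynomials, which is where the moment functional applies. *)
Lemma fejer_riesz p : (forall x, 0 <= p.[x]) ->
  exists g h, p = g ^+ 2 + h ^+ 2 /\
    forall t y q1 e1 o1 q2 e2 o2, 0 <= y ->
      g = q1 * quadp t y + e1%:P + o1%:P * ('X - t%:P) ->
      h = q2 * quadp t y + e2%:P + o2%:P * ('X - t%:P) ->
      p.[t] <= (e1 - y * o2) ^+ 2 + (y * o1 + e2) ^+ 2.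
Proof.
move=> /fejer_riesz_complex[g [h [pE le]]]; exists g, h; split=> //.
move=> t y q1 e1 o1 q2 e2 o2 y0 gE hE; have := le t y y0.
rewrite gE hE !cev_rem /sqn; simpc => /=.
by congr (_ <= _ + _); ring.
Qed.

End fejer_riesz.

(** * Integrals of polynomially bounded functions *)

Notation mT R := (measurableTypeR R).

Section tame_functions.
Context (R : realType).
Implicit Types (f g : R -> R) (p : {poly R}).

Definition poly_bounded f := exists p : {poly R}, forall x, `|f x| <= p.[x].

(** The functions that are integrable for structural reasons: they are
    integrable against every measure with finite moments, and form an
    algebra. *)
Definition tame f := measurable_fun [set: mT R] (f : mT R -> mT R) /\ poly_bounded f.

Lemma poly_bounded_poly p : poly_bounded (horner p).
Proof.
exists (p ^+ 2 + 1%:P) => x; rewrite !hornerE.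
by case: ger0P => h; nra.
Qed.

Lemma poly_boundedW f g : (forall x, `|f x| <= `|g x|) ->
  poly_bounded g -> poly_bounded f.
Proof. by move=> fg [p gp]; exists p => x; exact: le_trans (gp x). Qed.

Lemma poly_boundedD f g :
  poly_bounded f -> poly_bounded g -> poly_bounded (fun x => f x + g x).
Proof.
move=> [p fp] [q gq]; exists (p + q) => x; rewrite hornerD.
by rewrite (le_trans (ler_normD _ _))// lerD.
Qed.

Lemma poly_boundedM f g :
  poly_bounded f -> poly_bounded g -> poly_bounded (fun x => f x * g x).
Proof.
move=> [p fp] [q gq]; exists (p * q) => x; rewrite hornerM normrM.
by rewrite ler_pM.
Qed.

Lemma poly_bounded_bounded f (M : R) : (forall x, `|f x| <= M) -> poly_bounded f.
Proof. by move=> fM; exists M%:P => x; rewrite hornerC. Qed.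

Lemma poly_bounded_cst c : poly_bounded (fun=> c).
Proof. exact: (@poly_bounded_bounded _ `|c|). Qed.

Lemma tame_cst c : tame (fun=> c).
Proof. by split; [exact: measurable_cst|exact: poly_bounded_cst]. Qed.

Lemma tameD f g : tame f -> tame g -> tame (fun x => f x + g x).
Proof.
by move=> [mf bf] [mg bg]; split; [exact: measurable_funD|exact: poly_boundedD].
Qed.

Lemma tameM f g : tame f -> tame g -> tame (fun x => f x * g x).
Proof.
by move=> [mf bf] [mg bg]; split; [exact: measurable_funM|exact: poly_boundedM].
Qed.

Lemma tameN f : tame f -> tame (fun x => - f x).
Proof.
move=> [mf bf]; split; first exact: measurable_funN.
by apply: poly_boundedW bf => x; rewrite normrN.
Qed.

Lemma tameX f n : tame f -> tame (fun x => f x ^+ n).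
Proof.
move=> tf; elim: n => [|n IH]; first exact: (tame_cst 1).
rewrite (_ : (fun x => _) = (fun x => f x * f x ^+ n)); first exact: tameM.
by apply/funext => x; rewrite exprS.
Qed.

Lemma tame_norm f : tame f -> tame (fun x => `|f x|).
Proof.
move=> [mf bf]; split; first exact: measurableT_comp.
by apply: poly_boundedW bf => x; rewrite normr_id.
Qed.

Lemma tame_poly p : tame (fun x => p.[x]).
Proof.
split; last exact: poly_bounded_poly.
by apply: continuous_measurable_fun; exact: continuous_horner.
Qed.

Lemma tame_id : tame (fun x => x).
Proof.
by rewrite (_ : (fun x => x) = (fun x => ('X : {poly R}).[x]));
  [exact: tame_poly | apply/funext => x; rewrite hornerX].
Qed.

Lemma tame_sum (I : Type) (s : seq I) (f : I -> R -> R) :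
  (forall i, tame (f i)) -> tame (fun x => \sum_(i <- s) f i x).
Proof.
move=> tf; elim: s => [|i s IH].
  by under eq_fun do rewrite big_nil; exact: tame_cst.
by under eq_fun do rewrite big_cons; exact: tameD.
Qed.

Lemma tame_indic (A : set R) : measurable (A : set (mT R)) -> tame (\1_A : R -> R).
Proof.
move=> mA; split; first exact: measurable_indic.
by apply: (@poly_bounded_bounded _ 1) => x; rewrite indicE; case: (_ \in _);
  rewrite /= ?normr1 ?normr0.
Qed.

Lemma tame_bounded f (M : R) : measurable_fun [set: mT R] (f : mT R -> mT R) ->
  (forall x, `|f x| <= M) -> tame f.
Proof. by move=> mf fM; split=> //; exact: poly_bounded_bounded fM. Qed.

End tame_functions.

Ltac tame_tac := repeat first
  [ assumption | refine (tame_cst _) | refine (tame_id _) | refine (tame_poly _)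
  | refine (tame_norm _) | refine (tameX _ _)
  | refine (tameM _ _) | refine (tameD _ _) | refine (tameN _) ].

Section moments.
Context (R : realType).
Implicit Types (mu nu : {measure set (mT R) -> \bar R}) (f g : R -> R).

Definition all_moments mu := forall n, (\int[mu]_t (`|t : R| ^+ n)%:E < +oo)%E.

Definition represents (gamma : nat -> R) mu :=
  all_moments mu /\ forall n, (\int[mu]_t ((t : R) ^+ n)%:E)%E = (gamma n)%:E.

(** The integral of [p] against any solution of the moment problem, by
    [ig_poly]. *)
Definition mlin (gamma : nat -> R) (p : {poly R}) : R :=
  \sum_(i < size p) p`_i * gamma i.

Lemma integrable_monomial mu n : all_moments mu ->
  mu.-integrable setT (fun x : mT R => ((x : R) ^+ n)%:E).
Proof.
move=> mom; apply/integrableP; split.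
  by apply/measurable_EFinP; have [] := tameX n (tame_id R).
rewrite (_ : (fun x => _) = (fun x : mT R => (`|x : R| ^+ n)%:E)); first exact: mom.
by apply/funext => x; rewrite /= normrX.
Qed.

Lemma integrable_poly mu (p : {poly R}) : all_moments mu ->
  mu.-integrable setT (fun x : mT R => p.[x]%:E).
Proof.
move=> mom; rewrite (_ : (fun x => _) = (fun x : mT R =>
    \sum_(i <- index_enum 'I_(size p)) ((p`_i)%:E * ((x : R) ^+ i)%:E)%E)%E); last first.
  apply/funext => x; rewrite horner_coef -sumEFin.
  by apply: eq_bigr => i _; rewrite EFinM.
apply: integrable_sum => // i _.
by apply: integrableZl => //; exact: integrable_monomial.
Qed.

Lemma tame_integrable mu f : all_moments mu -> tame f ->
  mu.-integrable setT (EFin \o (f : mT R -> R)).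
Proof.
move=> mom [mf [p fp]].
apply: le_integrable (integrable_poly p mom) => //; first exact/measurable_EFinP.
by move=> x _ /=; rewrite lee_fin (le_trans (fp x))// ler_norm.
Qed.

Definition ig mu f : R := \int[mu]_x f x.

Section ig_theory.
Variables (mu : {measure set (mT R) -> \bar R}) (mom : all_moments mu).

Lemma ig_EFin f : tame f -> (\int[mu]_x (f x)%:E)%E = (ig mu f)%:E.
Proof.
move=> tf; rewrite /ig /Rintegral fineK//.
by apply: integrable_fin_num => //; exact: tame_integrable.
Qed.

Lemma ig_cstM (c : R) f : tame f -> ig mu (fun x => c * f x) = c * ig mu f.
Proof. by move=> tf; rewrite /ig RintegralZl//; exact: tame_integrable. Qed.

Lemma igD f g : tame f -> tame g -> ig mu (fun x => f x + g x) = ig mu f + ig mu g.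
Proof. by move=> tf tg; rewrite /ig RintegralD//; exact: tame_integrable. Qed.

Lemma igN f : tame f -> ig mu (fun x => - f x) = - ig mu f.
Proof.
move=> tf; rewrite -mulN1r -ig_cstM//; congr ig.
by apply/funext => x; rewrite mulN1r.
Qed.

Lemma igB f g : tame f -> tame g -> ig mu (fun x => f x - g x) = ig mu f - ig mu g.
Proof. by move=> tf tg; rewrite igD ?igN//; exact: tameN. Qed.

Lemma ig_le f g : tame f -> tame g -> (forall x, f x <= g x) -> ig mu f <= ig mu g.
Proof. by move=> tf tg fg; apply: le_Rintegral => //; exact: tame_integrable. Qed.

Lemma ig_ge0 f : (forall x, 0 <= f x) -> 0 <= ig mu f.
Proof. by move=> f0; apply: Rintegral_ge0. Qed.

Lemma ig_norm f : tame f -> `|ig mu f| <= ig mu (fun x => `|f x|).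
Proof. by move=> tf; apply: le_normr_Rintegral => //; exact: tame_integrable. Qed.

Lemma measure_fin (A : set (mT R)) : measurable A -> mu A \is a fin_num.
Proof.
move=> mA; have := integrable_fin_num measurableT (tame_integrable mom (tame_indic mA)).
by rewrite /= integral_indic// setIT.
Qed.

Lemma ig_indic (A : set (mT R)) : measurable A -> ig mu \1_A = fine (mu A).
Proof. by move=> mA; rewrite /ig /Rintegral integral_indic// setIT. Qed.

Lemma ig_cst (c : R) : ig mu (fun=> c) = c * ig mu (fun=> 1).
Proof. by rewrite -ig_cstM; [rewrite mulr1|exact: tame_cst]. Qed.

Lemma ig_sum (I : Type) (s : seq I) (f : I -> R -> R) : (forall i, tame (f i)) ->
  ig mu (fun x => \sum_(i <- s) f i x) = \sum_(i <- s) ig mu (f i).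
Proof.
move=> tf; elim: s => [|i s IH].
  under [in LHS]eq_fun do rewrite big_nil.
  by rewrite big_nil ig_cst mul0r.
under [in LHS]eq_fun do rewrite big_cons.
by rewrite igD ?IH ?big_cons//; exact: tame_sum.
Qed.

Lemma ig_eq_off_null f g (N : set (mT R)) : tame f -> tame g -> measurable N ->
  mu N = 0%E -> (forall x, ~ N x -> f x = g x) -> ig mu f = ig mu g.
Proof.
move=> tf tg mN N0 fg; rewrite /ig /Rintegral; congr fine.
have H h (th : tame h) := negligible_integral mN measurableT (tame_integrable mom th) N0.
rewrite [LHS](H f tf) [RHS](H g tg).
by apply: eq_integral => x; rewrite inE => -[_ Nx]; rewrite /= fg.
Qed.

Lemma ig_dct (f_ : nat -> R -> R) f g : (forall n, tame (f_ n)) -> tame g ->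
  (forall n x, `|f_ n x| <= g x) -> (forall x, f_ ^~ x @ \oo --> f x) ->
  tame f /\ (fun n => ig mu (f_ n)) @ \oo --> ig mu f.
Proof.
move=> tf tg fg cf.
have mf : measurable_fun [set: mT R] (f : mT R -> mT R).
  by apply: measurable_fun_cvg => [n|x _]; [exact: (tf n).1|exact: cf].
have fg' x : `|f x| <= g x.
  have cn : (fun n => `|f_ n x|) @ \oo --> `|f x| by apply: cvg_norm; exact: cf.
  rewrite -(cvg_lim _ cn)//; apply: limr_le; first by apply/cvg_ex; exists `|f x|.
  by apply: nearW => n.
have tF : tame f.
  split=> //; case: tg => _ [p gp]; exists p => x.
  exact: le_trans (fg' x) (le_trans (ler_norm _) (gp x)).
split=> //.
have [_ _] := @dominated_convergence _ _ _ mu setT measurableT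
  (fun n x => (f_ n x)%:E) (EFin \o f) (EFin \o g)
  (fun n => measurable_int mu (tame_integrable mom (tf n)))
  (measurable_int mu (tame_integrable mom tF))
  ltac:(by apply: aeW => x _ /=; apply/fine_cvgP; split; [exact: nearW|exact: cf])
  (tame_integrable mom tg) ltac:(by apply: aeW => x n _ /=; rewrite lee_fin).
under eq_fun do rewrite (ig_EFin (tf _)).
by rewrite ig_EFin// => /fine_cvgP[].
Qed.

End ig_theory.

Lemma ig_monomial mu gamma n : represents gamma mu -> ig mu (fun x => x ^+ n) = gamma n.
Proof. by move=> [mom rep]; rewrite /ig /Rintegral rep. Qed.

Lemma ig_poly mu gamma (p : {poly R}) : represents gamma mu ->
  ig mu (fun x => p.[x]) = mlin gamma p.
Proof.
move=> rep; have mom := rep.1; rewrite /mlin.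
transitivity (\sum_(i < size p) ig mu (fun x => p`_i * x ^+ i)).
  rewrite -(ig_sum mom) => [|i]; last by tame_tac.
  by congr ig; apply/funext => x; rewrite horner_coef.
apply: eq_bigr => i _; rewrite ig_cstM//; last by tame_tac.
by rewrite (ig_monomial _ rep).
Qed.

Lemma mlin_ge0 mu gamma p : represents gamma mu -> (forall x, 0 <= p.[x]) ->
  0 <= mlin gamma p.
Proof. by move=> rep p0; rewrite -(ig_poly _ rep); apply: ig_ge0. Qed.

End moments.

(** * Poisson kernels generate the Borel indicators *)

Section poisson_kernels.
Context (R : realType).
Implicit Types (t y x : R) (f : R -> R) (A : (R -> R) -> Prop).

(** For [z = t + i y], the imaginary and real parts of [1 / (x - z)] are
    [y * poisson t y x] and [cpoisson t y x]. *)
Definition poisson t y x : R := ((x - t) ^+ 2 + y ^+ 2)^-1.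
Definition cpoisson t y x : R := (x - t) * poisson t y x.

Lemma poisson_den_gt0 t y x : 0 < y -> 0 < (x - t) ^+ 2 + y ^+ 2.
Proof. by move=> y0; rewrite ltr_wpDl ?sqr_ge0// exprn_gt0. Qed.

Lemma poisson_gt0 t y x : 0 < y -> 0 < poisson t y x.
Proof. by move=> y0; rewrite invr_gt0 poisson_den_gt0. Qed.

Lemma poissonV t y x : 0 < y -> poisson t y x * ((x - t) ^+ 2 + y ^+ 2) = 1.
Proof. by move=> y0; rewrite mulVf// gt_eqF// poisson_den_gt0. Qed.

Lemma poisson_le t y x : 0 < y -> poisson t y x <= y ^- 2.
Proof.
move=> y0; rewrite lef_pV2 ?posrE ?poisson_den_gt0 ?exprn_gt0//.
by rewrite lerDr sqr_ge0.
Qed.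

Lemma poisson_norm t y x : 0 < y -> `|poisson t y x| <= y ^- 2.
Proof. by move=> y0; rewrite gtr0_norm ?poisson_gt0// poisson_le. Qed.

Lemma cpoisson_norm t y x : 0 < y -> `|cpoisson t y x| <= y^-1.
Proof.
move=> y0; rewrite normrM (gtr0_norm (poisson_gt0 _ _ y0)).
rewrite ler_pdivrMr ?poisson_den_gt0// ler_pdivlMl//.
rewrite -(real_normK (num_real (x - t))).
have := normr_ge0 (x - t); move: `|_| => u u0; nra.
Qed.

Lemma measurable_poisson t y : 0 < y -> measurable_fun [set: mT R] (poisson t y : mT R -> mT R).
Proof.
move=> y0; apply: continuous_measurable_fun => x.
apply: cvgV; first by rewrite gt_eqF// poisson_den_gt0.
by apply: cvgD; [apply: cvgM; apply: cvgB; try exact: cvg_cst; exact: cvg_id|exact: cvg_cst].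
Qed.

Lemma tame_poisson t y : 0 < y -> tame (poisson t y).
Proof.
move=> y0; apply: (tame_bounded (M := y ^- 2)) => [|x]; first exact: measurable_poisson.
exact: poisson_norm.
Qed.

Lemma tame_cpoisson t y : 0 < y -> tame (cpoisson t y).
Proof. by move=> y0; apply: tameM; [tame_tac|exact: tame_poisson]. Qed.

End poisson_kernels.

Section kernel_class.
Context (R : realType).
Implicit Types (t y x c : R) (f g : R -> R) (A : (R -> R) -> Prop).

(** The closure of the kernels on one vertical line under operations that
    preserve both equality of integrals and approximability by polynomials. *)
Inductive hull t : (R -> R) -> Prop :=
| hull_poisson y : 0 < y -> hull t (poisson t y)
| hull_cpoisson y : 0 < y -> hull t (cpoisson t y)
| hullD f g : hull t f -> hull t g -> hull t (fun x => f x + g x)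
| hullZ c f : hull t f -> hull t (fun x => c * f x)
| hull_lim (f_ : nat -> R -> R) f M : (forall n, hull t (f_ n)) ->
    (forall n x, `|f_ n x| <= M) -> (forall x, f_ ^~ x @ \oo --> f x) -> hull t f.

Lemma eq_hull t f g : f =1 g -> hull t f -> hull t g.
Proof. by move=> /funext ->. Qed.

Lemma hull_bounded t f : hull t f -> exists M, forall x, `|f x| <= M.
Proof.
elim=> {f} [y y0|y y0|f g _ [M fM] _ [N gN]|c f _ [M fM]|f_ f M _ _ fM cf].
- by exists (y ^- 2) => x; exact: poisson_norm.
- by exists y^-1 => x; exact: cpoisson_norm.
- by exists (M + N) => x; rewrite (le_trans (ler_normD _ _))// lerD.
- by exists (`|c| * M) => x; rewrite normrM ler_wpM2l.
- exists M => x.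
  have cn : (fun n => `|f_ n x|) @ \oo --> `|f x| by apply: cvg_norm; exact: cf.
  rewrite -(cvg_lim _ cn)//; apply: limr_le; first by apply/cvg_ex; exists `|f x|.
  by apply: nearW => n.
Qed.

Lemma poisson_mul t y z x : 0 < y -> 0 < z -> y != z ->
  poisson t y x * poisson t z x = (z ^+ 2 - y ^+ 2)^-1 * (poisson t y x - poisson t z x).
Proof.
move=> y0 z0 yz.
have h : z ^+ 2 - y ^+ 2 != 0.
  rewrite subr_sqr mulf_neq0//; first by rewrite subr_eq0 eq_sym.
  by rewrite gt_eqF// addr_gt0.
have := poisson_den_gt0 t x y0; have := poisson_den_gt0 t x z0.
rewrite /poisson => /lt0r_neq0 ? /lt0r_neq0 ?; field.
by apply/and3P.
Qed.

Lemma cvg_shift_harmonic (y : R) : (fun n => y + n.+1%:R^-1) @ \oo --> y.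
Proof.
rewrite -[X in _ --> X]addr0.
by apply: cvgD; [exact: cvg_cst|exact: cvg_harmonic].
Qed.

Lemma cvg_poisson t y x : 0 < y ->
  (fun n => poisson t (y + n.+1%:R^-1) x) @ \oo --> poisson t y x.
Proof.
move=> y0; apply: cvgV; first by rewrite gt_eqF// poisson_den_gt0.
apply: cvgD; first exact: cvg_cst.
by rewrite !expr2; apply: cvgM; exact: cvg_shift_harmonic.
Qed.

(** Partial fractions express products of kernels at distinct heights only;
    equal heights are limits of distinct ones. *)
Lemma hull_mul_limit t g y (M : R) : 0 < y -> (forall x, `|g x| <= M) ->
  (forall z, 0 < z -> z != y -> hull t (fun x => g x * poisson t z x)) ->
  forall z, 0 < z -> hull t (fun x => g x * poisson t z x).
Proof.
move=> y0 gM h z z0; have [->|] := eqVneq z y; last exact: h.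
apply: (@hull_lim _ (fun n x => g x * poisson t (y + n.+1%:R^-1) x) _ (M * y ^- 2)).
- move=> n; apply: h; first by rewrite addr_gt0.
  by rewrite gt_eqF// ltrDl.
- move=> n x; rewrite normrM ler_pM//.
  have yn : 0 < y + n.+1%:R^-1 by rewrite addr_gt0.
  rewrite (le_trans (poisson_norm _ _ yn))// lef_pV2 ?posrE ?exprn_gt0//.
  by rewrite lerXn2r ?nnegrE ?ltW// ltrDl.
- by move=> x; apply: cvgM; [exact: cvg_cst|exact: cvg_poisson].
Qed.

Lemma hull_poisson_poisson t y z : 0 < y -> 0 < z -> hull t (fun x => poisson t y x * poisson t z x).
Proof.
move=> y0 z0; apply: (hull_mul_limit (y := y) (M := y ^- 2)) => // [x|u u0 uy].
  exact: poisson_norm.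
apply: (@eq_hull _ (fun x => (u ^+ 2 - y ^+ 2)^-1 * (poisson t y x + (-1) * poisson t u x))).
  by move=> x; rewrite mulN1r -poisson_mul// eq_sym.
by apply: hullZ; apply: hullD; [|apply: hullZ]; exact: hull_poisson.
Qed.

Lemma hull_cpoisson_poisson t y z : 0 < y -> 0 < z -> hull t (fun x => cpoisson t y x * poisson t z x).
Proof.
move=> y0 z0; apply: (hull_mul_limit (y := y) (M := y^-1)) => // [x|u u0 uy].
  exact: cpoisson_norm.
apply: (@eq_hull _ (fun x => (u ^+ 2 - y ^+ 2)^-1 * (cpoisson t y x + (-1) * cpoisson t u x))).
  by move=> x; rewrite mulN1r /cpoisson -mulrBr mulrCA -poisson_mul// 1?eq_sym// mulrA.
by apply: hullZ; apply: hullD; [|apply: hullZ]; exact: hull_cpoisson.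
Qed.

Lemma hull_cpoisson_cpoisson t y z : 0 < y -> 0 < z -> hull t (fun x => cpoisson t y x * cpoisson t z x).
Proof.
move=> y0 z0.
apply: (@eq_hull _ (fun x => poisson t z x + (- y ^+ 2) * (poisson t y x * poisson t z x))).
  move=> x; rewrite /cpoisson; transitivity (poisson t z x * (poisson t y x * ((x - t) ^+ 2 + y ^+ 2))
     - y ^+ 2 * (poisson t y x * poisson t z x)); last by ring.
  by rewrite poissonV// mulr1 mulNr.
by apply: hullD; [exact: hull_poisson|apply: hullZ; exact: hull_poisson_poisson].
Qed.

(** Multiplication by a bounded [g] commutes with sums and bounded limits, so
    kernels suffice. *)
Lemma hullM_ind t g : (exists M, forall x, `|g x| <= M) ->
  (forall y, 0 < y -> hull t (fun x => g x * poisson t y x) /\ hull t (fun x => g x * cpoisson t y x)) ->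
  forall f, hull t f -> hull t (fun x => g x * f x).
Proof.
move=> [M gM] gen f.
elim=> {f} [y y0|y y0|f h _ hf _ hh|c f _ hf|f_ f N _ hf fN cf].
- exact: (gen y y0).1.
- exact: (gen y y0).2.
- by apply: (eq_hull _ (hullD hf hh)) => x; rewrite mulrDr.
- by apply: (eq_hull _ (hullZ c hf)) => x; rewrite mulrCA.
- apply: (@hull_lim _ (fun n x => g x * f_ n x) _ (M * N)) => // [n x|x].
    by rewrite normrM ler_pM.
  by apply: cvgM; [exact: cvg_cst|exact: cf].
Qed.

Lemma hullM t f g : hull t f -> hull t g -> hull t (fun x => f x * g x).
Proof.
move=> hf hg.
have kf k : hull t k -> (forall y, 0 < y -> hull t (fun x => k x * poisson t y x) /\
    hull t (fun x => k x * cpoisson t y x)) -> hull t (fun x => f x * k x).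
  move=> hk kk; apply: (@eq_hull _ (fun x => k x * f x)); first by move=> x; exact: mulrC.
  exact: hullM_ind (hull_bounded hk) kk _ hf.
apply: (hullM_ind (hull_bounded hf) _ hg) => y y0; split; apply: kf.
- exact: hull_poisson.
- move=> z z0; split; first exact: hull_poisson_poisson.
  apply: (@eq_hull _ (fun x => cpoisson t z x * poisson t y x)); first by move=> x; exact: mulrC.
  exact: hull_cpoisson_poisson.
- exact: hull_cpoisson.
- by move=> z z0; split; [exact: hull_cpoisson_poisson|exact: hull_cpoisson_cpoisson].
Qed.

(** Poisson kernels normalised at their peak flatten out as their height
    grows. *)
Lemma hull1 t : hull t (fun=> 1).
Proof.
apply: (@hull_lim _ (fun n x => n.+1%:R ^+ 2 * poisson t n.+1%:R x) _ 1).
- by move=> n; apply: hullZ; exact: hull_poisson.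
- move=> n x; have k0 := poisson_gt0 t x (ltr0Sn R n); rewrite ger0_norm ?mulr_ge0 ?sqr_ge0 ?(ltW k0)//.
  by rewrite -ler_pdivlMl ?exprn_gt0// mulr1 poisson_le.
- move=> x.
  have -> : (fun n => n.+1%:R ^+ 2 * poisson t n.+1%:R x) =
            (fun n => ((x - t) ^+ 2 * (n.+1%:R^-1 * n.+1%:R^-1) + 1)^-1).
    apply/funext => n; have n0 : (n.+1%:R : R) != 0 by rewrite pnatr_eq0.
    have := poisson_den_gt0 t x (ltr0Sn R n); rewrite /poisson => /lt0r_neq0 h.
    rewrite -[LHS]invrK invfM invrK; congr (_^-1).
    by rewrite mulrDr mulVf ?expf_neq0// mulrC -exprVn expr2.
  rewrite -[X in _ --> X]invr1; apply: cvgV; first exact: oner_neq0.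
  rewrite -[X in _ --> X](add0r 1) -(mulr0 ((x - t) ^+ 2)); apply: cvgD; last exact: cvg_cst.
  apply: cvgM; first exact: cvg_cst.
  by rewrite -[X in _ --> X](mulr0 0); apply: cvgM; exact: cvg_harmonic.
Qed.

Lemma hullC t c : hull t (fun=> c).
Proof. by apply: (eq_hull _ (hullZ c (hull1 t))) => x; rewrite mulr1. Qed.

End kernel_class.

Section sharpening.
Context (R : realType).
Implicit Types (a x c t : R).

(** Iterating this polynomial drives the numbers of [ [0, 1] ] on either side of
    its repelling fixed point 1/2 to 0 and 1.  It turns a function in an algebra
    into a threshold function in its closure. *)
Definition sharpen a : R := a ^+ 2 * (3 - 2 * a).

Lemma sharpen_ge0_le1 n a : 0 <= a <= 1 -> 0 <= iter n sharpen a <= 1.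
Proof.
move=> a01; elim: n => [//|n]; rewrite iterS; move: (iter n _ _) => b.
move=> /andP[b0 b1]; rewrite /sharpen; apply/andP; split.
  by rewrite mulr_ge0 ?sqr_ge0//; lra.
have -> : b ^+ 2 * (3 - 2 * b) = 1 - (1 - b) ^+ 2 * (1 + 2 * b) by ring.
by rewrite gerBl mulr_ge0 ?sqr_ge0//; lra.
Qed.

Lemma sharpenC n a : iter n sharpen (1 - a) = 1 - iter n sharpen a.
Proof. by elim: n => [//|n]; rewrite !iterS => ->; rewrite /sharpen; ring. Qed.

(** One step multiplies [b] by [b (3 - 2 b)], which increases with [b] below 1/2,
    and the iterates decrease. *)
Lemma sharpen_lt n a : 0 <= a -> a < 2^-1 ->
  0 <= iter n sharpen a <= (a * (3 - 2 * a)) ^+ n * a.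
Proof.
move=> a0 a2; elim: n => [|n]; first by rewrite expr0 mul1r lexx a0.
have ah : a < 1 / 2 by rewrite div1r.
have c01 : 0 <= a * (3 - 2 * a) <= 1.
  rewrite mulr_ge0//=; last by lra.
  have -> : a * (3 - 2 * a) = 1 - (1 - a) * (1 - 2 * a) by ring.
  by rewrite gerBl mulr_ge0//; lra.
rewrite iterS exprS; set c := a * (3 - 2 * a) in c01 *.
have [c0 c1] := andP c01.
have := exprn_ge0 n c0; have := exprn_ile1 n c0 c1.
move: (c ^+ n) (iter n _ _) => d b d1 d0 /andP[b0 bd].
have ba : b <= a by nra.
have bc : b * (3 - 2 * b) <= c.
  rewrite /c -subr_ge0.
  have -> : a * (3 - 2 * a) - b * (3 - 2 * b) = (a - b) * (3 - 2 * (a + b)) by ring.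
  by rewrite mulr_ge0//; lra.
have b3 : 0 <= b * (3 - 2 * b) by rewrite mulr_ge0//; lra.
rewrite /sharpen expr2 -mulrA.
apply/andP; split; first exact: mulr_ge0.
by rewrite mulrC -mulrA ler_pM.
Qed.

Definition half_step a : R := if a < 2^-1 then 0 else if 2^-1 < a then 1 else 2^-1.

Lemma cvg_sharpen_lt a : 0 <= a -> a < 2^-1 -> (fun n => iter n sharpen a) @ \oo --> (0 : R).
Proof.
move=> a0 a2; have ah : a < 1 / 2 by rewrite div1r.
have cl : (fun n => (a * (3 - 2 * a)) ^+ n * a) @ \oo --> (0 : R).
  rewrite -[X in _ --> X](mul0r a); apply: cvgM; last exact: cvg_cst.
  apply: cvg_expr; rewrite ger0_norm; last by rewrite mulr_ge0//; lra.
  have -> : a * (3 - 2 * a) = 1 - (1 - a) * (1 - 2 * a) by ring.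
  by rewrite gtrBl mulr_gt0//; lra.
apply: squeeze_cvgr (cvg_cst _) cl.
by apply: nearW => n; exact: sharpen_lt.
Qed.

Lemma cvg_sharpen a : 0 <= a <= 1 -> (fun n => iter n sharpen a) @ \oo --> half_step a.
Proof.
move=> /andP[a0 a1]; rewrite /half_step; case: ltgtP => [a2|a2|->].
- exact: cvg_sharpen_lt.
- have -> : (fun n => iter n sharpen a) = (fun n => 1 - iter n sharpen (1 - a)).
    by apply/funext => n; rewrite sharpenC subKr.
  rewrite -[X in _ --> X]subr0; apply: cvgB; first exact: cvg_cst.
  apply: cvg_sharpen_lt; first by rewrite subr_ge0.
  have : 1 / 2 < a by rewrite div1r.
  by rewrite -div1r; lra.
- have -> : (fun n => iter n sharpen 2^-1) = (fun=> 2^-1); last exact: cvg_cst.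
  apply/funext => n; elim: n => [//|n IH]; rewrite iterS IH /sharpen.
  by field.
Qed.

End sharpening.

Section hull_borel.
Context (R : realType).
Implicit Types (t c x : R).

(** [(x - c) * poisson t 1 x] changes sign exactly at [c] and stays bounded at
    infinity, unlike [x - c]; it is rescaled to make 1/2 the threshold. *)
Definition ramp t c x : R := 2^-1 + (2 * (1 + `|t - c|))^-1 * ((x - c) * poisson t 1 x).

Lemma ramp_bound t c x : `|(x - c) * poisson t 1 x| <= 1 + `|t - c|.
Proof.
have -> : (x - c) * poisson t 1 x = cpoisson t 1 x + (t - c) * poisson t 1 x.
  by rewrite /cpoisson; ring.
rewrite (le_trans (ler_normD _ _))// lerD//.
  by have := cpoisson_norm t x (ltr01 : 0 < 1 :> R); rewrite invr1.
rewrite normrM ler_piMr//.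
by have := poisson_norm t x (ltr01 : 0 < 1 :> R); rewrite expr1n invr1.
Qed.

Lemma ramp01 t c x : 0 <= ramp t c x <= 1.
Proof.
have := ramp_bound t c x; rewrite /ramp.
have d0 : 0 < 1 + `|t - c| by rewrite ltr_pwDl.
move: (_ * poisson _ _ _) (1 + _) d0 => u d d0; rewrite ler_norml => /andP[u1 u2].
have h1 : - 2^-1 <= (2 * d)^-1 * u.
  by rewrite invfM -mulrA -mulrN1 ler_pM2l// ler_pdivlMl// mulrN1.
have h2 : (2 * d)^-1 * u <= 2^-1.
  by rewrite invfM -mulrA -[leRHS]mulr1 ler_pM2l// ler_pdivrMl// mulr1.
have k2 : (2^-1 : R) = 1 / 2 by rewrite div1r.
by rewrite k2 in h1 h2 *; apply/andP; split; lra.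
Qed.

Lemma ramp_half t c x : half_step (ramp t c x) =
  if x < c then 0 else if c < x then 1 else 2^-1.
Proof.
have k0 : 0 < (2 * (1 + `|t - c|))^-1 :> R.
  by rewrite invr_gt0 mulr_gt0// ltr_pwDl.
have w0 : 0 < poisson t 1 x by exact: poisson_gt0.
rewrite /half_step /ramp ltrDl gtrDl.
by rewrite pmulr_rlt0// pmulr_rgt0// pmulr_llt0// pmulr_lgt0// subr_lt0 subr_gt0.
Qed.

Lemma hull_ramp t c : hull t (ramp t c).
Proof.
apply: hullD; first exact: hullC.
apply: hullZ; apply: (@eq_hull _ _ (fun x => cpoisson t 1 x + (t - c) * poisson t 1 x)).
  by move=> x; rewrite /cpoisson; ring.
by apply: hullD; [exact: hull_cpoisson|apply: hullZ; exact: hull_poisson].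
Qed.

Lemma hull_sharpen t f n : hull t f -> hull t (fun x => iter n (@sharpen R) (f x)).
Proof.
move=> hf; elim: n => [//|n IH].
apply: hullM; first exact: hullM.
apply: hullD; first exact: hullC.
by apply: (eq_hull _ (hullZ (-2) IH)) => x; rewrite mulNr.
Qed.

Lemma hull_half_step t c : hull t (fun x => half_step (ramp t c x)).
Proof.
apply: (@hull_lim _ _ (fun n x => iter n (@sharpen R) (ramp t c x)) _ 1) => [n|n x|x].
- apply: hull_sharpen; exact: hull_ramp.
- by have /andP[h0 h1] := sharpen_ge0_le1 n (ramp01 t c x); rewrite ger0_norm.
- apply: cvg_sharpen; exact: ramp01.
Qed.

(** The threshold function takes the value 1/2 at its endpoint, hence the
    thresholds that tend to [c] from below. *)
Lemma hull_ray t c : hull t (\1_(`[c, +oo[%classic : set R)).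
Proof.
apply: (@hull_lim _ _ (fun n x => half_step (ramp t (c - n.+1%:R^-1) x)) _ 1).
- by move=> n; exact: hull_half_step.
- move=> n x; rewrite ramp_half; case: ifP => _; first by rewrite normr0.
  by case: ifP => _; rewrite ?normr1// ger0_norm// invf_le1// ler1n.
- move=> x; rewrite indicE; have [cx|xc] := leP c x.
    rewrite mem_set /=; last by rewrite in_itv/= cx.
    apply: cvg_near_cst; apply: nearW => n; rewrite ramp_half.
    have h : c - n.+1%:R^-1 < x by rewrite (lt_le_trans _ cx)// gtrBl.
    by rewrite h ltNge (ltW h).
  rewrite memNset /=; last by rewrite in_itv/= andbT leNgt xc.
  apply: cvg_near_cst.
  have := @cvg_shift_harmonic R 0; rewrite -subr_gt0 in xc.
  move=> /cvgrPdist_lt/(_ _ xc); apply: filterS => n.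
  rewrite !add0r normrN gtr0_norm// ramp_half => h.
  by rewrite ltrBrDl -ltrBrDr h.
Qed.

(** Rays generate the Borel sets and are stable under intersection; the sets
    with indicator in the hull form a Dynkin system, as the partial sums of
    disjoint indicators are bounded by 1. *)
Lemma hull_indic t (B : set (mT R)) : measurable B -> hull t (\1_B : R -> R).
Proof.
move=> mB.
have genE : @measurable _ (mT R) = <<s @RGenCInfty.G R >> by exact: RGenCInfty.measurableE.
apply: (@dynkin_induction _ (mT R) (@RGenCInfty.G R)
  (fun B => hull t (\1_B : R -> R)) genE) => //.
- move=> _ _ [x ->] [y ->]; exists (Num.max x y).
  apply/seteqP; split=> z; rewrite /= !in_itv/= !andbT ge_max; last by move=> /andP[].
  by move=> [-> ->].
- by apply: (eq_hull _ (hull1 t)) => x; rewrite indicE in_setT.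
- by move=> _ [x ->]; exact: hull_ray.
- move=> S _ hS; apply: (eq_hull _ (hullD (hull1 t) (hullZ (-1) hS))) => x.
  by rewrite indicC indicE; case: (_ \in _); rewrite /= ?mulN1r ?subrr// oppr0 addr0.
- move=> F mF tF hF.
  have sumE n x k : F k x -> \sum_(0 <= i < n) (\1_(F i) x : R) = (k < n)%N%:R.
    move=> Fkx; elim: n => [|n IH]; first by rewrite big_geq.
    rewrite big_nat_recr//= IH indicE ltnS (leq_eqVlt k).
    have [Fnx|Fnx] := pselect (F n x).
      have -> : n = k by apply: (tF n k) => //; exists x.
      by rewrite mem_set// eqxx ltnn add0r.
    rewrite memNset//= addr0; have [kn|//] := eqVneq k n.
    by rewrite kn in Fkx.
  have sum0 n x : ~ (exists k, F k x) -> \sum_(0 <= i < n) (\1_(F i) x : R) = 0.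
    move=> h; rewrite big1// => i _; rewrite indicE memNset// => Fx.
    by apply: h; exists i.
  apply: (@hull_lim _ _ (fun n x => \sum_(0 <= i < n) \1_(F i) x) _ 1).
  + elim=> [|n IH].
      by apply: (eq_hull _ (hullC t 0)) => x; rewrite big_geq.
    by apply: (eq_hull _ (hullD IH (hF n))) => x; rewrite big_nat_recr.
  + move=> n x; have [[k Fkx]|h] := pselect (exists k, F k x).
      by rewrite (sumE _ _ _ Fkx) ger0_norm ?ler0n// lern1 leq_b1.
    by rewrite sum0// normr0.
  + move=> x; have [[k Fkx]|h] := pselect (exists k, F k x).
      rewrite indicE mem_set; last by exists k.
      apply: cvg_near_cst; exists k.+1 => // n /= kn.
      by rewrite (sumE _ _ _ Fkx) kn.
    rewrite indicE memNset; last by move=> [k _ Fkx]; apply: h; exists k.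
    by apply: cvg_near_cst; apply: nearW => n; rewrite sum0.
- by rewrite -genE.
Qed.

End hull_borel.

(** * Evaluation at nonreal points *)

Section cauchy_schwarz.
Context (R : realType) (mu : {measure set (mT R) -> \bar R}) (mom : all_moments mu).
Implicit Types f g : R -> R.

Lemma discriminant_le (a b c : R) : 0 <= a -> 0 <= c ->
  (forall s, 2 * s * b <= s ^+ 2 * a + c) -> b ^+ 2 <= a * c.
Proof.
move=> a0 c0 h; have [a_gt0|/(conj a0)/andP/le_anti a00] := ltP 0 a.
  have := h (b / a); rewrite -(ler_pM2r a_gt0).
  have -> : 2 * (b / a) * b * a = 2 * b ^+ 2 by field; rewrite gt_eqF.
  have -> : ((b / a) ^+ 2 * a + c) * a = b ^+ 2 + a * c by field; rewrite gt_eqF.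
  by rewrite mulr_natl mulr2n lerD2l.
rewrite -a00 mul0r; have [->|b0] := eqVneq b 0; first by rewrite expr0n.
have := h ((c + 1) / b); rewrite -a00 mulr0 add0r.
have -> : 2 * ((c + 1) / b) * b = 2 * (c + 1) by field.
lra.
Qed.

Lemma ig_cauchy_schwarz f g : tame f -> tame g ->
  (ig mu (fun x => f x * g x)) ^+ 2 <=
  ig mu (fun x => f x ^+ 2) * ig mu (fun x => g x ^+ 2).
Proof.
move=> tf tg; apply: discriminant_le; do ?[by apply: ig_ge0 => x; exact: sqr_ge0].
move=> s.
have tf2 : tame (fun x => s ^+ 2 * f x ^+ 2) by tame_tac.
have tg2 : tame (fun x => g x ^+ 2) by tame_tac.
rewrite -ig_cstM//; last by tame_tac.
rewrite -[X in _ <= X + _]ig_cstM//; last by tame_tac.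
rewrite -igD//; apply: (ig_le mom) => // [||x]; [by tame_tac|by tame_tac|].
by have := sqr_ge0 (s * f x - g x); nra.
Qed.

Lemma ig_norm_sqr f : tame f ->
  (ig mu (fun x => `|f x|)) ^+ 2 <= ig mu (fun=> 1) * ig mu (fun x => f x ^+ 2).
Proof.
move=> tf; have := ig_cauchy_schwarz (tame_cst (1 : R)) (tame_norm tf).
have -> : (fun x => 1 * `|f x|) = (fun x => `|f x|).
  by apply/funext => x; rewrite mul1r.
have -> : (fun x => `|f x| ^+ 2) = (fun x => f x ^+ 2).
  by apply/funext => x; rewrite real_normK ?num_real.
by have -> : (fun x : R => (1 : R) ^+ 2) = (fun=> 1) by apply/funext => x; rewrite expr1n.
Qed.

End cauchy_schwarz.

Section uniqueness.
Context (R : realType) (mu nu : {measure set (mT R) -> \bar R}).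
Hypotheses (mmom : all_moments mu) (nmom : all_moments nu).

(** A measure is determined by its Cauchy transform on one vertical half-line,
    because integration respects the operations that generate the hull. *)
Lemma measure_eq_kernels (t : R) :
  (forall y, 0 < y -> ig mu (poisson t y) = ig nu (poisson t y)) ->
  (forall y, 0 < y -> ig mu (cpoisson t y) = ig nu (cpoisson t y)) ->
  forall B : set (mT R), measurable B -> mu B = nu B.
Proof.
move=> hre him.
have H f : hull t f -> tame f /\ ig mu f = ig nu f.
  elim=> {f} [y y0|y y0|f g _ [tf ef] _ [tg eg]|c f _ [tf ef]|f_ f M _ h fM cf].
  - by split; [exact: tame_poisson|exact: hre].
  - by split; [exact: tame_cpoisson|exact: him].
  - by split; [exact: tameD|rewrite !igD// ef eg].
  - by split; [exact: tameM (tame_cst c) tf|rewrite !ig_cstM// ef].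
  - have tM : tame (fun=> M : R) by exact: tame_cst.
    have [tf c1] := ig_dct mmom (fun n => (h n).1) tM fM cf.
    have [_ c2] := ig_dct nmom (fun n => (h n).1) tM fM cf.
    split=> //; have E : (fun n => ig mu (f_ n)) = (fun n => ig nu (f_ n)).
      by apply/funext => n; exact: (h n).2.
    by rewrite -(cvg_lim _ c1)// E (cvg_lim _ c2).
move=> B mB; have [_] := H _ (hull_indic t mB).
rewrite !ig_indic// => e.
by rewrite -[LHS]fineK -1?[RHS]fineK ?e//; exact: measure_fin.
Qed.

End uniqueness.

Section bounded_evaluation.
Context (R : realType) (gamma : nat -> R) (mu nu : {measure set (mT R) -> \bar R}).
Hypotheses (rmu : represents gamma mu) (rnu : represents gamma nu).
Implicit Types (t y e o : R) (p q : {poly R}).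

Local Notation mmu := (rmu.1).
Local Notation mnu := (rnu.1).

(** Up to the factor [y] of [dpoisson], the imaginary and real parts of the
    difference of the two Cauchy transforms at [t + i y]. *)
Definition dpoisson t y := ig mu (poisson t y) - ig nu (poisson t y).
Definition dcpoisson t y := ig mu (cpoisson t y) - ig nu (cpoisson t y).

Lemma ig_poly_eq p : ig mu (fun x => p.[x]) = ig nu (fun x => p.[x]).
Proof. by rewrite (ig_poly _ rmu) (ig_poly _ rnu). Qed.

Lemma mlin_norm_sqr kappa p : represents gamma kappa ->
  (ig kappa (fun x => `|p.[x]|)) ^+ 2 <= gamma 0%N * mlin gamma (p ^+ 2).
Proof.
move=> rk; have := ig_norm_sqr rk.1 (tame_poly p).
have -> : ig kappa (fun=> 1) = gamma 0%N by rewrite -(ig_monomial 0 rk).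
suff -> : ig kappa (fun x => p.[x] ^+ 2) = mlin gamma (p ^+ 2) by [].
by rewrite -(ig_poly _ rk); congr ig; apply/funext => x; rewrite horner_exp.
Qed.

Let quad q e o t y := q * quadp t y + e%:P + o%:P * ('X - t%:P).

Lemma quad_horner q e o t y x : (quad q e o t y).[x] =
  q.[x] * ((x - t) ^+ 2 + y ^+ 2) + e + o * (x - t).
Proof. by rewrite /quad /quadp !hornerE. Qed.

Lemma quad_poisson q e o t y x : 0 < y ->
  (quad q e o t y).[x] * poisson t y x = q.[x] + (e * poisson t y x + o * cpoisson t y x).
Proof.
move=> y0; rewrite quad_horner /cpoisson.
have := poissonV t x y0; move: (poisson t y x) => k kE.
transitivity (q.[x] * (k * ((x - t) ^+ 2 + y ^+ 2)) + (e * k + o * ((x - t) * k))).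
  by ring.
by rewrite kE mulr1.
Qed.

Lemma quad_cpoisson q e o t y x : 0 < y -> (quad q e o t y).[x] * cpoisson t y x =
  (q * ('X - t%:P) + o%:P).[x] + (e * cpoisson t y x + (- (y ^+ 2 * o)) * poisson t y x).
Proof.
move=> y0; rewrite quad_horner !(hornerD, hornerM, hornerN, hornerC, hornerX) /cpoisson.
have := poissonV t x y0; move: (poisson t y x) => k kE.
transitivity ((q.[x] * (x - t) + o) * (k * ((x - t) ^+ 2 + y ^+ 2)) +
   (e * ((x - t) * k) + (- (y ^+ 2 * o)) * k)).
  by ring.
by rewrite kE mulr1.
Qed.

(** Both solutions integrate the quotient by [quadp] in the same way, so that
    the difference sees the remainder only. *)
Lemma diff_quad_poisson q e o t y : 0 < y ->
  ig mu (fun x => (quad q e o t y).[x] * poisson t y x) -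
  ig nu (fun x => (quad q e o t y).[x] * poisson t y x) = e * dpoisson t y + o * dcpoisson t y.
Proof.
move=> y0; have tr := tame_poisson t y0; have ti := tame_cpoisson t y0.
have E kappa : all_moments kappa -> ig kappa (fun x => (quad q e o t y).[x] * poisson t y x) =
    ig kappa (fun x => q.[x]) + (e * ig kappa (poisson t y) + o * ig kappa (cpoisson t y)).
  move=> mk; under [X in ig kappa X]eq_fun do rewrite quad_poisson//.
  by rewrite igD ?igD ?ig_cstM//; tame_tac.
by rewrite (E _ mmu) (E _ mnu) ig_poly_eq /dpoisson /dcpoisson; ring.
Qed.

Lemma diff_quad_cpoisson q e o t y : 0 < y ->
  ig mu (fun x => (quad q e o t y).[x] * cpoisson t y x) -
  ig nu (fun x => (quad q e o t y).[x] * cpoisson t y x) =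
  e * dcpoisson t y - y ^+ 2 * o * dpoisson t y.
Proof.
move=> y0; have tr := tame_poisson t y0; have ti := tame_cpoisson t y0.
have E kappa : all_moments kappa -> ig kappa (fun x => (quad q e o t y).[x] * cpoisson t y x) =
    ig kappa (fun x => (q * ('X - t%:P) + o%:P).[x]) +
    (e * ig kappa (cpoisson t y) + (- (y ^+ 2 * o)) * ig kappa (poisson t y)).
  move=> mk; under [X in ig kappa X]eq_fun do rewrite quad_cpoisson//.
  by rewrite igD ?igD ?ig_cstM//; tame_tac.
by rewrite (E _ mmu) (E _ mnu) ig_poly_eq /dpoisson /dcpoisson; ring.
Qed.

Lemma diff_bound p f (M : R) : 0 <= M -> tame f -> (forall x, `|f x| <= M) ->
  (ig mu (fun x => p.[x] * f x) - ig nu (fun x => p.[x] * f x)) ^+ 2 <=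
  4 * M ^+ 2 * (gamma 0%N * mlin gamma (p ^+ 2)).
Proof.
move=> M0 tf fM.
have B kappa : represents gamma kappa ->
    `|ig kappa (fun x => p.[x] * f x)| <= M * ig kappa (fun x => `|p.[x]|).
  move=> rk; rewrite -(ig_cstM rk.1); last by tame_tac.
  apply: (le_trans (ig_norm rk.1 _)); first by tame_tac.
  apply: (ig_le rk.1); [by tame_tac|by tame_tac|move=> x].
  by rewrite normrM mulrC ler_wpM2r.
have := B _ rmu; have := B _ rnu.
have := mlin_norm_sqr p rmu; have := mlin_norm_sqr p rnu.
have : 0 <= ig mu (fun x => `|p.[x]|) by apply: ig_ge0.
have : 0 <= ig nu (fun x => `|p.[x]|) by apply: ig_ge0.
move: (ig mu (fun x => `|_|)) (ig nu (fun x => `|_|)) => a b b0 a0.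
move: (_ * mlin _ _) (ig mu _) (ig nu _) => L u v bL aL vb ua.
have uv : `|u - v| <= M * (a + b).
  by rewrite (le_trans (ler_normB _ _))// mulrDr lerD.
rewrite -(real_normK (num_real (u - v))).
apply: (@le_trans _ _ ((M * (a + b)) ^+ 2)).
  by rewrite lerXn2r ?nnegrE ?mulr_ge0 ?addr_ge0.
have h : (a + b) ^+ 2 <= 4 * L by have := sqr_ge0 (a - b); nra.
by rewrite exprMn (le_trans (ler_wpM2l (sqr_ge0 M) h))// mulrCA mulrA.
Qed.

(** The value of a polynomial at [t + i y] times the difference of the Cauchy
    transforms there is the difference of the integrals of the polynomial
    against the kernel [1 / (x - t - i y)], which the Cauchy-Schwarz inequality
    bounds by the L2 norm. *)
Lemma nonreal_evaluation q e o t y : 0 < y ->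
  (e ^+ 2 + (y * o) ^+ 2) * ((y * dpoisson t y) ^+ 2 + dcpoisson t y ^+ 2) <=
  8 * y ^- 2 * (gamma 0%N * mlin gamma (quad q e o t y ^+ 2)).
Proof.
move=> y0.
have yV0 : 0 <= y^-1 by rewrite invr_ge0 ltW.
have yV20 : 0 <= y ^- 2 by rewrite invr_ge0 exprn_ge0// ltW.
have := diff_bound (quad q e o t y) yV20 (tame_poisson t y0) (fun x => poisson_norm t x y0).
have := diff_bound (quad q e o t y) yV0 (tame_cpoisson t y0) (fun x => cpoisson_norm t x y0).
rewrite diff_quad_poisson// diff_quad_cpoisson// => h1 h2.
move: (_ * mlin _ _) h1 h2 => L h1 h2.
have -> : (e ^+ 2 + (y * o) ^+ 2) * ((y * dpoisson t y) ^+ 2 + dcpoisson t y ^+ 2) =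
  y ^+ 2 * (e * dpoisson t y + o * dcpoisson t y) ^+ 2 +
  (e * dcpoisson t y - y ^+ 2 * o * dpoisson t y) ^+ 2 by ring.
have y2 : 0 <= y ^+ 2 by rewrite sqr_ge0.
have := ler_wpM2l y2 h2.
have -> : y ^+ 2 * (4 * y ^- 2 ^+ 2 * L) = 4 * y ^- 2 * L by field; rewrite gt_eqF.
rewrite exprVn in h1.
by move: (y ^- 2) h1 => w h1 h3; lra.
Qed.

End bounded_evaluation.

(** * Evaluation at real points *)

Section local_bound.
Context (R : realType).
Implicit Types (t y e o : R) (p q : {poly R}).

Lemma poisson_lipschitz y s t x : 0 < y ->
  `|poisson s y x - poisson t y x| <= (2 * y ^- 3) * `|s - t|.
Proof.
move=> y0.
have -> : poisson s y x - poisson t y x =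
    (s - t) * (cpoisson s y x * poisson t y x + cpoisson t y x * poisson s y x).
  have h1 : (x - s) ^+ 2 + y ^+ 2 != 0 by rewrite gt_eqF// poisson_den_gt0.
  have h2 : (x - t) ^+ 2 + y ^+ 2 != 0 by rewrite gt_eqF// poisson_den_gt0.
  by rewrite /cpoisson /poisson; field; apply/andP.
rewrite normrM mulrC ler_wpM2r//.
have B u v : `|cpoisson u y x * poisson v y x| <= y ^- 3.
  by rewrite normrM exprS invfM ler_pM ?cpoisson_norm ?poisson_norm.
by rewrite (le_trans (ler_normD _ _))// mulr_natl mulr2n lerD.
Qed.

Lemma cpoisson_lipschitz y s t x : 0 < y ->
  `|cpoisson s y x - cpoisson t y x| <= (2 * y ^- 2) * `|s - t|.
Proof.
move=> y0.
have -> : cpoisson s y x - cpoisson t y x =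
    (s - t) * (cpoisson s y x * cpoisson t y x - y ^+ 2 * (poisson s y x * poisson t y x)).
  have h1 : (x - s) ^+ 2 + y ^+ 2 != 0 by rewrite gt_eqF// poisson_den_gt0.
  have h2 : (x - t) ^+ 2 + y ^+ 2 != 0 by rewrite gt_eqF// poisson_den_gt0.
  by rewrite /cpoisson /poisson; field; apply/andP.
rewrite normrM mulrC ler_wpM2r//.
rewrite (le_trans (ler_normB _ _))// mulr_natl mulr2n lerD//.
  by rewrite normrM expr2 invfM ler_pM ?cpoisson_norm.
have h : `|poisson s y x * poisson t y x| <= y ^- 2 * y ^- 2.
  by rewrite normrM ler_pM ?poisson_norm.
rewrite normrM ger0_norm ?sqr_ge0// (le_trans (ler_wpM2l (sqr_ge0 y) h))//.
by rewrite mulrA mulfV ?mul1r// expf_neq0// gt_eqF.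
Qed.

Lemma cvg_sum_sqr (f g : R -> R) (a b y t : R) :
  f s @[s --> t] --> a -> g s @[s --> t] --> b ->
  (y * f s) ^+ 2 + g s ^+ 2 @[s --> t] --> (y * a) ^+ 2 + b ^+ 2.
Proof.
move=> fa gb; have ya : y * f s @[s --> t] --> y * a by apply: cvgM => //; exact: cvg_cst.
have -> : (fun s => (y * f s) ^+ 2 + g s ^+ 2) =
          (fun s => (y * f s) * (y * f s) + g s * g s).
  by apply/funext => s; rewrite !expr2.
by rewrite !expr2; apply: cvgD; apply: cvgM.
Qed.

Lemma cvg_lipschitz (f : R -> R) (K : R) t : (forall s, `|f s - f t| <= K * `|s - t|) ->
  f s @[s --> t] --> f t.
Proof.
move=> fK; apply/cvgrPdist_lt => d d0.
have K0 : 0 < `|K| + 1 by rewrite ltr_pwDr.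
exists (d / (`|K| + 1)) => /=; first by rewrite divr_gt0.
move=> s; rewrite /ball/= ltr_pdivlMr// => st.
rewrite distrC (le_lt_trans (fK s))// distrC (le_lt_trans _ st)//.
rewrite mulrC ler_wpM2l// (le_trans (ler_norm _))//.
by rewrite lerDl.
Qed.

Context (gamma : nat -> R) (mu nu : {measure set (mT R) -> \bar R}).
Hypotheses (rmu : represents gamma mu) (rnu : represents gamma nu).

Lemma ig_lipschitz kappa (F : R -> R -> R) (K : R) : all_moments kappa ->
  (forall t, tame (F t)) -> (forall s t x, `|F s x - F t x| <= K * `|s - t|) ->
  forall t, (fun s => ig kappa (F s)) s @[s --> t] --> ig kappa (F t).
Proof.
move=> mk tF FK t; apply: (@cvg_lipschitz _ (K * ig kappa (fun=> 1))) => s.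
rewrite -igB// mulrAC -ig_cst//.
apply: (le_trans (ig_norm mk _)).
  by apply: tameD; [exact: tF|apply: tameN; exact: tF].
apply: ig_le => //; last exact: tame_cst.
by apply: tame_norm; apply: tameD; [exact: tF|apply: tameN; exact: tF].
Qed.

Lemma cvg_dpoisson y t : 0 < y -> dpoisson mu nu s y @[s --> t] --> dpoisson mu nu t y.
Proof.
by move=> y0; apply: cvgB; apply: (ig_lipschitz (K := 2 * y ^- 3)) => //;
  [exact: rmu.1|move=> *; exact: tame_poisson|move=> *; exact: poisson_lipschitz|
   exact: rnu.1|move=> *; exact: tame_poisson|move=> *; exact: poisson_lipschitz].
Qed.

Lemma cvg_dcpoisson y t : 0 < y -> dcpoisson mu nu s y @[s --> t] --> dcpoisson mu nu t y.
Proof.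
by move=> y0; apply: cvgB; apply: (ig_lipschitz (K := 2 * y ^- 2)) => //;
  [exact: rmu.1|move=> *; exact: tame_cpoisson|move=> *; exact: cpoisson_lipschitz|
   exact: rnu.1|move=> *; exact: tame_cpoisson|move=> *; exact: cpoisson_lipschitz].
Qed.

Hypothesis neq : exists2 B : set (mT R), measurable B & mu B <> nu B.

Let modulus t y := (y * dpoisson mu nu t y) ^+ 2 + dcpoisson mu nu t y ^+ 2.

Lemma modulus_gt0 t : exists2 y, 0 < y & 0 < modulus t y.
Proof.
apply: contrapT => h; case: neq => B mB; apply.
have h0 y : 0 < y -> dpoisson mu nu t y = 0 /\ dcpoisson mu nu t y = 0.
  move=> y0; have : ~~ (0 < modulus t y) by apply/negP => m0; apply: h; exists y.
  rewrite -leNgt /modulus => m0.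
  have d0 : dcpoisson mu nu t y ^+ 2 = 0.
    apply/le_anti; rewrite sqr_ge0 andbT (le_trans _ m0)// lerDr sqr_ge0//.
  have d1 : (y * dpoisson mu nu t y) ^+ 2 = 0.
    apply/le_anti; rewrite sqr_ge0 andbT (le_trans _ m0)// lerDl sqr_ge0//.
  split; last by apply/eqP; rewrite -sqrf_eq0 d0.
  by move/eqP: d1; rewrite sqrf_eq0 mulf_eq0 gt_eqF//= => /eqP.
apply: (measure_eq_kernels rmu.1 rnu.1 (t := t)) => // y y0.
  by apply/eqP; rewrite -subr_eq0; apply/eqP; exact: (h0 y y0).1.
by apply/eqP; rewrite -subr_eq0; apply/eqP; exact: (h0 y y0).2.
Qed.

Lemma mlin_sqr_ge0 p : 0 <= mlin gamma (p ^+ 2).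
Proof. by apply: (mlin_ge0 rmu) => x; rewrite horner_exp sqr_ge0. Qed.

Lemma mlinD p q : mlin gamma (p + q) = mlin gamma p + mlin gamma q.
Proof.
rewrite -!(ig_poly _ rmu) -(igD rmu.1); [|exact: tame_poly|exact: tame_poly].
by congr ig; apply/funext => x; rewrite hornerD.
Qed.

(** A height [y] at which the Cauchy transforms differ above [t] serves for
    all [s] near [t], so that [nonreal_evaluation] is uniform there, and the
    Fejer-Riesz factors of [p ^ 2] bound [p(s)] by their values at [s + i y]. *)
Lemma local_evaluation_bound t : exists d C, [/\ 0 < d, 0 < C &
  forall s p, `|s - t| < d -> p.[s] ^+ 2 <= C * mlin gamma (p ^+ 2)].
Proof.
have [y y0 m0] := modulus_gt0 t.
have cm : modulus s y @[s --> t] --> modulus t y.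
  by apply: (@cvg_sum_sqr (fun s => dpoisson mu nu s y) (fun s => dcpoisson mu nu s y)); [exact: cvg_dpoisson|exact: cvg_dcpoisson].
move/cvgrPdist_lt: cm => /(_ _ (divr_gt0 m0 (ltr0Sn _ 1)))/nbhs_ballP[d /= d0 hd].
set m := modulus t y in m0 hd.
have g0 : 0 <= gamma 0%N.
  by rewrite -(ig_monomial 0 rmu); apply: ig_ge0 => x; rewrite expr0.
have y20 : 0 < y ^- 2 by rewrite invr_gt0 exprn_gt0.
pose C := 32 * y ^- 2 * gamma 0%N / m.
have C0 : 0 <= C by rewrite /C divr_ge0 ?(ltW m0)// !mulr_ge0// ltW.
exists d, (C + 1); split=> // [|s p st]; first by rewrite ltr_wpDl.
have ms : m / 2 < modulus s y.
  have := hd s; rewrite /ball/= distrC => /(_ st) /ltr_normlP[].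
  by rewrite opprB -/m; move: (modulus s y) => z; lra.
have p20 x : 0 <= (p ^+ 2).[x] by rewrite horner_exp sqr_ge0.
have [g [h [pE ple]]] := fejer_riesz p20.
have [q1 [e1 [ o1 gE]]] := divp_quadp g s y.
have [q2 [e2 [ o2 hE]]] := divp_quadp h s y.
have := ple s y _ _ _ _ _ _ (ltW y0) gE hE; rewrite horner_exp => {}ple.
have h1 := nonreal_evaluation rmu rnu q1 e1 o1 s y0.
have h2 := nonreal_evaluation rmu rnu q2 e2 o2 s y0.
rewrite -gE -/(modulus s y) in h1; rewrite -hE -/(modulus s y) in h2.
have Lp : mlin gamma (p ^+ 2) = mlin gamma (g ^+ 2) + mlin gamma (h ^+ 2).
  by rewrite pE mlinD.
have Lg := mlin_sqr_ge0 g; have Lh := mlin_sqr_ge0 h.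
rewrite Lp; apply: (@le_trans _ _ (C * (mlin gamma (g ^+ 2) + mlin gamma (h ^+ 2)))); last first.
  by rewrite ler_wpM2r ?addr_ge0// lerDl.
rewrite /C mulrAC ler_pdivlMr//.
move: (mlin _ (g ^+ 2)) (mlin _ (h ^+ 2)) Lg Lh h1 h2 {Lp C C0} => G H G0 H0 h1 h2.
have sq1 : (e1 - y * o2) ^+ 2 <= 2 * (e1 ^+ 2 + (y * o2) ^+ 2).
  by have := sqr_ge0 (e1 + y * o2); nra.
have sq2 : (y * o1 + e2) ^+ 2 <= 2 * ((y * o1) ^+ 2 + e2 ^+ 2).
  by have := sqr_ge0 (y * o1 - e2); nra.
move: (modulus s y) ms h1 h2 => M ms h1 h2.
have M0 : m < 2 * M by lra.
have hp : p.[s] ^+ 2 <= 2 * (e1 ^+ 2 + (y * o1) ^+ 2) + 2 * (e2 ^+ 2 + (y * o2) ^+ 2).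
  by lra.
have hp2 : p.[s] ^+ 2 * m <= p.[s] ^+ 2 * (2 * M).
  by rewrite ler_wpM2l ?sqr_ge0// ltW.
apply: (le_trans hp2).
have hM : 0 <= M by lra.
apply: (@le_trans _ _ ((2 * (e1 ^+ 2 + (y * o1) ^+ 2) + 2 * (e2 ^+ 2 + (y * o2) ^+ 2)) * (2 * M))).
  by rewrite ler_wpM2r// mulr_ge0.
have -> : (2 * (e1 ^+ 2 + (y * o1) ^+ 2) + 2 * (e2 ^+ 2 + (y * o2) ^+ 2)) * (2 * M) =
  4 * ((e1 ^+ 2 + (y * o1) ^+ 2) * M) + 4 * ((e2 ^+ 2 + (y * o2) ^+ 2) * M) by ring.
have -> : 32 / y ^+ 2 * gamma 0%N * (G + H) =
  4 * (8 * y ^- 2 * (gamma 0%N * G)) + 4 * (8 * y ^- 2 * (gamma 0%N * H)) by ring.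
by rewrite lerD// ler_wpM2l.
Qed.

End local_bound.

(** * Solutions with extremal mass at a point *)

Section christoffel.
Context (R : realType) (gamma : nat -> R) (mu0 : {measure set (mT R) -> \bar R}).
Hypothesis rep0 : represents gamma mu0.
Implicit Types (t y e : R) (p q g h : {poly R}).

Definition locally_bounded_evaluation (c : nat -> R) := forall t, exists d C,
  [/\ 0 < d, 0 < C &
  forall s p, `|s - t| < d -> p.[s] ^+ 2 <= C * mlin c (p ^+ 2)].

(** The Christoffel function.  It bounds the mass of every solution at [t],
    because [p ^ 2] lies above the indicator of [t]. *)
Definition rho (c : nat -> R) t : R :=
  inf [set mlin c (p ^+ 2) | p in [set p : {poly R} | p.[t] = 1]].

Lemma mlinZ c p : mlin gamma (c *: p) = c * mlin gamma p.
Proof.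
rewrite -!(ig_poly _ rep0) -(ig_cstM rep0.1); last exact: tame_poly.
by congr ig; apply/funext => x; rewrite hornerZ.
Qed.

Lemma rho_le p t : p.[t] = 1 -> rho gamma t <= mlin gamma (p ^+ 2).
Proof.
move=> pt; apply: ge_inf; last by exists p.
by exists 0 => _ [q _ <-]; exact: (mlin_sqr_ge0 rep0).
Qed.

Lemma rho_approx t e : 0 < e -> exists2 p, p.[t] = 1 & mlin gamma (p ^+ 2) < rho gamma t + e.
Proof.
move=> e0; have [|_ [p pt <-] lt] := @inf_adherent _
    [set mlin gamma (p ^+ 2) | p in [set p : {poly R} | p.[t] = 1]] _ e0.
  split; first by exists (mlin gamma (1 ^+ 2)), 1 => //=; rewrite hornerC.
  by exists 0 => _ [q _ <-]; exact: (mlin_sqr_ge0 rep0).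
by exists p.
Qed.

Lemma rho_sqr_le p t : rho gamma t * p.[t] ^+ 2 <= mlin gamma (p ^+ 2).
Proof.
have [->|pt0] := eqVneq p.[t] 0.
  by rewrite expr0n mulr0; exact: (mlin_sqr_ge0 rep0).
have : ((p.[t])^-1 *: p).[t] = 1 by rewrite hornerZ mulVf.
move/rho_le; rewrite exprZn mlinZ exprVn mulrC ler_pdivlMr//.
by rewrite exprn_even_gt0.
Qed.

Lemma rho_nonneg_le p t : (forall x, 0 <= p.[x]) -> rho gamma t * p.[t] <= mlin gamma p.
Proof.
move=> /fejer_riesz[g [h [-> _]]].
by rewrite (mlinD rep0) hornerD !horner_exp mulrDr lerD ?rho_sqr_le.
Qed.

Lemma rho_gt0 t : locally_bounded_evaluation gamma -> 0 < rho gamma t.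
Proof.
move=> /(_ t)[d [C [d0 C0 h]]]; rewrite (@lt_le_trans _ _ C^-1) ?invr_gt0//.
apply: lb_le_inf; first by exists (mlin gamma (1 ^+ 2)), 1 => //=; rewrite hornerC.
move=> _ [p pt <-]; rewrite -[leLHS]mulr1 ler_pdivrMl//.
by have := h t p; rewrite subrr normr0 pt expr1n => /(_ d0).
Qed.

(** The Fejer-Riesz factor [g + i h] of an almost minimal [q ^ 2] has modulus 1
    at [t] and is rotated to have the value 1 there; its modulus at [t + i y],
    bounded from below in the last clause, is unchanged. *)
Lemma outer_minimizer t y e : 0 < y -> 0 < e ->
  exists q1 e1 o1 q2 e2 o2 g1 g2,
  [/\ g1 = q1 * quadp t y + e1%:P + o1%:P * ('X - t%:P),
      g2 = q2 * quadp t y + e2%:P + o2%:P * ('X - t%:P),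
      g1.[t] = 1 /\ g2.[t] = 0,
      mlin gamma (g1 ^+ 2 + g2 ^+ 2) < rho gamma t + e
    & 1 <= (e1 - y * o2) ^+ 2 + (y * o1 + e2) ^+ 2].
Proof.
move=> y0 e0; have [q qt Lq] := rho_approx t e0.
have q0 x : 0 <= (q ^+ 2).[x] by rewrite horner_exp sqr_ge0.
have [g [h [qE qle]]] := fejer_riesz q0.
have [q1 [e1 [ o1 gE]]] := divp_quadp g t y.
have [q2 [e2 [ o2 hE]]] := divp_quadp h t y.
have := qle t y _ _ _ _ _ _ (ltW y0) gE hE.
rewrite horner_exp qt expr1n => le1.
have ab : g.[t] ^+ 2 + h.[t] ^+ 2 = 1.
  by rewrite -!horner_exp -hornerD -qE horner_exp qt expr1n.
set a := g.[t] in ab; set b := h.[t] in ab.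
exists (a%:P * q1 + b%:P * q2), (a * e1 + b * e2), (a * o1 + b * o2).
exists (a%:P * q2 - b%:P * q1), (a * e2 - b * e1), (a * o2 - b * o1).
exists (a%:P * g + b%:P * h), (a%:P * h - b%:P * g); split.
- by rewrite gE hE; ring.
- by rewrite gE hE; ring.
- rewrite !(hornerD, hornerN, hornerM, hornerC) -/a -/b -!expr2 ab.
  by split=> //; ring.
- rewrite (_ : _ + _ = q ^+ 2)// qE.
  have -> : g ^+ 2 + h ^+ 2 = (a ^+ 2 + b ^+ 2)%:P * (g ^+ 2 + h ^+ 2).
    by rewrite ab mul1r.
  by ring.
- rewrite [leRHS](_ : _ = (a ^+ 2 + b ^+ 2) *
    ((e1 - y * o2) ^+ 2 + (y * o1 + e2) ^+ 2)); last by ring.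
  by rewrite ab mul1r.
Qed.

End christoffel.

Section approximable.
Context (R : realType) (mu : {measure set (mT R) -> \bar R}).
Hypothesis mom : all_moments mu.
Implicit Types (f g : R -> R) (p q : {poly R}).

Definition approximable f := tame f /\ forall e, 0 < e ->
  exists p : {poly R}, ig mu (fun x => (f x - p.[x]) ^+ 2) < e.

Lemma tame_sqrB f g : tame f -> tame g -> tame (fun x => (f x - g x) ^+ 2).
Proof. by move=> tf tg; tame_tac. Qed.

Lemma ig_sqrD f g : tame f -> tame g ->
  ig mu (fun x => (f x + g x) ^+ 2) <=
  2 * ig mu (fun x => f x ^+ 2) + 2 * ig mu (fun x => g x ^+ 2).
Proof.
move=> tf tg; have tf2 := tameX 2 tf; have tg2 := tameX 2 tg.
rewrite -!ig_cstM// -igD//; [|by tame_tac|by tame_tac].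
apply: (ig_le mom) => // [||x]; [by tame_tac|by tame_tac|].
by have := sqr_ge0 (f x - g x); nra.
Qed.

Lemma approximableD f g : approximable f -> approximable g ->
  approximable (fun x => f x + g x).
Proof.
move=> [tf af] [tg ag]; split; first exact: tameD.
move=> e e0; have e4 : 0 < e / 4 by rewrite divr_gt0.
have [p pe] := af _ e4; have [q qe] := ag _ e4.
exists (p + q).
rewrite [X in ig mu X](_ : _ = (fun x => (f x - p.[x] + (g x - q.[x])) ^+ 2)).
  apply: (le_lt_trans (ig_sqrD (tameD tf (tameN (tame_poly p)))
                               (tameD tg (tameN (tame_poly q))))).
  by lra.
by apply/funext => x; rewrite hornerD; ring.
Qed.

Lemma approximableZ c f : approximable f -> approximable (fun x => c * f x).
Proof.
move=> [tf af]; split; first exact: tameM (tame_cst c) tf.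
move=> e e0; have c0 : 0 < c ^+ 2 + 1 by rewrite ltr_wpDl ?sqr_ge0.
have [p pe] := af _ (divr_gt0 e0 c0).
exists (c *: p).
rewrite (_ : (fun x => _) = (fun x => c ^+ 2 * (f x - p.[x]) ^+ 2)); last first.
  by apply/funext => x; rewrite hornerZ -mulrBr exprMn.
rewrite ig_cstM//; last by apply: tame_sqrB => //; exact: tame_poly.
rewrite ltr_pdivlMr// mulrC mulrDl mul1r in pe; apply: le_lt_trans pe.
by rewrite lerDl; apply: ig_ge0 => x; exact: sqr_ge0.
Qed.

Lemma approximable_lim (f_ : nat -> R -> R) f g : (forall n, approximable (f_ n)) ->
  tame g -> (forall n x, `|f_ n x| <= g x) -> (forall x, f_ ^~ x @ \oo --> f x) ->
  approximable f.
Proof.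
move=> af tg fg cf.
have [tf _] := ig_dct mom (fun n => (af n).1) tg fg cf.
split=> // e e0; have e4 : 0 < e / 4 by rewrite divr_gt0.
have fg' x : `|f x| <= g x.
  have cn : (fun n => `|f_ n x|) @ \oo --> `|f x| by apply: cvg_norm; exact: cf.
  rewrite -(cvg_lim _ cn)//; apply: limr_le; first by apply/cvg_ex; exists `|f x|.
  by apply: nearW => n.
have t2 n : tame (fun x => (f x - f_ n x) ^+ 2) by apply: tame_sqrB => //; exact: (af n).1.
have tg2 : tame (fun x => (2 * g x) ^+ 2) by tame_tac.
have c0 x : (fun n => (f x - f_ n x) ^+ 2) @ \oo --> (0 : R).
  have : (fun n => f x - f_ n x) @ \oo --> f x - f x.
    by apply: cvgB; [exact: cvg_cst|exact: cf].
  rewrite subrr => h; rewrite -[X in _ --> X](mulr0 0).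
  by under eq_fun do rewrite expr2; exact: cvgM.
have bd n x : `|(f x - f_ n x) ^+ 2| <= (2 * g x) ^+ 2.
  have g0 : 0 <= g x by exact: le_trans (fg 0%N x).
  rewrite normrX lerXn2r ?nnegrE ?mulr_ge0// (le_trans (ler_normB _ _))//.
  by rewrite mulr_natl mulr2n lerD.
have [_] := ig_dct mom t2 tg2 bd c0.
rewrite ig_cst// mul0r => /cvgrPdist_lt/(_ _ e4)[n _ /(_ n (leqnn n))].
rewrite sub0r normrN => /ltr_normlW hn.
have [p pe] := (af n).2 _ e4; exists p.
rewrite [X in ig mu X](_ : _ = (fun x => (f x - f_ n x + (f_ n x - p.[x])) ^+ 2)).
  apply: (le_lt_trans (ig_sqrD (tameD tf (tameN (af n).1))
                               (tameD (af n).1 (tameN (tame_poly p))))).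
  by lra.
by apply/funext => x; ring.
Qed.

Lemma approximable_hull t :
  (forall y, 0 < y -> approximable (poisson t y) /\ approximable (cpoisson t y)) ->
  forall f, hull t f -> approximable f.
Proof.
move=> hk f; elim=> {f} [y y0|y y0|f g _ af _ ag|c f _ af|f_ f M _ h fM cf].
- exact: (hk y y0).1.
- exact: (hk y y0).2.
- exact: approximableD.
- exact: approximableZ.
- exact: approximable_lim (tame_cst M) fM cf.
Qed.

End approximable.

Lemma sqr_comb_le (R : realType) (a b c d v g m : R) : a ^+ 2 <= m -> b ^+ 2 <= m ->
  c ^+ 2 <= m -> d ^+ 2 <= m -> forall A B,
  (A * (a * v + b * g) + B * (c * v + d * g)) ^+ 2 <=
  4 * m * (A ^+ 2 + B ^+ 2) * (v ^+ 2 + g ^+ 2).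
Proof.
move=> am bm cm dm A B.
have CS (x y z t : R) : (x * z + y * t) ^+ 2 <= (x ^+ 2 + y ^+ 2) * (z ^+ 2 + t ^+ 2).
  by have := sqr_ge0 (x * t - y * z); nra.
have n0 : 0 <= v ^+ 2 + g ^+ 2 by rewrite addr_ge0 ?sqr_ge0.
have h1 : (a * v + b * g) ^+ 2 <= 2 * m * (v ^+ 2 + g ^+ 2).
  by rewrite (le_trans (CS _ _ _ _))// ler_wpM2r//; lra.
have h2 : (c * v + d * g) ^+ 2 <= 2 * m * (v ^+ 2 + g ^+ 2).
  by rewrite (le_trans (CS _ _ _ _))// ler_wpM2r//; lra.
rewrite (le_trans (CS _ _ _ _))//.
rewrite [leRHS](_ : _ = (A ^+ 2 + B ^+ 2) * (4 * m * (v ^+ 2 + g ^+ 2))); last by ring.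
by rewrite ler_wpM2l ?addr_ge0 ?sqr_ge0//; lra.
Qed.

Section extremal_mass.
Context (R : realType) (gamma : nat -> R).
Implicit Types (mu : {measure set (mT R) -> \bar R}) (t y e : R) (p q g h : {poly R}).

Lemma ig_delta_sub mu p t : represents gamma mu -> p.[t] = 1 ->
  ig mu (fun x => (\1_[set t] x - p.[x]) ^+ 2) = mlin gamma (p ^+ 2) - fine (mu [set t]).
Proof.
move=> rmu pt; rewrite -ig_indic// -(ig_poly _ rmu) -(igB rmu.1); last 2 first.
- exact: tame_poly.
- exact: tame_indic.
congr ig; apply/funext => x; rewrite horner_exp indicE.
have [->|/eqP xt] := eqVneq x t; first by rewrite mem_set// pt /=; ring.
by rewrite memNset//=; ring.
Qed.

(** Take [z = t + i y] and the factor [g = g1 + i g2] of [outer_minimizer],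
    which is close to the indicator of [t] in L2, with [|g(z)| >= 1].  Then
    [(g(X) - g(z)) / (X - z)] is a polynomial, and [g(x) / (x - z)] is close to
    [(i / y) g1(x)], since both are close to [i / y] times the indicator of [t].
    Hence polynomials approach [g(z) / (x - z)]; division by [g(z)] and
    separation of real and imaginary parts give the two kernels. *)
Lemma kernels_approx mu0 t y e : represents gamma mu0 -> 0 < y -> 0 < e ->
  exists p1 p2, forall mu, represents gamma mu -> rho gamma t <= fine (mu [set t]) ->
    ig mu (fun x => (poisson t y x - p1.[x]) ^+ 2) < e /\
    ig mu (fun x => (cpoisson t y x - p2.[x]) ^+ 2) < e.
Proof.
move=> rmu0 y0 e0.
pose K := 8 * (y ^- 2 + y ^- 4).
have K0 : 0 < K by rewrite mulr_gt0// addr_gt0// invr_gt0 exprn_gt0.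
have [q1 [e1 [ o1 [q2 [e2 [ o2 [g1 [g2 [g1E g2E [g1t g2t] Lg AB]]]]]]]]] :=
  outer_minimizer rmu0 t y0 (divr_gt0 e0 K0).
set A := e1 - y * o2 in AB; set B := y * o1 + e2 in AB.
have N0 : 0 < A ^+ 2 + B ^+ 2 by exact: lt_le_trans AB.
pose h1 := q1 * ('X - t%:P) - y%:P * q2 + o1%:P.
pose h2 := y%:P * q1 + q2 * ('X - t%:P) + o2%:P.
pose P1 := (y * (A ^+ 2 + B ^+ 2))^-1 *: (B%:P * h1 + A%:P * ((y^-1)%:P * g1 - h2)).
pose P2 := (A ^+ 2 + B ^+ 2)^-1 *: (- A%:P * h1 + B%:P * ((y^-1)%:P * g1 - h2)).
pose S x := (\1_[set t] x - g1.[x]) ^+ 2 + g2.[x] ^+ 2.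
have tS : tame S.
  apply: tameD; last by tame_tac.
  by apply: tame_sqrB; [exact: tame_indic|exact: tame_poly].
have iS mu : represents gamma mu -> rho gamma t <= fine (mu [set t]) -> ig mu S < e / K.
  move=> rmu mt; rewrite /S (igD rmu.1); last 2 first.
  - by apply: tame_sqrB; [exact: tame_indic|exact: tame_poly].
  - by tame_tac.
  rewrite (ig_delta_sub rmu g1t).
  rewrite (_ : (fun x => g2.[x] ^+ 2) = (fun x => (g2 ^+ 2).[x])); last first.
    by apply/funext => x; rewrite horner_exp.
  by rewrite (ig_poly _ rmu); rewrite (mlinD rmu0) in Lg; lra.
suff H x : (poisson t y x - P1.[x]) ^+ 2 <= K * S x /\ (cpoisson t y x - P2.[x]) ^+ 2 <= K * S x.
  exists P1, P2 => mu rmu mt; have tK : tame (fun x => K * S x) by exact: tameM (tame_cst K) tS.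
  have := iS mu rmu mt.
  rewrite ltr_pdivlMr// mulrC -(ig_cstM rmu.1 K tS) => h.
  split; apply: le_lt_trans h; apply: (ig_le rmu.1) => //.
  - by apply: tame_sqrB; [exact: tame_poisson|exact: tame_poly].
  - by move=> z; exact: (H z).1.
  - by apply: tame_sqrB; [exact: tame_cpoisson|exact: tame_poly].
  - by move=> z; exact: (H z).2.
set w := poisson t y x; set u := x - t; set yi := y^-1.
set v := \1_[set t] x - g1.[x]; set g := g2.[x].
have y_neq0 : y != 0 by rewrite gt_eqF.
have wD : w * (u ^+ 2 + y ^+ 2) = 1 by exact: poissonV.
have yyi : y * yi = 1 by rewrite mulfV.
have ug1 : u * g1.[x] = - (u * v).
  rewrite /v mulrBr opprB indicE; have [xt|/eqP xt] := eqVneq x t.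
    by rewrite /u xt subrr !mul0r subr0.
  by rewrite memNset//= mulr0 subr0.
have g1x : g1.[x] = q1.[x] * (u ^+ 2 + y ^+ 2) + e1 + o1 * u.
  by rewrite g1E /quadp !hornerE.
have g2x : g = q2.[x] * (u ^+ 2 + y ^+ 2) + e2 + o2 * u.
  by rewrite /g g2E /quadp !hornerE.
have h1x : h1.[x] = ((g1.[x] - A) * u - (g - B) * y) * w.
  transitivity ((q1.[x] * u - y * q2.[x] + o1) * (w * (u ^+ 2 + y ^+ 2))).
    by rewrite wD mulr1 /h1 !(hornerD, hornerN, hornerM, hornerC, hornerX).
  by rewrite g1x g2x /A /B; ring.
have h2x : h2.[x] = ((g1.[x] - A) * y + (g - B) * u) * w.
  transitivity ((y * q1.[x] + q2.[x] * u + o2) * (w * (u ^+ 2 + y ^+ 2))).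
    by rewrite wD mulr1 /h2 !(hornerD, hornerN, hornerM, hornerC, hornerX).
  by rewrite g1x g2x /A /B; ring.
clearbody h1 h2.
have yiE : yi = u ^+ 2 * w * yi + y * w.
  transitivity (yi * (w * (u ^+ 2 + y ^+ 2))); first by rewrite wD mulr1.
  transitivity (u ^+ 2 * w * yi + y * w * (y * yi)); first by ring.
  by rewrite yyi mulr1.
have w0 : 0 < w by exact: poisson_gt0.
have b1 : (u * w) ^+ 2 <= y ^- 2.
  have := cpoisson_norm t x y0; rewrite -/w -/u => h.
  by rewrite -exprVn -(real_normK (num_real (u * w))) lerXn2r ?nnegrE ?invr_ge0 ?(ltW y0).
have yw : 0 <= y * w <= yi.
  rewrite mulr_ge0 ?(ltW y0) ?(ltW w0)//= -ler_pdivlMl//.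
  by have := poisson_le t x y0; rewrite -/w expr2 invfM.
have b2 : (y * w) ^+ 2 <= y ^- 2.
  by case/andP: yw => ? ?; rewrite -exprVn lerXn2r ?nnegrE ?invr_ge0 ?(ltW y0).
have b3 : (u ^+ 2 * w * yi) ^+ 2 <= y ^- 2.
  have h0 : 0 <= u ^+ 2 * w * yi by rewrite mulr_ge0//; [rewrite mulr_ge0 ?sqr_ge0 ?(ltW w0)|rewrite /yi invr_ge0 ltW].
  rewrite -exprVn lerXn2r ?nnegrE ?invr_ge0 ?(ltW y0)// -/yi.
  by case/andP: yw => ? ?; lra.
have SE : S x = v ^+ 2 + g ^+ 2 by [].
pose N := A ^+ 2 + B ^+ 2.
have P2E : N * (cpoisson t y x - P2.[x]) =
    A * ((- (u * w)) * v + (- (y * w)) * g) + B * ((u ^+ 2 * w * yi) * v + (u * w) * g).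
  rewrite /P2 hornerZ mulrBr (mulrA N N^-1) mulfV ?gt_eqF// mul1r.
  rewrite !(hornerD, hornerN, hornerM, hornerC) h1x h2x -/yi /cpoisson -/u -/w.
  transitivity (A * ((u * g1.[x]) * w - y * w * g) +
    B * ((y * w) * g1.[x] + u * w * g - yi * g1.[x])); first by rewrite /N; ring.
  rewrite {1}yiE.
  transitivity (A * ((u * g1.[x]) * w - y * w * g) +
    B * (u * w * g - (u * w * yi) * (u * g1.[x]))); first by ring.
  by rewrite ug1; ring.
have P1E : y * N * (poisson t y x - P1.[x]) =
    A * ((u ^+ 2 * w * yi) * v + (u * w) * g) + B * ((u * w) * v + (y * w) * g).
  rewrite /P1 hornerZ mulrBr (mulrA (y * N) (y * N)^-1) mulfV ?mulf_neq0 ?gt_eqF// mul1r.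
  rewrite !(hornerD, hornerN, hornerM, hornerC) h1x h2x -/yi -/w.
  transitivity (A * ((y * w) * g1.[x] + u * w * g - yi * g1.[x]) -
    B * ((u * g1.[x]) * w - y * w * g)); first by rewrite /N; ring.
  rewrite {1}yiE.
  transitivity (A * (u * w * g - (u * w * yi) * (u * g1.[x])) -
    B * ((u * g1.[x]) * w - y * w * g)); first by ring.
  by rewrite ug1; ring.
have S0 : 0 <= S x by rewrite SE addr_ge0 ?sqr_ge0.
have N1 : 1 <= N by [].
have b1' : (- (u * w)) ^+ 2 <= y ^- 2 by rewrite sqrrN.
have b2' : (- (y * w)) ^+ 2 <= y ^- 2 by rewrite sqrrN.
have yV0 : 0 < y ^- 2 by rewrite invr_gt0 exprn_gt0.
have yV4 : 0 < y ^- 4 by rewrite invr_gt0 exprn_gt0.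
split.
  have := sqr_comb_le v g b3 b1 b1 b2 A B; rewrite -P1E -SE -/N exprMn => h.
  have : N * (poisson t y x - P1.[x]) ^+ 2 <= 4 * y ^- 4 * S x.
    have NN : N ^+ 2 = N * N by rewrite expr2.
    have y4 : y ^- 4 = y ^- 2 * y ^- 2 by rewrite -invfM -exprD.
    rewrite exprMn NN in h.
    have yN : 0 < y ^+ 2 * N by rewrite mulr_gt0// exprn_gt0.
    rewrite -(ler_pM2l yN) (_ : y ^+ 2 * N * (N * _) = y ^+ 2 * (N * N) * (poisson t y x - P1.[x]) ^+ 2); last by ring.
    apply: (le_trans h); rewrite y4.
    rewrite (_ : y ^+ 2 * N * (4 * (y ^- 2 * y ^- 2) * S x) =
      (y ^+ 2 * y ^- 2) * (4 * y ^- 2 * N * S x)); last by ring.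
    by rewrite mulfV ?mul1r// expf_neq0.
  have := ler_pM ler01 (sqr_ge0 (poisson t y x - P1.[x])) N1 (lexx _).
  rewrite mul1r /K; move: (poisson t y x - P1.[x]) => z z1 z2.
  have := mulr_ge0 (ltW yV0) S0; have := mulr_ge0 (ltW yV4) S0.
  by move: (y ^- 4) (y ^- 2) z2 => a4 a2; nra.
have := sqr_comb_le v g b1' b2' b3 b1 A B; rewrite -P2E -SE -/N exprMn => h.
have : N * (cpoisson t y x - P2.[x]) ^+ 2 <= 4 * y ^- 2 * S x.
  rewrite -(ler_pM2l (lt_le_trans ltr01 N1)) mulrA -expr2 (le_trans h)//.
  by rewrite le_eqVlt; apply/orP; left; apply/eqP; ring.
have := ler_pM ler01 (sqr_ge0 (cpoisson t y x - P2.[x])) N1 (lexx _).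
rewrite mul1r /K; move: (cpoisson t y x - P2.[x]) => z z1 z2.
have := mulr_ge0 (ltW yV0) S0; have := mulr_ge0 (ltW yV4) S0.
by move: (y ^- 4) (y ^- 2) z2 => a4 a2; nra.
Qed.

Lemma indic_approximable mu t (B : set (mT R)) : represents gamma mu ->
  rho gamma t <= fine (mu [set t]) -> measurable B -> approximable mu \1_B.
Proof.
move=> rmu mt mB; apply: (approximable_hull rmu.1 (t := t)); last exact: hull_indic.
move=> y y0; split; split; do ?[exact: tame_poisson|exact: tame_cpoisson];
  move=> e e0; have [p1 [p2 /(_ mu rmu mt)[h1 h2]]] := kernels_approx t rmu y0 e0.
  by exists p1.
by exists p2.
Qed.

(** The polynomials of [kernels_approx] serve both solutions at once, so the
    kernels have the same integrals. *)
Lemma extremal_mass_unique mu nu t : represents gamma mu -> represents gamma nu ->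
  rho gamma t <= fine (mu [set t]) -> rho gamma t <= fine (nu [set t]) ->
  forall B : set (mT R), measurable B -> mu B = nu B.
Proof.
move=> rmu rnu mt nt.
have close kappa (f : R -> R) p e : represents gamma kappa -> tame f ->
    ig kappa (fun x => (f x - p.[x]) ^+ 2) < e ->
    (ig kappa f - mlin gamma p) ^+ 2 <= gamma 0%N * e.
  move=> rk tf h; rewrite -(ig_poly _ rk) -(igB rk.1)//; last exact: tame_poly.
  have tfp : tame (fun x => f x - p.[x]) by apply: tameD => //; apply: tameN; exact: tame_poly.
  have := ig_norm rk.1 tfp; have := ig_norm_sqr rk.1 tfp.
  have -> : ig kappa (fun=> 1) = gamma 0%N by rewrite -(ig_monomial 0 rk).
  move=> h1 h2; rewrite -(real_normK (num_real (ig _ _))).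
  have g0 : 0 <= gamma 0%N.
    by rewrite -(ig_monomial 0 rk); apply: ig_ge0 => x; rewrite expr0.
  apply: (@le_trans _ _ (ig kappa (fun x => `|f x - p.[x]|) ^+ 2)).
    by rewrite lerXn2r ?nnegrE// (le_trans _ h2).
  by rewrite (le_trans h1)// ler_wpM2l// ltW.
have g0 : 0 <= gamma 0%N.
  by rewrite -(ig_monomial 0 rmu); apply: ig_ge0 => x; rewrite expr0.
have same (f : R -> R) : tame f -> (forall e, 0 < e -> exists p : {poly R},
    ig mu (fun x => (f x - p.[x]) ^+ 2) < e /\ ig nu (fun x => (f x - p.[x]) ^+ 2) < e) ->
    ig mu f = ig nu f.
  move=> tf hf; apply/eqP; rewrite -subr_eq0 -sqrf_eq0; apply/eqP/le_anti.
  rewrite sqr_ge0 andbT; apply/ler_addgt0Pl => d d0; rewrite addr0.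
  have K0 : 0 < 4 * gamma 0%N + 1 by rewrite ltr_wpDl// mulr_ge0.
  have [p [h1 h2]] := hf _ (divr_gt0 d0 K0).
  have {}h1 := close _ _ _ _ rmu tf h1; have {}h2 := close _ _ _ _ rnu tf h2.
  have : 4 * (gamma 0%N * (d / (4 * gamma 0%N + 1))) <= d.
    rewrite mulrA mulrA ler_pdivrMr// mulrC ler_wpM2l ?(ltW d0)//.
    by rewrite lerDl.
  move: (gamma 0%N * _) h1 h2 => c h1 h2 h3.
  have := sqr_ge0 ((ig mu f - mlin gamma p) + (ig nu f - mlin gamma p)).
  by move: h1 h2; nra.
apply: (measure_eq_kernels rmu.1 rnu.1 (t := t)) => y y0; apply: same;
  do ?[exact: tame_poisson|exact: tame_cpoisson]; move=> e e0;
  have [p1 [p2 H]] := kernels_approx t rmu y0 e0;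
  have [h1 h2] := H mu rmu mt; have [h3 h4] := H nu rnu nt.
  by exists p1.
by exists p2.
Qed.

(** A polynomial near the indicator of [B] has values near 1 on [B], while its
    squared norm is near the mass of [B]; the evaluation bound compares them. *)
Lemma mass_lower_bound mu (B : set (mT R)) C : represents gamma mu -> measurable B ->
  approximable mu \1_B -> 0 < C ->
  (forall x p, B x -> p.[x] ^+ 2 <= C * mlin gamma (p ^+ 2)) ->
  0 < fine (mu B) -> 1 <= C * fine (mu B).
Proof.
move=> rmu mB [tB aB] C0 hC; set m := fine (mu B) => m0.
rewrite leNgt; apply/negP => Cm.
have [p] := aB (m * (1 - C * m)) ltac:(by rewrite mulr_gt0// subr_gt0).
apply/negP; rewrite -leNgt.
set L := mlin gamma (p ^+ 2).
have tp2 : tame (fun x => p.[x] ^+ 2) by tame_tac.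
have iL : ig mu (fun x => p.[x] ^+ 2) = L.
  rewrite /L -(ig_poly _ rmu); congr ig.
  by apply/funext => x; rewrite horner_exp.
(* With this weight the norm [L] drops out of the integrated bound. *)
pose th := (C * m)^-1.
have Cm0 : 0 < C * m by rewrite mulr_gt0.
have -> : m * (1 - C * m) = L - (th * (C * L) + th^-1 - 1) * m.
  rewrite /th invrK.
  have -> : (C * m)^-1 * (C * L) = L / m by field; rewrite !gt_eqF.
  by field; rewrite gt_eqF.
rewrite -iL /m -ig_indic// iL -(ig_cstM rmu.1 _ tB) -iL.
rewrite -(igB rmu.1)//; last by tame_tac.
apply: (ig_le rmu.1) => [||x].
- by apply: tameD => //; apply: tameN; exact: tameM (tame_cst _) tB.
- by apply: tame_sqrB => //; exact: tame_poly.
rewrite indicE; have [Bx|Bx] := pselect (B x); last by rewrite memNset//= mulr0 sub0r subr0 sqrrN.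
rewrite mem_set//= mulr1.
have th0 : 0 < th by rewrite invr_gt0.
have h1 := hC x p Bx; rewrite -/L in h1.
have h2 : th * p.[x] ^+ 2 <= th * (C * L) by rewrite ler_wpM2l// ltW.
have h3 : 2 * p.[x] <= th * p.[x] ^+ 2 + th^-1.
  have := sqr_ge0 (th * p.[x] - 1); rewrite -(pmulr_rge0 _ (_ : 0 < th^-1)) ?invr_gt0//.
  have -> : th^-1 * (th * p.[x] - 1) ^+ 2 = th * p.[x] ^+ 2 + th^-1 - 2 * p.[x].
    by field; rewrite gt_eqF.
  by rewrite subr_ge0.
by nra.
Qed.

End extremal_mass.

(** * Density of the polynomials in the complex L2 space *)

Section complex_density.
Context (R : realType).
Implicit Types (nu : borelMeasure R) (e : R).

Lemma L2norm_sqr nu (f : R -> R[i]) :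
  (L2norm nu f `^ 2)%E = (\int[nu]_x (sqn (f x))%:E)%E.
Proof.
rewrite /L2norm poweR_Lnorm//; apply: eq_integral => x _ /=.
rewrite powR_mulrn// real_normK ?num_real//.
by case: (f x) => a b; rewrite /= sqr_sqrtr// addr_ge0 ?sqr_ge0.
Qed.

Lemma L2norm_lt nu (f : R -> R[i]) e : 0 < e ->
  (L2norm nu f < e%:E)%E <-> (\int[nu]_x (sqn (f x))%:E < (e ^+ 2)%:E)%E.
Proof.
move=> e0; rewrite -L2norm_sqr.
have : (0 <= L2norm nu f)%E by exact: Lnorm_ge0.
case: (L2norm nu f) => [r r0|_|//].
  by rewrite poweR_EFin powR_mulrn// !lte_fin ltr_pXn2r ?nnegrE// ltW.
by rewrite poweRyr.
Qed.

Lemma L2norm_fin nu (f : R -> R[i]) :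
  (L2norm nu f < +oo)%E <-> (\int[nu]_x (sqn (f x))%:E < +oo)%E.
Proof.
rewrite -L2norm_sqr; split; first exact: poweR_lty.
by apply: lty_poweRy.
Qed.

Lemma complex_poly_split (p : {poly R[i]}) :
  exists a b : {poly R}, forall t : R, p.[t%:C%C] = (a.[t] +i* b.[t])%C.
Proof.
elim/poly_ind: p => [|p c [a [b ab]]].
  by exists 0, 0 => t; rewrite !horner0.
exists (a * 'X + (complex.Re c)%:P), (b * 'X + (complex.Im c)%:P) => t.
rewrite !hornerE ab; case: c => c d; rewrite /= -[t%:C%C]/(t +i* 0)%C; simpc.
by [].
Qed.

Lemma real_poly_pair (a b : {poly R}) :
  exists p : {poly R[i]}, forall t : R, p.[t%:C%C] = (a.[t] +i* b.[t])%C.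
Proof.
exists (map_poly (real_complex R) a + (0 +i* 1)%C *: map_poly (real_complex R) b) => t.
by rewrite hornerD hornerZ !horner_map; simpc.
Qed.

End complex_density.

Import HBNNSimple.

Section square_integrable.
Context (R : realType) (mu : {measure set (mT R) -> \bar R}).
Hypothesis mom : all_moments mu.
Implicit Types (f g : R -> R) (p q : {poly R}) (e : R).

Let sqint f := (\int[mu]_x (f x ^+ 2)%:E)%E.

Lemma measurable_sqr f : measurable_fun [set: mT R] (f : mT R -> mT R) ->
  measurable_fun [set: mT R] (fun x : mT R => (f x ^+ 2)%:E).
Proof. by move=> mf; apply/measurable_EFinP; exact: measurable_funX. Qed.

Lemma sqintD f g : measurable_fun [set: mT R] (f : mT R -> mT R) ->
  measurable_fun [set: mT R] (g : mT R -> mT R) ->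
  (sqint (fun x => (f x + g x)%R) <= 2%:E * sqint f + 2%:E * sqint g)%E.
Proof.
move=> mf mg; rewrite /sqint.
rewrite -!ge0_integralZl//; try by move=> x _; rewrite lee_fin sqr_ge0.
- rewrite -ge0_integralD//; last 4 first.
  + by move=> x _; rewrite mule_ge0// lee_fin sqr_ge0.
  + by apply: measurable_funeM; exact: measurable_sqr.
  + by move=> x _; rewrite mule_ge0// lee_fin sqr_ge0.
  + by apply: measurable_funeM; exact: measurable_sqr.
  apply: ge0_le_integral => //.
  + by move=> x _; rewrite lee_fin sqr_ge0.
  + by apply: measurable_sqr; exact: measurable_funD.
  + by apply: emeasurable_funD; apply: measurable_funeM; exact: measurable_sqr.
  + move=> x _; rewrite -!EFinM -EFinD lee_fin.
    by have := sqr_ge0 (f x - g x); nra.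
- exact: measurable_sqr.
- exact: measurable_sqr.
Qed.

Lemma approximable_sum (I : Type) (s : seq I) (F : I -> R -> R) :
  (forall i, approximable mu (F i)) -> approximable mu (fun x => \sum_(i <- s) F i x).
Proof.
move=> aF; elim: s => [|i s IH].
  under eq_fun do rewrite big_nil; split; first exact: tame_cst.
  move=> e e0; exists 0.
  have -> : (fun x : R => (0 - (0 : {poly R}).[x]) ^+ 2) = (fun=> 0).
    by apply/funext => x; rewrite horner0 subr0 expr0n.
  by rewrite (ig_cst mom) mul0r.
by under eq_fun do rewrite big_cons; apply: approximableD.
Qed.

Hypothesis indic_approx : forall B : set (mT R), measurable B -> approximable mu \1_B.

Lemma sfun_approximable (g : {nnsfun (mT R) >-> R}) :
  approximable mu (g : mT R -> R).
Proof.
have /funext E := fimfunEord g; rewrite [X in approximable mu X]E.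
apply: approximable_sum => i; apply: approximableZ => //.
by apply: indic_approx.
Qed.

Lemma sqint_approx_ge0 f e : measurable_fun [set: mT R] (f : mT R -> mT R) ->
  (forall x, 0 <= f x) -> (sqint f < +oo)%E -> 0 < e ->
  exists p : {poly R}, (sqint (fun x => (f x - p.[x])%R) < e%:E)%E.
Proof.
move=> mf f0 fi e0.
have mF : measurable_fun [set: mT R] (EFin \o (f : mT R -> R)) by exact/measurable_EFinP.
pose g n := nnsfun_approx measurableT mF n.
have gf n x : g n x <= f x.
  rewrite /g nnsfun_approxE -lee_fin.
  by apply: (le_approx (D := setT)) => // t _; rewrite lee_fin.
have gc x : (fun n => g n x) @ \oo --> f x.
  have /fine_cvgP[_] := @cvg_nnsfun_approx _ _ _ _ measurableT _ mF
    ltac:(by move=> t _; rewrite lee_fin) x Logic.I.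
  by apply.
have mg n : measurable_fun [set: mT R] (g n : mT R -> mT R).
  exact: (sfun_approximable (g n)).1.1.
have md n : measurable_fun [set: mT R] (fun x : mT R => ((f x - g n x) ^+ 2)%:E).
  by apply: measurable_sqr; exact: measurable_funB.
have cd : {ae mu, forall x, [set: mT R] x ->
    (fun n => ((f x - g n x) ^+ 2)%:E) @ \oo --> (0%R%:E : \bar R)}.
  apply: aeW => x _; apply/fine_cvgP; split; first exact: nearW.
  have h : (fun n => f x - g n x) @ \oo --> (0 : R).
    by rewrite -[X in _ --> X](subrr (f x)); apply: cvgB; [exact: cvg_cst|exact: gc].
  rewrite -[X in _ --> X](mulr0 0).
  by under eq_fun do rewrite /= expr2; apply: cvgM.
have intf : mu.-integrable setT (fun x : mT R => (f x ^+ 2)%:E).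
  apply/integrableP; split; first exact: measurable_sqr.
  by under eq_integral => x _ do rewrite gee0_abs ?lee_fin ?sqr_ge0//.
have bd : {ae mu, forall x n, [set: mT R] x -> (`|((f x - g n x) ^+ 2)%:E| <= (f x ^+ 2)%:E)%E}.
  apply: aeW => x n _; rewrite /= lee_fin ger0_norm ?sqr_ge0//.
  by rewrite lerXn2r ?nnegrE ?subr_ge0// gerBl.
have [_ _] := dominated_convergence measurableT md (measurable_cst _) cd intf bd.
rewrite integral0 => /fine_cvgP[fn].
have e4 : 0 < e / 4 by rewrite divr_gt0.
move=> /cvgrPdist_lt/(_ _ e4) fl.
near \oo => n.
have [p pe] := (sfun_approximable (g n)).2 _ e4.
exists p.
have tg := (sfun_approximable (g n)).1.
have -> : sqint (fun x => f x - p.[x]) = sqint (fun x => (f x - g n x) + (g n x - p.[x])).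
  by apply: eq_integral => x _; congr (_ ^+ 2)%:E; ring.
apply: (le_lt_trans (sqintD _ _)).
- exact: measurable_funB.
- by apply: measurable_funB => //; exact: (tame_poly p).1.
rewrite /sqint (ig_EFin mom (f := fun x => (g n x - p.[x]) ^+ 2)); last first.
  by apply: tame_sqrB => //; exact: tame_poly.
have fin1 : (\int[mu]_x ((f x - g n x) ^+ 2)%:E)%E \is a fin_num by near: n.
have : `|0 - fine (\int[mu]_x ((f x - g n x) ^+ 2)%:E)%E| < e / 4 by near: n.
rewrite -(fineK fin1) sub0r normrN => /ltr_normlW h.
by rewrite -!EFinM -EFinD lte_fin; lra.
Unshelve. all: by end_near. Qed.

Lemma sqint_approx f e : measurable_fun [set: mT R] (f : mT R -> mT R) ->
  (sqint f < +oo)%E -> 0 < e ->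
  exists p : {poly R}, (sqint (fun x => (f x - p.[x])%R) < e%:E)%E.
Proof.
move=> mf fi e0.
have e4 : 0 < e / 4 by rewrite divr_gt0.
pose fp x := Num.max (f x) 0; pose fn x := Num.max (- f x) 0.
have mp : measurable_fun [set: mT R] (fp : mT R -> mT R).
  by apply: measurable_maxr => //; exact: measurable_cst.
have mn : measurable_fun [set: mT R] (fn : mT R -> mT R).
  by apply: measurable_maxr => //; exact: measurable_funN.
have fin h : measurable_fun [set: mT R] (h : mT R -> mT R) ->
    (forall x, h x ^+ 2 <= f x ^+ 2) -> (sqint h < +oo)%E.
  move=> mh hf; apply: le_lt_trans fi; apply: ge0_le_integral => //.
  - by move=> x _; rewrite lee_fin sqr_ge0.
  - exact: measurable_sqr.
  - exact: measurable_sqr.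
  - by move=> x _; rewrite lee_fin.
have [p pe] : exists p : {poly R}, (sqint (fun x => (fp x - p.[x])%R) < (e / 4)%:E)%E.
  apply: sqint_approx_ge0 => // [x|]; first by rewrite /fp le_max lexx orbT.
  apply: fin => // x; rewrite /fp; have [_|_] := leP (f x) 0 => //.
  by rewrite expr0n sqr_ge0.
have [q qe] : exists p : {poly R}, (sqint (fun x => (fn x - p.[x])%R) < (e / 4)%:E)%E.
  apply: sqint_approx_ge0 => // [x|]; first by rewrite /fn le_max lexx orbT.
  apply: fin => // x; rewrite /fn; have [_|_] := leP (- f x) 0.
    by rewrite expr0n sqr_ge0.
  by rewrite sqrrN.
exists (p - q).
have -> : sqint (fun x => f x - (p - q).[x]) =
          sqint (fun x => (fp x - p.[x]) + (- (fn x - q.[x]))).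
  apply: eq_integral => x _; congr (_ ^+ 2)%:E; rewrite hornerD hornerN.
  suff : f x = fp x - fn x by move=> ->; ring.
  by rewrite /fp /fn; have [h1|h1] := leP (f x) 0; have [h2|h2] := leP (- f x) 0; lra.
apply: (le_lt_trans (sqintD _ _)).
- by apply: measurable_funB => //; exact: (tame_poly p).1.
- by apply: measurable_funN; apply: measurable_funB => //; exact: (tame_poly q).1.
rewrite [X in (_ + _ * X)%E](_ : _ = sqint (fun x => (fn x - q.[x])%R)); last first.
  by apply: eq_integral => x _; rewrite sqrrN.
move: pe qe; have : (0 <= sqint (fun x => (fp x - p.[x])%R))%E.
  by apply: integral_ge0 => x _; rewrite lee_fin sqr_ge0.
have : (0 <= sqint (fun x => (fn x - q.[x])%R))%E.
  by apply: integral_ge0 => x _; rewrite lee_fin sqr_ge0.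
case: (sqint _) => [a| |] //; case: (sqint _) => [b| |] //.
by rewrite !lee_fin !lte_fin; lra.
Qed.

End square_integrable.

Section density.
Context (R : realType) (nu : borelMeasure R).
Hypothesis mom : all_moments nu.

(** Approximating the indicators is enough for simple functions, hence by
    dominated convergence for nonnegative square-integrable functions, hence
    for real and imaginary parts. *)
Lemma dense_of_indic :
  (forall B : set (mT R), measurable B -> approximable nu \1_B) -> polynomials_dense nu.
Proof.
move=> ia f [mre mim /L2norm_fin fin] e e0.
have msq (g : R -> R) : measurable_fun [set: mT R] (g : mT R -> mT R) ->
    measurable_fun [set: mT R] (fun x : mT R => (g x ^+ 2)%:E) by exact: measurable_sqr.
have sum_sqr (a b : R -> R) : measurable_fun [set: mT R] (a : mT R -> mT R) ->
    measurable_fun [set: mT R] (b : mT R -> mT R) ->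
    (\int[nu]_x (a x ^+ 2 + b x ^+ 2)%:E = \int[nu]_x (a x ^+ 2)%:E + \int[nu]_x (b x ^+ 2)%:E)%E.
  move=> ma mb; under eq_integral do rewrite EFinD.
  by rewrite ge0_integralD//; do ?[by move=> x _; rewrite lee_fin sqr_ge0|exact: msq].
have e2 : 0 < e ^+ 2 / 2 by rewrite divr_gt0// exprn_gt0.
rewrite /sqn sum_sqr// in fin.
have fre : (\int[nu]_x (complex.Re (f x) ^+ 2)%:E < +oo)%E.
  by apply: le_lt_trans fin; rewrite leeDl// integral_ge0// => x _; rewrite lee_fin sqr_ge0.
have fim : (\int[nu]_x (complex.Im (f x) ^+ 2)%:E < +oo)%E.
  by apply: le_lt_trans fin; rewrite leeDr// integral_ge0// => x _; rewrite lee_fin sqr_ge0.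
have [a ae] := sqint_approx mom ia mre fre e2.
have [b be] := sqint_approx mom ia mim fim e2.
have [p pE] := real_poly_pair a b.
exists p; apply/(L2norm_lt nu _ e0).
rewrite (eq_integral (fun x : mT R => ((complex.Re (f x) - a.[x]) ^+ 2 +
                                (complex.Im (f x) - b.[x]) ^+ 2)%:E)); last first.
  by move=> x _; rewrite /sqn pE; case: (f x).
rewrite sum_sqr; last 2 first.
- by apply: measurable_funB => //; exact: (tame_poly a).1.
- by apply: measurable_funB => //; exact: (tame_poly b).1.
by rewrite (splitr (e ^+ 2)) EFinD lteD.
Qed.

Lemma indic_of_dense (B : set (mT R)) : polynomials_dense nu -> measurable B ->
  approximable nu \1_B.
Proof.
move=> dn mB; have tB := tame_indic mB; split=> // e e0.
pose f (x : R) : R[i] := (\1_B x +i* 0)%C.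
have fL2 : L2 nu f.
  split; [exact: tB.1|exact: measurable_cst|].
  apply/L2norm_fin; rewrite /sqn /f /=.
  rewrite (eq_integral (fun x : mT R => (\1_B x ^+ 2)%:E)); last first.
    by move=> x _; rewrite expr0n addr0.
  rewrite (ig_EFin mom (f := fun x => \1_B x ^+ 2)) ?ltry//.
  exact: tameX.
have se0 : 0 < Num.sqrt e by rewrite sqrtr_gt0.
have [p /(L2norm_lt nu _ se0)] := dn f fL2 _ se0.
have [a [b pE]] := complex_poly_split p.
rewrite sqr_sqrtr ?ltW// => h; exists a.
have ts : tame (fun x => (\1_B x - a.[x]) ^+ 2) by apply: tame_sqrB => //; exact: tame_poly.
rewrite -lte_fin -(ig_EFin mom ts); apply: le_lt_trans h.
have E x : sqn (f x - p.[x%:C%C]) = (\1_B x - a.[x]) ^+ 2 + b.[x] ^+ 2.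
  by rewrite pE /sqn /f; simpc; rewrite /= sqrrN.
under [leRHS]eq_integral do rewrite E.
apply: ge0_le_integral => //.
- by move=> x _; rewrite lee_fin sqr_ge0.
- by apply/measurable_EFinP; exact: ts.1.
- apply/measurable_EFinP; apply: measurable_funD; first exact: ts.1.
  by apply: measurable_funX; exact: (tame_poly b).1.
- by move=> x _; rewrite lee_fin lerDl sqr_ge0.
Qed.

End density.

(** * Supports of N-extremal solutions *)

Section n_extremal.
Context (R : realType) (gamma : nat -> R).
Implicit Types (mu nu : borelMeasure R) (s t : R) (p q : {poly R}).

Lemma represents_H mu : H_representing gamma mu -> represents gamma mu.
Proof. by []. Qed.

Lemma indeterminate_bounded : H_indeterminate gamma -> locally_bounded_evaluation gamma.
Proof.
move=> [[mu rmu] nd] t.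
have [nu [rnu mn]] : exists nu, H_representing gamma nu /\ mu <> nu.
  apply: contrapT => h; apply: nd; exists mu; split=> // nu rnu.
  by apply: contrapT => mn; apply: h; exists nu.
have [B mB mnB] : exists2 B : set (mT R), measurable B & mu B <> nu B.
  apply: contrapT => h; apply: mn; apply/borelMeasureP => B mB.
  by apply: contrapT => mnB; apply: h; exists B.
by apply: (local_evaluation_bound rmu rnu); exists B.
Qed.

Lemma extremal_of_mass mu t : H_indeterminate gamma -> H_representing gamma mu ->
  rho gamma t <= fine (mu [set t]) -> N_extremal gamma mu.
Proof.
move=> ig rmu mt; split=> //; apply: dense_of_indic; first exact: rmu.1.
by move=> B mB; exact: (indic_approximable rmu mt).
Qed.

Lemma supp_of_mass mu t : represents gamma mu -> 0 < fine (mu [set t]) -> supp mu t.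
Proof.
move=> rmu m0 U [oU Ut]; apply: (@lt_le_trans _ _ (mu [set t])).
  by move: m0; rewrite -{2}(fineK (measure_fin rmu.1 (measurable_set1 t))) lte_fin.
apply: le_measure; rewrite ?inE//; last by move=> _ ->.
exact: open_measurable.
Qed.

(** The evaluation bound is uniform over small balls around [t], which keeps
    their masses away from 0 and makes [t] an atom.  At the single point [t] the
    best constant in the bound is [(rho gamma t)^-1], and [mass_lower_bound]
    gives the full mass. *)
Lemma mass_of_supp mu t : N_extremal gamma mu -> supp mu t ->
  rho gamma t <= fine (mu [set t]).
Proof.
move=> [ind rmu dn] st; have lb := indeterminate_bounded ind.
have mom := rmu.1.
have ia B mB := @indic_of_dense _ _ mom B dn mB.
have r0 := rho_gt0 t lb.
have [d [C [d0 C0 hC]]] := lb t.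
pose F n : set (mT R) := ball t (d / n.+1%:R).
have mF n : measurable (F n) by exact: measurable_ball.
have Fb n : (C^-1%:E <= mu (F n))%E.
  have b0 : 0 < d / n.+1%:R by rewrite divr_gt0.
  have : (0 < mu (F n))%E.
    apply: st; split; [exact: ball_open|exact: ballxx].
  rewrite -(fineK (measure_fin mom (mF n))) lte_fin lee_fin => m0.
  have : 1 <= C * fine (mu (F n)).
    apply: (mass_lower_bound rmu (mF n) (ia _ (mF n))) => // x p Fx.
    apply: hC; move: Fx; rewrite /F /ball/= distrC => /lt_le_trans; apply.
    by rewrite ler_pdivrMr// ler_peMr ?ler1n// ltW.
  by rewrite -ler_pdivrMl// mulr1.
have FE : \bigcap_n F n = [set t].
  apply/seteqP; split=> [x Fx|x -> n _]; last first.
    by apply: (ballxx t); rewrite divr_gt0.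
  apply: contrapT => /eqP xt.
  have xt0 : 0 < `|t - x| / d by rewrite divr_gt0// normr_gt0 subr_eq0 eq_sym.
  have := @cvg_harmonic R => /cvgrPdist_lt/(_ _ xt0)[n _ /(_ n (leqnn n))].
  rewrite sub0r normrN gtr0_norm//= ltr_pdivlMr// => h.
  have := Fx n Logic.I; rewrite /F /ball/= mulrC => h2.
  by have := lt_trans h h2; rewrite ltxx.
have m0 : 0 < fine (mu [set t]).
  have := @nonincreasing_cvg_mu _ _ _ mu F.
  rewrite FE => /(_ _ mF (measurable_set1 t)) cF.
  have {}cF : mu \o F @ \oo --> mu [set t].
    apply: cF; first by rewrite ltey_eq measure_fin.
    apply/nonincreasing_seqP => n; rewrite subsetEset; apply: le_ball.
    by rewrite ler_pM2l// lef_pV2 ?posrE// ler_nat.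
  have : (C^-1%:E <= mu [set t])%E.
    rewrite -(cvg_lim _ cF)//; apply: lime_ge; first by apply/cvg_ex; exists (mu [set t]).
    exact: nearW.
  rewrite -{1}(fineK (measure_fin mom (measurable_set1 t))) lee_fin.
  by apply: lt_le_trans; rewrite invr_gt0.
have := @mass_lower_bound _ _ mu [set t] (rho gamma t)^-1 rmu (measurable_set1 t)
  (ia _ (measurable_set1 t)).
rewrite invr_gt0 => /(_ r0) h.
rewrite -[leLHS]mulr1 -ler_pdivlMl//; apply: h => // x p ->.
by rewrite ler_pdivlMl//; exact: (rho_sqr_le rmu).
Qed.

Lemma extremal_eq mu nu t : N_extremal gamma mu -> N_extremal gamma nu ->
  supp mu t -> supp nu t -> mu = nu.
Proof.
move=> mu_e nu_e st st'; apply/borelMeasureP => B mB.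
have [_ rmu _] := mu_e; have [_ rnu _] := nu_e.
by apply: (extremal_mass_unique (t := t) rmu rnu) => //; exact: mass_of_supp.
Qed.

Lemma supp_closed mu : closed (supp mu).
Proof.
move=> x cx U [oU Ux].
have [y [sy Uy]] := cx _ (open_nbhs_nbhs (conj oU Ux)).
exact: sy.
Qed.

Lemma not_supp mu x : ~ supp mu x -> exists2 d, 0 < d & mu (ball x d) = 0%E.
Proof.
move=> nx; apply: contrapT => h; apply: nx => U [oU Ux].
have /nbhs_ballP[d /= d0 dU] := open_nbhs_nbhs (conj oU Ux).
rewrite lt0e; apply/andP; split; last exact: measure_ge0.
apply/eqP => U0; apply: h; exists d => //; apply/eqP; rewrite eq_le measure_ge0 andbT -U0.
by apply: le_measure; rewrite ?inE//; [exact: measurable_ball|exact: open_measurable].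
Qed.

Lemma not_supp_itv mu x : ~ supp mu x ->
  exists d, 0 < d /\ forall z, `|z - x| < d -> ~ supp mu z.
Proof.
move=> nx; have := closed_openC (@supp_closed mu).
rewrite openE => /(_ x nx)/nbhs_ballP[d /= d0 h].
by exists d; split=> // z zx; apply: h; rewrite /ball/= distrC.
Qed.

(** The complement is covered by the countably many null intervals with
    rational endpoints. *)
Lemma supp_full mu : mu (~` supp mu) = 0%E.
Proof.
have mS : measurable (~` supp mu : set (mT R)).
  by apply: measurableC; exact: closed_measurable (@supp_closed mu).
pose I (ab : rat * rat) : set (mT R) := `]ratr ab.1, ratr ab.2[%classic.
pose F (n : nat) : set (mT R) :=
  if unpickle n is Some ab then if mu (I ab) == 0%E then I ab else set0 else set0.
have F0 n : mu.-negligible (F n).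
  rewrite /F; case: unpickle => [ab|]; last exact: negligible_set0.
  case: eqP => [h|_]; last exact: negligible_set0.
  by apply/negligibleP => //; exact: measurable_itv.
apply: measure_negligible => //.
apply: negligibleS (negligible_bigcup F0) => x nx.
have [d d0 md] := not_supp nx.
have [a] := rat_in_itvoo (ltac:(by rewrite ltrBlDr ltrDl) : x - d < x).
rewrite in_itv/= => /andP[a1 a2].
have [b] := rat_in_itvoo (ltac:(by rewrite ltrDl) : x < x + d).
rewrite in_itv/= => /andP[b1 b2].
exists (pickle (a, b)); first exact: Logic.I.
rewrite /F pickleK /I /=.
suff -> : mu `]ratr a, ratr b[%classic = 0%E.
  by rewrite eqxx /= in_itv/= a2 b1.
apply/eqP; rewrite eq_le measure_ge0 andbT -md.
apply: le_measure; rewrite ?inE//; [exact: measurable_ball|move=> z].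
rewrite /= in_itv/= /ball/= => /andP[za zb]; rewrite ltr_norml.
by apply/andP; split; lra.
Qed.

Lemma ig_le_on_supp mu (f g : R -> R) : all_moments mu -> tame f -> tame g ->
  (forall x, supp mu x -> f x <= g x) -> ig mu f <= ig mu g.
Proof.
move=> mom tf tg fg.
have mS : measurable (supp mu : set (mT R)) by exact: closed_measurable (@supp_closed mu).
have tS := tame_indic mS.
have E h : tame h -> ig mu h = ig mu (fun x => h x * \1_(supp mu) x).
  move=> th; apply: (ig_eq_off_null mom th (tameM th tS) (measurableC mS)).
    exact: supp_full.
  by move=> x /contrapT sx; rewrite indicE mem_set// mulr1.
rewrite E// [leRHS]E//; apply: (ig_le mom); [exact: tameM|exact: tameM|move=> x].
rewrite indicE; have [sx|sx] := pselect (supp mu x).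
  by rewrite mem_set//= !mulr1 fg.
by rewrite memNset//= !mulr0.
Qed.

Lemma frac_bounds (a b c d : R) : 0 < a -> 0 < b -> 0 < d ->
  a * d <= c * b -> c * a <= b * d -> a / b <= c / d <= b / a.
Proof.
move=> a0 b0 d0 h1 h2; apply/andP; split.
  by rewrite ler_pdivrMr// mulrAC ler_pdivlMr.
by rewrite ler_pdivrMr// mulrAC ler_pdivlMr.
Qed.

(** If [nu] had no support in [ [s, s'] ], then [(x - s) / (x - s')] would be
    bounded above and below by positive constants on the support of [nu].  Let
    [q] be close to the indicator of [s] for [mu]; then [q(s')] is small, as [s']
    is an atom, and [r = (X - s) (q - q(s')) / (X - s')] is a polynomial.  The
    integral of [r q] is small for [mu], because [r(s) = 0], but at least about
    [ka * rho gamma s] for [nu], because [r] is close to [q] times a factor at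
    least [ka] on its support.  Both integrals are equal. *)
Lemma interlacing mu nu s s' : represents gamma mu -> represents gamma nu ->
  0 < rho gamma s -> rho gamma s <= fine (mu [set s]) -> 0 < fine (mu [set s']) ->
  s < s' -> exists2 x, s <= x <= s' & supp nu x.
Proof.
move=> rmu rnu r0 ms m'0 ss'; apply: contrapT => h.
have mmu := rmu.1; have mnu := rnu.1.
have [d1 [d10 hd1]] : exists d, 0 < d /\ forall z, `|z - s| < d -> ~ supp nu z.
  by apply: not_supp_itv => hs; apply: h; exists s => //; rewrite lexx ltW.
have [d2 [d20 hd2]] : exists d, 0 < d /\ forall z, `|z - s'| < d -> ~ supp nu z.
  by apply: not_supp_itv => hs; apply: h; exists s' => //; rewrite lexx ltW.
pose d := Num.min d1 d2.
have d0 : 0 < d by rewrite lt_min d10.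
have gap x : supp nu x -> x <= s - d \/ s' + d <= x.
  move=> sx; have [x1|x1] := leP x (s - d); [by left|right].
  rewrite leNgt; apply/negP => x2.
  have [xs|xs] := ltP x s.
    apply: (hd1 x) sx; rewrite ltr0_norm ?subr_lt0//.
    by rewrite opprB; apply: (@lt_le_trans _ _ d); [lra|rewrite ge_min lexx].
  have [xs'|xs'] := leP x s'; first by apply: h; exists x; rewrite ?xs.
  apply: (hd2 x) sx; rewrite gtr0_norm ?subr_gt0//.
  by apply: (@lt_le_trans _ _ d); [lra|rewrite ge_min lexx orbT].
pose l := s' - s; have l0 : 0 < l by rewrite subr_gt0.
pose ka := d / (d + l); pose K := (d + l) / d.
have dl0 : 0 < d + l by rewrite addr_gt0.
have ka0 : 0 < ka by rewrite divr_gt0.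
have K0 : 0 < K by rewrite divr_gt0.
have ratio x : supp nu x -> x != s' /\ ka <= (x - s) / (x - s') <= K.
  move=> /gap[xs|xs].
    have xs' : x - s' < 0 by rewrite subr_lt0; apply: (le_lt_trans xs); lra.
    split; first by rewrite lt_eqF// -subr_lt0.
    rewrite -[_ / _]mulrNN -invrN !opprB.
    have ? : 0 < s' - x by rewrite subr_gt0 -subr_lt0.
    have h1 : 0 <= (s - x - d) * l by rewrite mulr_ge0 ?(ltW l0)// subr_ge0; lra.
    have h2 : 0 <= d * l by apply: mulr_ge0; exact: ltW.
    have h3 : 0 <= l * (s - x) by rewrite mulr_ge0 ?(ltW l0)// subr_ge0; lra.
    have h4 : 0 <= l * l by apply: mulr_ge0; exact: ltW.
    have lE : s' = s + l by rewrite /l addrC subrK.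
    by move: h1 h2 h3 h4; rewrite lE => h1 h2 h3 h4; apply: frac_bounds => //; nra.
  have ? : 0 < x - s' by rewrite subr_gt0; apply: lt_le_trans xs; lra.
  split; first by rewrite gt_eqF// -subr_gt0.
  have h1 : 0 <= (x - s' - d) * l by rewrite mulr_ge0 ?(ltW l0)// subr_ge0; lra.
  have h2 : 0 <= d * l by apply: mulr_ge0; exact: ltW.
  have h3 : 0 <= l * (x - s) by rewrite mulr_ge0 ?(ltW l0)// subr_ge0; lra.
  have h4 : 0 <= l * l by apply: mulr_ge0; exact: ltW.
  have lE : s' = s + l by rewrite /l addrC subrK.
  by move: h1 h2 h3 h4; rewrite lE => h1 h2 h3 h4; apply: frac_bounds => //; nra.
set r := rho gamma s in r0 ms; set m' := fine (mu [set s']) in m'0.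
set g0 := gamma 0%N.
have g00 : 0 <= g0.
  by rewrite /g0 -(ig_monomial 0 rmu); apply: ig_ge0 => x; rewrite expr0.
pose M := 2 * K ^+ 2 * (r + 1 + g0 / m') + 1 + K * (g0 / m' + r + 1).
have gm0 : 0 <= g0 / m' by rewrite divr_ge0// ltW.
have M0 : 0 < M.
  have h1 : 0 <= K ^+ 2 * (r + 1 + g0 / m') by apply: mulr_ge0; [exact: sqr_ge0|lra].
  have h2 : 0 <= K * (g0 / m' + r + 1) by apply: mulr_ge0; [exact: ltW|lra].
  rewrite /M; have -> : 2 * K ^+ 2 * (r + 1 + g0 / m') =
    2 * (K ^+ 2 * (r + 1 + g0 / m')) by rewrite mulrA.
  by lra.
suff main eta : 0 < eta -> eta <= 1 -> 2 * ka * r <= eta * M.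
  pose eta := Num.min 1 (ka * r / M).
  have e0 : 0 < eta by rewrite lt_min ltr01 divr_gt0// mulr_gt0.
  have e1 : eta <= 1 by rewrite ge_min lexx.
  have e2 : eta * M <= ka * r by rewrite -ler_pdivlMr// ge_min lexx orbT.
  have := main _ e0 e1; have : 0 < ka * r by rewrite mulr_gt0.
  by rewrite -mulrA; lra.
move=> e0 e1.
have [q qs Lq] := rho_approx rmu s (exprn_gt0 2 e0).
rewrite -/r in Lq; set L := mlin gamma (q ^+ 2) in Lq.
have rL : r <= L by exact: (rho_le rmu).
have e21 : eta ^+ 2 <= 1 by rewrite expr_le1// ltW.
have L1 : L <= r + 1 by apply: (le_trans (ltW Lq)); rewrite lerD2l.
have iL kappa : represents gamma kappa -> ig kappa (fun x => q.[x] ^+ 2) = L.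
  move=> rk; rewrite /L -(ig_poly _ rk); congr ig.
  by apply/funext => x; rewrite horner_exp.
have dsq : ig mu (fun x => (\1_[set s] x - q.[x]) ^+ 2) <= eta ^+ 2.
  by rewrite (ig_delta_sub rmu qs) -/L; lra.
have tds := tame_indic (measurable_set1 s).
have tds' := tame_indic (measurable_set1 s').
set b := q.[s'].
have bb : b ^+ 2 <= eta ^+ 2 / m'.
  rewrite ler_pdivlMr//; apply: le_trans dsq.
  rewrite /m' -ig_indic// -(ig_cstM mmu _ tds').
  apply: (ig_le mmu) => [||x].
  - exact: tameM (tame_cst _) tds'.
  - by apply: tame_sqrB => //; exact: tame_poly.
  - rewrite !indicE; have [->|/eqP xs'] := eqVneq x s'.
      by rewrite mem_set// mulr1 memNset/= ?sub0r ?sqrrN//; apply/eqP; rewrite gt_eqF.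
    by rewrite [_ \in [set s']]memNset//= mulr0 sqr_ge0.
have [q1 q1E] : exists q1, q - b%:P = q1 * ('X - s'%:P).
  by apply/factor_theorem; rewrite /root !hornerE subrr.
have qb x : q.[x] - b = q1.[x] * (x - s').
  have := congr1 (fun p => p.[x]) q1E.
  by rewrite !hornerE.
pose rr := ('X - s%:P) * q1.
have rrE x : rr.[x] = (x - s) * q1.[x] by rewrite /rr !hornerE.
have rr_supp x : supp nu x -> rr.[x] = (x - s) / (x - s') * (q.[x] - b).
  move=> /ratio[xs' _]; rewrite rrE qb; field.
  by rewrite subr_eq0.
pose Lr := mlin gamma (rr ^+ 2).
have iLr kappa : represents gamma kappa -> ig kappa (fun x => rr.[x] ^+ 2) = Lr.
  move=> rk; rewrite /Lr -(ig_poly _ rk); congr ig.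
  by apply/funext => x; rewrite horner_exp.
have iX kappa : represents gamma kappa -> ig kappa (fun x => rr.[x] * q.[x]) = mlin gamma (rr * q).
  move=> rk; rewrite -(ig_poly (rr * q) rk); congr (ig kappa _).
  by apply/funext => x; rewrite [RHS]hornerM.
set X := mlin gamma (rr * q) in iX.
have i1 kappa : represents gamma kappa -> ig kappa (fun=> 1) = g0.
  by move=> rk; rewrite /g0 -(ig_monomial 0 rk).
have upper : 2 * X <= eta * (Lr + 1).
  have h1 : 2 * X <= eta * Lr + eta^-1 * ig mu (fun x => (\1_[set s] x - q.[x]) ^+ 2).
    have tdq : tame (fun x => (\1_[set s] x - q.[x]) ^+ 2).
      by apply: tame_sqrB => //; exact: tame_poly.
    rewrite -(iX _ rmu) -(iLr _ rmu).
    rewrite -(ig_cstM mmu); last by tame_tac.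
    rewrite -(ig_cstM mmu); last by tame_tac.
    rewrite -(ig_cstM mmu); last by tame_tac.
    rewrite -(igD mmu); [|by tame_tac|by tame_tac].
    apply: (ig_le mmu); [by tame_tac|by tame_tac|move=> x].
    have [->|/eqP xs] := eqVneq x s.
      rewrite rrE subrr mul0r mul0r mulr0 addr_ge0// mulr_ge0 ?sqr_ge0// ?invr_ge0 ltW//.
    rewrite indicE memNset//= sub0r sqrrN.
    have := sqr_ge0 (eta * rr.[x] - q.[x]).
    rewrite -(pmulr_rge0 _ (_ : 0 < eta^-1)) ?invr_gt0//.
    have -> : eta^-1 * (eta * rr.[x] - q.[x]) ^+ 2 =
      (eta * rr.[x] ^+ 2 + eta^-1 * q.[x] ^+ 2) - 2 * (rr.[x] * q.[x]).
      by field; rewrite gt_eqF.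
    by rewrite subr_ge0.
  have h2 : eta^-1 * ig mu (fun x => (\1_[set s] x - q.[x]) ^+ 2) <= eta.
    by rewrite ler_pdivrMl// -expr2.
  by lra.
have LrM : Lr <= 2 * K ^+ 2 * (r + 1 + g0 / m').
  have h1 : Lr <= 2 * K ^+ 2 * L + 2 * K ^+ 2 * b ^+ 2 * g0.
    rewrite -(iLr _ rnu) -(i1 _ rnu) -(iL _ rnu).
    rewrite -(ig_cstM mnu); last by tame_tac.
    rewrite -(ig_cstM mnu); last by tame_tac.
    rewrite -(igD mnu); [|by tame_tac|by tame_tac].
    apply: ig_le_on_supp => //; [by tame_tac|by tame_tac|move=> x sx].
    have [_ /andP[k1 k2]] := ratio x sx.
    rewrite rr_supp// exprMn mulr1.
    move: (_ / _) k1 k2 => f k1 k2.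
    have f2 : f ^+ 2 <= K ^+ 2 by rewrite lerXn2r ?nnegrE ?(ltW K0)// (le_trans _ k1)// ltW.
    apply: (le_trans (ler_wpM2r (sqr_ge0 _) f2)).
    have -> : 2 * K ^+ 2 * q.[x] ^+ 2 + 2 * K ^+ 2 * b ^+ 2 =
      K ^+ 2 * (2 * q.[x] ^+ 2 + 2 * b ^+ 2) by ring.
    rewrite ler_wpM2l ?sqr_ge0//.
    by have := sqr_ge0 (q.[x] + b); nra.
  have h2 : b ^+ 2 * g0 <= g0 / m'.
    rewrite [leRHS]mulrC ler_wpM2r// (le_trans bb)// ler_pdivrMr// mulVf ?gt_eqF//.
  apply: (le_trans h1).
  have -> : 2 * K ^+ 2 * L + 2 * K ^+ 2 * b ^+ 2 * g0 = 2 * K ^+ 2 * (L + b ^+ 2 * g0) by ring.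
  apply: ler_wpM2l; first by apply: mulr_ge0 => //; exact: sqr_ge0.
  by clear -L1 h2; lra.
have lower : 2 * ka * L - K * eta * (g0 / m' + L) <= 2 * X.
  rewrite [leLHS](_ : _ = (2 * ka - K * eta) * L + (- (K * eta / m')) * g0); last first.
    by field; rewrite gt_eqF.
  rewrite -(iX _ rnu) -(i1 _ rnu) -(iL _ rnu).
  rewrite -(ig_cstM mnu); last by tame_tac.
  rewrite -(ig_cstM mnu); last by tame_tac.
  rewrite -(ig_cstM mnu); last by tame_tac.
  rewrite -(igD mnu); [|by tame_tac|by tame_tac].
  apply: ig_le_on_supp => //; [by tame_tac|by tame_tac|move=> x sx].
  have [_ /andP[k1 k2]] := ratio x sx.
  rewrite rr_supp// mulr1.
  move: (_ / (x - s')) k1 k2 => f k1 k2.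
  have h1 : 2 * (b * q.[x]) <= eta / m' + eta * q.[x] ^+ 2.
    have h3 : 2 * (b * q.[x]) <= eta^-1 * b ^+ 2 + eta * q.[x] ^+ 2.
      have := sqr_ge0 (b - eta * q.[x]).
      rewrite -(pmulr_rge0 _ (_ : 0 < eta^-1)) ?invr_gt0//.
      have -> : eta^-1 * (b - eta * q.[x]) ^+ 2 =
        (eta^-1 * b ^+ 2 + eta * q.[x] ^+ 2) - 2 * (b * q.[x]).
        by field; rewrite gt_eqF.
      by rewrite subr_ge0.
    apply: (le_trans h3); rewrite lerD2r ler_pdivrMl// mulrA -expr2.
    exact: bb.
  have f0 : 0 <= f by rewrite (le_trans _ k1)// ltW.
  have h4 : 2 * (f * (b * q.[x])) <= K * (eta / m' + eta * q.[x] ^+ 2).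
    apply: (@le_trans _ _ (f * (eta / m' + eta * q.[x] ^+ 2))).
      by rewrite mulrCA ler_wpM2l.
    rewrite ler_wpM2r// addr_ge0//; first by rewrite divr_ge0// ltW.
    by rewrite mulr_ge0 ?sqr_ge0// ltW.
  have h5 : ka * q.[x] ^+ 2 <= f * q.[x] ^+ 2 by rewrite ler_wpM2r ?sqr_ge0.
  move: h4 h5; clear; move: (m'^-1) => n h4 h5.
  by nra.
have h1 : 2 * ka * r <= 2 * ka * L by apply: ler_wpM2l => //; apply: mulr_ge0 => //; exact: ltW.
have h2 : K * eta * (g0 / m' + L) <= K * eta * (g0 / m' + (r + 1)).
  by apply: ler_wpM2l; [apply: mulr_ge0; exact: ltW|rewrite lerD2l].
have h3 : eta * (Lr + 1) <= eta * (2 * K ^+ 2 * (r + 1 + g0 / m') + 1).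
  by rewrite ler_wpM2l ?(ltW e0)// lerD2r.
have -> : eta * M = eta * (2 * K ^+ 2 * (r + 1 + g0 / m') + 1) + K * eta * (g0 / m' + (r + 1)).
  by rewrite /M; ring.
by lra.
Qed.

End n_extremal.

(** * The Hahn-Banach theorem *)

Section hahn_banach.
Context (R : realType) (V : lmodType R) (D : V -> Prop).
Hypothesis DD : forall x y, D x -> D y -> D (x + y).
Hypothesis DZ : forall (c : R) x, D x -> D (c *: x).
Implicit Types (x y v : V) (s p : V -> R) (c : R).

(** Relative to a subspace [D], for use with the polynomially bounded functions
    inside the space of all functions. *)
Definition sublinear s :=
  (forall x y, D x -> D y -> s (x + y) <= s x + s y) /\
  (forall c x, D x -> 0 < c -> s (c *: x) <= c * s x).

Let DN x : D x -> D (- x).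
Proof. by move=> Dx; rewrite -scaleN1r; exact: DZ. Qed.

Lemma sublinearZ s c x : sublinear s -> D x -> 0 < c -> s (c *: x) = c * s x.
Proof.
move=> [_ sZ] Dx c0; apply/le_anti; rewrite sZ//=.
have cV0 : 0 < c^-1 by rewrite invr_gt0.
have := sZ c^-1 (c *: x) (DZ c Dx) cV0.
rewrite scalerA mulVf ?gt_eqF// scale1r.
by rewrite ler_pdivlMl.
Qed.

Lemma sublinear0 s x : sublinear s -> D x -> s 0 = 0.
Proof.
move=> ss Dx; have D0 : D 0 by rewrite -(scale0r x); exact: DZ.
have := sublinearZ ss D0 (ltr0Sn R 1).
by rewrite scaler0; lra.
Qed.

(** The largest sublinear minorant of [s] whose value at [- v] is [- s v]. *)
Definition sharp s v x : R := inf [set s (x + t *: v) - t * s v | t in [set t : R | 0 <= t]].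

Lemma sharp_lb s v x : sublinear s -> D v -> D x ->
  lbound [set s (x + t *: v) - t * s v | t in [set t : R | 0 <= t]] (- s (- x)).
Proof.
move=> ss Dv Dx _ [t /= t_ge0 <-]; have [->|t_neq0] := eqVneq t 0.
  rewrite scale0r addr0 mul0r subr0.
  have := ss.1 _ _ Dx (DN Dx); rewrite subrr (sublinear0 ss Dx); lra.
have t0 : 0 < t by rewrite lt_neqAle eq_sym t_neq0.
rewrite -(sublinearZ ss Dv t0).
have Dt : D (t *: v) by exact: DZ.
have := ss.1 _ _ (DD Dx Dt) (DN Dx).
by rewrite addrAC subrr add0r; lra.
Qed.

Lemma sharp_le s v x t : sublinear s -> D v -> D x -> 0 <= t ->
  sharp s v x <= s (x + t *: v) - t * s v.
Proof.
move=> ss Dv Dx t0; apply: ge_inf; last by exists t.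
by exists (- s (- x)); exact: sharp_lb.
Qed.

Lemma sharp_ge s v x (m : R) : (forall t, 0 <= t -> m <= s (x + t *: v) - t * s v) ->
  m <= sharp s v x.
Proof.
move=> h; apply: lb_le_inf; last by move=> _ [t t0 <-]; exact: h.
by exists (s (x + 0 *: v) - 0 * s v), 0 => /=.
Qed.

Lemma sharp_sublinear s v : sublinear s -> D v -> sublinear (sharp s v).
Proof.
move=> ss Dv; split=> [x y Dx Dy|c x Dx c0].
  rewrite -lerBlDr; apply: sharp_ge => t t0.
  rewrite lerBlDl -lerBlDr; apply: sharp_ge => t' t'0.
  rewrite lerBlDr; apply: (le_trans (sharp_le ss Dv (DD Dx Dy) (addr_ge0 t0 t'0))).
  have := ss.1 _ _ (DD Dx (DZ t Dv)) (DD Dy (DZ t' Dv)).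
  by rewrite addrACA -scalerDl mulrDl; lra.
rewrite -ler_pdivrMl//; apply: sharp_ge => t t0.
rewrite ler_pdivrMl//.
have ct0 : 0 <= c * t by rewrite mulr_ge0// ltW.
apply: (le_trans (sharp_le ss Dv (DZ c Dx) ct0)).
rewrite -scalerA -scalerDr (sublinearZ ss _ c0); last by apply: DD => //; exact: DZ.
by lra.
Qed.

(** Zorn's lemma: the pointwise infimum of a chain is finite because every
    sublinear functional below [p] is at least [- p (- x)], and it is sublinear
    because two members of a chain can be replaced by the smaller one. *)
Lemma minimal_sublinear p : (exists x, D x) -> sublinear p ->
  exists s, [/\ sublinear s, forall x, D x -> s x <= p x
    & forall s', sublinear s' -> (forall x, D x -> s' x <= s x) ->
        forall x, D x -> s x <= s' x].
Proof.
move=> [z Dz] sp.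
pose T := {s : V -> R | sublinear s /\ forall x, D x -> s x <= p x}.
pose r (s t : T) := `[< forall x, D x -> sval t x <= sval s x >].
have t0 : T by exists p.
have [||A tot|[s [ss sle]] smax] := @ZL_preorder T t0 r.
- by move=> t; apply/asboolP.
- move=> s t u /asboolP st /asboolP tu; apply/asboolP => x Dx.
  exact: le_trans (tu x Dx) (st x Dx).
- have [[a0 Aa0]|A0] := pselect (exists a, A a); last first.
    by exists t0 => s As; case: A0; exists s.
  pose m x : R := inf [set sval a x | a in A].
  have lb x : D x -> lbound [set sval a x | a in A] (- p (- x)).
    move=> Dx _ [a Aa <-]; have [sa ale] := svalP a.
    have := ale (- x) (DN Dx); have := sa.1 _ _ Dx (DN Dx).
    by rewrite subrr (sublinear0 sa Dx); lra.
  have mle a x : A a -> D x -> m x <= sval a x.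
    by move=> Aa Dx; apply: ge_inf; [exists (- p (- x)); exact: lb|exists a].
  have mge x (k : R) : (forall a, A a -> k <= sval a x) -> k <= m x.
    move=> h; apply: lb_le_inf; first by exists (sval a0 x), a0.
    by move=> _ [a Aa <-]; exact: h.
  have sm : sublinear m.
    split=> [x y Dx Dy|c x Dx c0].
      rewrite -lerBlDr; apply: (mge _ _ _) => a Aa.
      rewrite lerBlDl -lerBlDr; apply: (mge _ _ _) => b Ab.
      rewrite lerBlDr.
      have [/asboolP ab|/asboolP ba] := tot a b Aa Ab.
        apply: (le_trans (mle b _ Ab (DD Dx Dy))).
        apply: (le_trans ((svalP b).1.1 _ _ Dx Dy)).
        by have := ab x Dx; lra.
      apply: (le_trans (mle a _ Aa (DD Dx Dy))).
      apply: (le_trans ((svalP a).1.1 _ _ Dx Dy)).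
      by have := ba y Dy; lra.
    rewrite -ler_pdivrMl//; apply: (mge _ _ _) => a Aa; rewrite ler_pdivrMl//.
    apply: (le_trans (mle a _ Aa (DZ c Dx))).
    exact: ((svalP a).1.2 c x Dx c0).
  have mp x : D x -> m x <= p x.
    by move=> Dx; apply: (le_trans (mle a0 x Aa0 Dx)); exact: (svalP a0).2.
  exists (exist _ m (conj sm mp)) => s As; apply/asboolP => x Dx.
  exact: mle.
- exists s; split=> // s' ss' s's x Dx.
  have s'p y : D y -> s' y <= p y.
    by move=> Dy; exact: le_trans (s's y Dy) (sle y Dy).
  have := smax (exist _ s' (conj ss' s'p)).
  by rewrite /r => h; have /asboolP := h ltac:(by apply/asboolP); exact.
Qed.

(** Minimal sublinear functionals are linear, because [sharp] cannot lower
    them; one below [sharp p v] has the value [p v] at [v]. *)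
Lemma hahn_banach p v : D v -> sublinear p ->
  exists s, [/\ forall x y, D x -> D y -> s (x + y) = s x + s y,
    forall c x, D x -> s (c *: x) = c * s x,
    forall x, D x -> s x <= p x & s v = p v].
Proof.
move=> Dv sp.
have [s [ss sle smin]] := minimal_sublinear (ex_intro _ v Dv) (sharp_sublinear sp Dv).
have sD x y : D x -> D y -> s (x + y) = s x + s y.
  move=> Dx Dy; apply/le_anti; rewrite ss.1//=.
  have h z : D z -> sharp s y z <= s z.
    move=> Dz; have := sharp_le ss Dy Dz (lexx 0).
    by rewrite scale0r addr0 mul0r subr0.
  have := smin _ (sharp_sublinear ss Dy) h x Dx.
  have := sharp_le ss Dy Dx ler01; rewrite scale1r mul1r; lra.
have s0 : s 0 = 0 by exact: sublinear0 ss Dv.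
have sN x : D x -> s (- x) = - s x.
  by move=> Dx; have := sD _ _ Dx (DN Dx); rewrite subrr s0; lra.
have splep x : D x -> s x <= p x.
  move=> Dx; apply: (le_trans (sle x Dx)); have := sharp_le sp Dv Dx (lexx 0).
  by rewrite scale0r addr0 mul0r subr0.
exists s; split=> //.
  move=> c x Dx; have [c0|c0|->] := ltgtP c 0; last by rewrite scale0r mul0r.
    have nc : 0 < - c by rewrite oppr_gt0.
    rewrite -[c]opprK scaleNr sN; last exact: DZ.
    by rewrite (sublinearZ ss Dx nc); ring.
  exact: (sublinearZ ss Dx c0).
apply/le_anti; rewrite splep//=.
have := sle _ (DN Dv); have := sharp_le sp Dv (DN Dv) ler01.
rewrite scale1r addNr mul1r (sublinear0 sp Dv) sN//; lra.
Qed.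

End hahn_banach.

(** * Positive extensions of the moment functional and Stieltjes measures *)

Section extension.
Context (R : realType) (gamma : nat -> R) (mu0 : {measure set (mT R) -> \bar R}).
Hypothesis rep0 : represents gamma mu0.
Implicit Types (f g : R -> R) (q : {poly R}) (t : R).

Let V : lmodType R := (R -> R^o : lmodType R).

(** A linear functional lies below [upper_value] exactly when it is a positive
    extension of [mlin gamma]. *)
Definition upper_value f : R := inf [set mlin gamma q | q in [set q : {poly R} | forall x, f x <= q.[x]]].

Lemma mlin_le q q' : (forall x, q.[x] <= q'.[x]) -> mlin gamma q <= mlin gamma q'.
Proof.
by move=> h; rewrite -!(ig_poly _ rep0); apply: (ig_le rep0.1) => //; exact: tame_poly.
Qed.

Lemma mlinN q : mlin gamma (- q) = - mlin gamma q.
Proof. by rewrite -scaleN1r (mlinZ rep0) mulN1r. Qed.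

Lemma upper_value_le f q : poly_bounded f -> (forall x, f x <= q.[x]) ->
  upper_value f <= mlin gamma q.
Proof.
move=> [p fp] fq; apply: ge_inf; last by exists q.
exists (mlin gamma (- p)) => _ [r fr <-]; apply: mlin_le => x.
rewrite hornerN; have := fp x; rewrite ler_norml => /andP[h _].
exact: le_trans h (fr x).
Qed.

Lemma upper_value_ge f m : poly_bounded f ->
  (forall q, (forall x, f x <= q.[x]) -> m <= mlin gamma q) -> m <= upper_value f.
Proof.
move=> [p fp] h; apply: lb_le_inf; last by move=> _ [q fq <-]; exact: h.
by exists (mlin gamma p), p => // x; exact: le_trans (ler_norm _) (fp x).
Qed.

Lemma poly_boundedZ c f : poly_bounded f -> poly_bounded (fun x => c * f x).
Proof. by move=> bf; apply: poly_boundedM bf; exact: poly_bounded_cst. Qed.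

Lemma upper_value_sublinear : @sublinear R V (@poly_bounded R) upper_value.
Proof.
split=> [f g bf bg|c f bf c0].
  rewrite -lerBlDr; apply: upper_value_ge => // p fp.
  rewrite lerBlDl -lerBlDr; apply: upper_value_ge => // q gq.
  rewrite lerBlDr; apply: (@le_trans _ _ (mlin gamma (p + q))).
    apply: upper_value_le; first exact: poly_boundedD.
    by move=> x; rewrite hornerD; exact: lerD.
  by rewrite (mlinD rep0); lra.
rewrite -ler_pdivrMl//; apply: upper_value_ge => // p fp; rewrite ler_pdivrMl//.
rewrite -(mlinZ rep0); apply: upper_value_le; first exact: (poly_boundedZ c bf).
by move=> x; rewrite hornerZ ler_pM2l.
Qed.

(** A polynomial above the indicator of [t] is nonnegative and at least 1 at [t],
    so [rho_nonneg_le] bounds [upper_value] of that indicator from below, and the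
    extension can be chosen to attain it. *)
Lemma positive_extension t : exists Lam : (R -> R) -> R,
  [/\ forall f g, poly_bounded f -> poly_bounded g ->
        Lam (fun x => f x + g x) = Lam f + Lam g,
      forall c f, poly_bounded f -> Lam (fun x => c * f x) = c * Lam f,
      forall f q, poly_bounded f -> (forall x, f x <= q.[x]) -> Lam f <= mlin gamma q
    & rho gamma t <= Lam \1_[set t]].
Proof.
have bt : poly_bounded (\1_[set t] : R -> R) by have [] := tame_indic (measurable_set1 t).
have [|c f bf|s [sD sZ sle st]] := @hahn_banach R V (@poly_bounded R) _ _ upper_value
  (\1_[set t] : R -> R) bt upper_value_sublinear.
- by move=> f g bf bg; exact: poly_boundedD.
- exact: poly_boundedZ.
exists s; split.
- exact: sD.
- exact: sZ.
- by move=> f q bf fq; apply: (le_trans (sle f bf)); exact: upper_value_le.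
- rewrite st; apply: upper_value_ge => // q h.
  have q0 x : 0 <= q.[x].
    by apply: le_trans (h x); rewrite indicE.
  have qt : 1 <= q.[t] by apply: le_trans (h t); rewrite indicE mem_set.
  apply: le_trans (rho_nonneg_le rep0 t q0).
  have r0 : 0 <= rho gamma t.
    apply: lb_le_inf; first by exists (mlin gamma (1 ^+ 2)), 1 => //=; rewrite hornerC.
    by move=> _ [p _ <-]; exact: (mlin_sqr_ge0 rep0).
  by rewrite -[leLHS]mulr1 ler_wpM2l.
Qed.

End extension.

Lemma lebesgue_stieltjes_itv (R : realType) (G : cumulative R R) (a b : R) : a <= b ->
  lebesgue_stieltjes_measure G `]a, b]%classic = (G b - G a)%:E.
Proof.
move=> ab; rewrite /lebesgue_stieltjes_measure /measure_extension/=.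
rewrite measurable_mu_extE/=; last exact: is_ocitv.
by rewrite wlength_itv_bnd.
Qed.

Section regularisation.
Context (R : realType) (F : R -> R) (m : R).
Hypothesis Fnd : forall x y, x <= y -> F x <= F y.
Hypothesis Flb : forall x, m <= F x.
Implicit Types x y : R.

(** The distribution function of a finitely additive functional need not be
    right continuous, and is replaced by its right limits. *)
Definition right_limit x : R := inf [set F y | y in [set y | x < y]].

Lemma right_limit_le x y : x < y -> right_limit x <= F y.
Proof.
move=> xy; apply: ge_inf; last by exists y.
by exists m => _ [z _ <-].
Qed.

Lemma right_limit_ge x k : (forall y, x < y -> k <= F y) -> k <= right_limit x.
Proof.
move=> h; apply: lb_le_inf; last by move=> _ [y xy <-]; exact: h.
by exists (F (x + 1)), (x + 1) => //=; rewrite ltrDl.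
Qed.

Lemma le_right_limit x : F x <= right_limit x.
Proof. by apply: right_limit_ge => y xy; apply: Fnd; exact: ltW. Qed.

Lemma right_limit_nd x y : x <= y -> right_limit x <= right_limit y.
Proof.
move=> xy; apply: right_limit_ge => z yz; apply: right_limit_le.
exact: le_lt_trans yz.
Qed.

Lemma right_limit_approx x e : 0 < e -> exists2 d, 0 < d &
  forall y, x < y -> y < x + d -> F y <= right_limit x + e.
Proof.
move=> e0; have [|_ [z xz <-] zl] := @inf_adherent _ [set F y | y in [set y | x < y]] _ e0.
  split; first by exists (F (x + 1)), (x + 1) => //=; rewrite ltrDl.
  by exists m => _ [z _ <-].
exists (z - x); first by rewrite subr_gt0.
move=> y xy; rewrite addrC subrK => yz; apply: ltW; apply: le_lt_trans zl.
by apply: Fnd; exact: ltW.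
Qed.

Lemma right_limit_rc x : right_limit y @[y --> x^'+] --> right_limit x.
Proof.
apply/cvgrPdist_le => e e0; have [d d0 hd] := right_limit_approx x e0.
near=> y; have xy : x < y by near: y; exact: nbhs_right_gt.
rewrite distrC ger0_norm ?subr_ge0; last by apply: right_limit_nd; exact: ltW.
rewrite lerBlDl; have yd : y < x + d by near: y; apply: nbhs_right_lt; rewrite ltrDl.
apply: (@le_trans _ _ (F ((y + (x + d)) / 2))).
  by apply: right_limit_le; exact: (midf_lt yd).1.
apply: hd; last exact: (midf_lt yd).2.
exact: lt_trans xy (midf_lt yd).1.
Unshelve. all: by end_near. Qed.

Lemma cvg_right_limit x : F (x + h) @[h --> 0^'+] --> right_limit x.
Proof.
apply/cvgrPdist_le => e e0; have [d d0 hd] := right_limit_approx x e0.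
near=> h; have h0 : 0 < h by near: h; exact: nbhs_right_gt.
have hlt : h < d by near: h; exact: nbhs_right_lt.
rewrite distrC ger0_norm ?subr_ge0; last by apply: right_limit_le; rewrite ltrDl.
by rewrite lerBlDl; apply: hd; rewrite ?ltrDl// ltrD2l.
Unshelve. all: by end_near. Qed.

Lemma stieltjes_measure : exists mu : {measure set (mT R) -> \bar R},
  forall a b, a <= b -> mu `]a, b]%classic = (right_limit b - right_limit a)%:E.
Proof.
pose G : cumulative R R := HB.pack right_limit
  (isCumulative.Build R _ R right_limit right_limit_nd right_limit_rc).
exists (lebesgue_stieltjes_measure G) => a b ab.
exact: (lebesgue_stieltjes_itv G ab).
Qed.

End regularisation.

(** * Existence of solutions with extremal mass *)

Section step_functions.
Context (R : realType).
Implicit Types (a d x y e M : R) (c : nat -> R) (q : {poly R}).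

Lemma poly_lipschitz q M : 0 <= M -> exists2 C, 0 <= C & forall x y, `|x| <= M -> `|y| <= M ->
  `|q.[x] - q.[y]| <= C * `|x - y| /\ `|q.[x]| <= C.
Proof.
move=> M0; elim/poly_ind: q => [|q b [C C0 h]].
  by exists 0 => // x y _ _; rewrite !horner0 subrr mul0r normr0.
exists ((C + M * C) + C * M + `|b|); first by rewrite !addr_ge0 ?mulr_ge0.
move=> x y xM yM; have [h1 h2] := h x y xM yM; rewrite !hornerE; split.
  have -> : q.[x] * x + b - (q.[y] * y + b) = q.[x] * (x - y) + y * (q.[x] - q.[y]) by ring.
  apply: (@le_trans _ _ (C * `|x - y| + M * (C * `|x - y|))).
    by rewrite (le_trans (ler_normD _ _))// !normrM lerD// ?ler_wpM2r// ler_pM.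
  by rewrite mulrA -mulrDl ler_wpM2r// -addrA lerDl addr_ge0 ?mulr_ge0.
rewrite (le_trans (ler_normD _ _))// lerD2r normrM.
by rewrite (le_trans (ler_pM _ _ h2 xM))// lerDr addr_ge0 ?mulr_ge0.
Qed.

Definition cell a d (j : nat) : set R := `]a + d * j%:R, a + d * j.+1%:R]%classic.

Definition stepf a d c N x : R := \sum_(0 <= j < N) c j * \1_(cell a d j) x.

Lemma stepf_cell a d c N x : 0 < d -> a < x <= a + d * N%:R ->
  exists j, [/\ (j < N)%N, a + d * j%:R < x <= a + d * j.+1%:R & stepf a d c N x = c j].
Proof.
move=> d0; elim: N => [|N IH].
  by rewrite mulr0 addr0 => /andP[h1 h2]; have := lt_le_trans h1 h2; rewrite ltxx.
move=> /andP[ax xN]; rewrite /stepf big_nat_recr//= -/(stepf a d c N x).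
have [xle|xgt] := leP x (a + d * N%:R).
  have [|j [jN jx ->]] := IH; first by rewrite ax.
  exists j; split=> //; first exact: ltnW.
  rewrite indicE memNset ?mulr0 ?addr0// /cell /= in_itv/= => /andP[].
  by rewrite ltNge xle.
exists N; split=> //; first by rewrite xgt.
rewrite indicE mem_set ?mulr1; last by rewrite /cell /= in_itv/= xgt.
rewrite /stepf big_nat big1 ?add0r// => j /andP[_ jN].
rewrite indicE memNset ?mulr0// /cell /= in_itv/= => /andP[_ xj].
have : a + d * j.+1%:R <= a + d * N%:R by rewrite lerD2l ler_pM2l// ler_nat.
by move=> /(le_trans xj); rewrite leNgt xgt.
Qed.

Lemma stepf_out a d c N x : 0 < d -> ~ (a < x <= a + d * N%:R) -> stepf a d c N x = 0.
Proof.
move=> d0 h; rewrite /stepf big_nat big1// => j /andP[_ jN].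
rewrite indicE memNset ?mulr0// /cell /= in_itv/= => /andP[jx xj]; apply: h.
apply/andP; split.
  by apply: le_lt_trans jx; rewrite lerDl mulr_ge0// ltW.
by apply: (le_trans xj); rewrite lerD2l ler_pM2l// ler_nat.
Qed.

Lemma measurable_cell a d j : measurable (cell a d j : set (mT R)).
Proof. exact: measurable_itv. Qed.

Lemma stepf_tame a d c N : tame (stepf a d c N).
Proof.
apply: tame_sum => j; apply: tameM; first exact: tame_cst.
by apply: tame_indic; exact: measurable_cell.
Qed.

Lemma stepf_integral (mu : {measure set (mT R) -> \bar R}) (G : R -> R) a d c N : 0 < d ->
  (forall u v, u <= v -> mu `]u, v]%classic = (G v - G u)%:E) ->
  (\int[mu]_x (stepf a d c N x)%:E =
   (\sum_(0 <= j < N) c j * (G (a + d * j.+1%:R) - G (a + d * j%:R)))%:E)%E.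
Proof.
move=> d0 muG.
have cellE j : mu (cell a d j) = (G (a + d * j.+1%:R) - G (a + d * j%:R))%:E.
  by apply: muG; rewrite lerD2l ler_pM2l// ler_nat.
have int1 j : mu.-integrable setT (fun x : mT R => (\1_(cell a d j) x)%:E).
  apply/integrableP; split.
    by apply/measurable_EFinP; apply: measurable_indic; exact: measurable_cell.
  under eq_integral do rewrite gee0_abs ?lee_fin//.
  by rewrite integral_indic ?setIT ?cellE ?ltry//; exact: measurable_cell.
rewrite /stepf (eq_integral (fun x : mT R => \sum_(j <- index_iota 0 N)
   (c j)%:E * (\1_(cell a d j) x)%:E)%E); last first.
  by move=> x _; rewrite -sumEFin; apply: eq_bigr => j _; rewrite EFinM.
rewrite (@integral_sum _ _ _ mu setT measurableT _
  (fun j (x : mT R) => (c j)%:E * (\1_(cell a d j) x)%:E)%E); last first.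
  by move=> j; apply: integrableZl.
rewrite -sumEFin; apply: eq_bigr => j _.
rewrite integralZl// integral_indic ?setIT ?cellE ?EFinM//.
exact: measurable_cell.
Qed.

End step_functions.

Section representation.
Context (R : realType) (gamma : nat -> R) (mu0 : {measure set (mT R) -> \bar R}).
Hypothesis rep0 : represents gamma mu0.
Implicit Types (f g : R -> R) (q : {poly R}) (t x y : R).

Variable Lam : (R -> R) -> R.
Hypothesis LD : forall f g, poly_bounded f -> poly_bounded g ->
  Lam (fun x => f x + g x) = Lam f + Lam g.
Hypothesis LZ : forall c f, poly_bounded f -> Lam (fun x => c * f x) = c * Lam f.
Hypothesis Lle : forall f q, poly_bounded f -> (forall x, f x <= q.[x]) ->
  Lam f <= mlin gamma q.

Lemma Lam_mono f g : poly_bounded f -> poly_bounded g -> (forall x, f x <= g x) ->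
  Lam f <= Lam g.
Proof.
move=> bf bg fg; have bN := poly_boundedZ (-1) bg.
have := @Lle (fun x => f x + -1 * g x) 0 (poly_boundedD bf bN).
rewrite LD// LZ// => h.
have : mlin gamma 0 = 0 by rewrite /mlin size_poly0 big_ord0.
move=> m0; have : Lam f + -1 * Lam g <= mlin gamma 0.
  by apply: h => x; rewrite horner0 mulN1r subr_le0.
by rewrite m0 mulN1r subr_le0.
Qed.

Lemma Lam_poly q : Lam (fun x => q.[x]) = mlin gamma q.
Proof.
have bq := poly_bounded_poly q.
apply/le_anti; rewrite Lle//=.
have := @Lle (fun x => -1 * q.[x]) (- q) (poly_boundedZ (-1) bq).
rewrite LZ// (mlinN rep0) mulN1r lerN2; apply => x.
by rewrite hornerN mulN1r.
Qed.

Lemma Lam0 : Lam (fun=> 0) = 0.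
Proof.
have := Lam_poly 0; rewrite (_ : mlin gamma 0 = 0).
  move=> h; rewrite -[RHS]h; congr Lam.
  by apply/funext => x; rewrite horner0.
by rewrite /mlin size_poly0 big_ord0.
Qed.

Lemma poly_bounded_indic (A : set R) : poly_bounded (\1_A : R -> R).
Proof.
apply: (@poly_bounded_bounded _ _ 1) => x; rewrite indicE; case: (_ \in _);
  by rewrite /= ?normr1 ?normr0.
Qed.

Definition lcdf x : R := Lam \1_(`]-oo, x]%classic : set R).

Lemma lcdf_itv x y : x <= y -> Lam \1_(`]x, y]%classic : set R) = lcdf y - lcdf x.
Proof.
move=> xy; apply/eqP; rewrite eq_sym subr_eq; apply/eqP; rewrite /lcdf.
rewrite -LD; [|exact: poly_bounded_indic|exact: poly_bounded_indic].
congr Lam; apply/funext => z; rewrite !indicE.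
have memE (i : interval R) : (z \in [set` i]) = (z \in i).
  by apply/idP/idP => h; [exact: (set_mem h)|exact: mem_set].
rewrite !memE !in_itv/=.
by have [zx|zx] := leP z x; have [zy|zy] := leP z y;
  rewrite /= ?addr0 ?add0r//; have := le_trans zx xy; rewrite leNgt zy.
Qed.

Lemma lcdf_nd x y : x <= y -> lcdf x <= lcdf y.
Proof.
move=> xy; rewrite -subr_ge0 -lcdf_itv// -Lam0; apply: Lam_mono => //.
- exact: poly_bounded_cst.
- exact: poly_bounded_indic.
Qed.

Lemma lcdf_ge0 x : 0 <= lcdf x.
Proof.
rewrite -Lam0; apply: Lam_mono => //.
- exact: poly_bounded_cst.
- exact: poly_bounded_indic.
Qed.

Lemma Lam_stepf a d c N : 0 < d -> Lam (stepf a d c N) =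
  \sum_(0 <= j < N) c j * (lcdf (a + d * j.+1%:R) - lcdf (a + d * j%:R)).
Proof.
move=> d0; elim: N => [|N IH].
  rewrite big_geq// -[RHS]Lam0; congr Lam; apply/funext => x.
  by rewrite /stepf big_geq.
rewrite big_nat_recr//= -IH -lcdf_itv; last by rewrite lerD2l ler_pM2l// ler_nat.
rewrite -LZ; last exact: poly_bounded_indic.
rewrite -LD; [|exact: (stepf_tame _ _ _ _).2|by apply: poly_boundedZ; exact: poly_bounded_indic].
by congr Lam; apply/funext => x; rewrite /stepf big_nat_recr.
Qed.

Lemma mlin1 : mlin gamma 1 = gamma 0%N.
Proof. by rewrite /mlin size_poly1 big_ord1 coef1 mul1r. Qed.

Lemma mlinXn n : mlin gamma 'X^n = gamma n.
Proof.
rewrite -(ig_poly _ rep0) -(ig_monomial n rep0); congr ig.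
by apply/funext => x; rewrite hornerXn.
Qed.

Lemma cvg_sum_nat (I : Type) (H : set_system I) (FH : Filter H) (f : nat -> I -> R) (l : nat -> R) N :
  (forall j, f j i @[i --> H] --> l j) ->
  (\sum_(0 <= j < N) f j i) @[i --> H] --> \sum_(0 <= j < N) l j.
Proof.
move=> fl; elim: N => [|N IH].
  by under eq_fun do rewrite big_geq//; rewrite big_geq//; exact: cvg_cst.
under eq_fun do rewrite big_nat_recr//=.
by rewrite big_nat_recr//=; apply: cvgD.
Qed.

Let tail q : {poly R} := (q ^+ 2 + 1) * 'X^2.

(** Truncation at [k] costs a factor [k ^- 2] times a fixed polynomial, whose
    integral the moments control. *)
Lemma tail_ge q k x : 0 < k -> k <= `|x| -> `|q.[x]| <= k ^- 2 * (tail q).[x].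
Proof.
move=> k0 kx; rewrite /tail hornerM hornerXn hornerD hornerC horner_exp.
have x2 : k ^+ 2 <= x ^+ 2 by rewrite -(real_normK (num_real x)) lerXn2r ?nnegrE// ltW.
rewrite ler_pdivlMl ?exprn_gt0//.
have q0 : `|q.[x]| <= q.[x] ^+ 2 + 1.
  rewrite -(real_normK (num_real q.[x])).
  by have := normr_ge0 q.[x]; move: `|_| => u u0; nra.
rewrite mulrC; apply: ler_pM => //.
exact: sqr_ge0.
Qed.

Lemma Lam_close q f e k : 0 < k -> tame f ->
  (forall x, `|q.[x] - f x| <= e + k ^- 2 * (tail q).[x]) ->
  `|mlin gamma q - Lam f| <= e * gamma 0%N + k ^- 2 * mlin gamma (tail q).
Proof.
move=> k0 [_ bf] h.
have bq := poly_bounded_poly q.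
pose P := e%:P + k ^- 2 *: tail q.
have PE x : P.[x] = e + k ^- 2 * (tail q).[x] by rewrite /P hornerD hornerC hornerZ.
have mP : mlin gamma P = e * gamma 0%N + k ^- 2 * mlin gamma (tail q).
  rewrite /P (mlinD rep0) (mlinZ rep0); congr (_ + _).
  by rewrite -mlin1 -(mlinZ rep0) -mul_polyC mulr1.
rewrite -mP ler_norml -(Lam_poly q); apply/andP; split.
  have := @Lle (fun x => f x + -1 * q.[x]) P (poly_boundedD bf (poly_boundedZ (-1) bq)).
  rewrite LD//; last exact: poly_boundedZ.
  rewrite LZ// mulN1r => H; suff : Lam f - Lam (fun x => q.[x]) <= mlin gamma P by lra.
  apply: H => x; rewrite PE mulN1r; have := h x.
  by rewrite ler_norml => /andP[]; lra.
have := @Lle (fun x => q.[x] + -1 * f x) P (poly_boundedD bq (poly_boundedZ (-1) bf)).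
rewrite LD//; last exact: poly_boundedZ.
rewrite LZ// mulN1r; apply => x; rewrite PE mulN1r; have := h x.
by rewrite ler_norml => /andP[].
Qed.

(** The cells may be shifted by any small [h] with the same values [c j]: a
    positive shift, tending to 0, is what turns values of the distribution
    function into right limits. *)
Lemma step_pointwise q n : exists d c N h0, [/\ 0 < d, 0 < h0,
  forall j, exists y, c j = q.[y],
  d * N%:R = 2 * n.+2%:R
  & forall h x, 0 <= h -> h <= h0 ->
    (- n.+2%:R + h < x <= n.+2%:R + h -> `|q.[x] - stepf (- n.+2%:R + h) d c N x| <= n.+1%:R^-1) /\
    (~ (- n.+2%:R + h < x <= n.+2%:R + h) -> stepf (- n.+2%:R + h) d c N x = 0 /\
        n.+1%:R <= `|x|)].
Proof.
set M : R := n.+2%:R; set e : R := n.+1%:R^-1.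
have M0 : 0 < M by [].
have e0 : 0 < e by rewrite invr_gt0.
have [|C C0 hC] := @poly_lipschitz _ q (M + 1); first by rewrite addr_ge0// ltW.
pose C' := C + 1; have C'0 : 0 < C' by rewrite ltr_wpDl.
pose N := (Num.bound (4 * M * C' / e)).+1.
have N0 : 0 < N%:R :> R by [].
pose d := 2 * M / N%:R.
have d0 : 0 < d by rewrite divr_gt0// mulr_gt0.
have dN : d * N%:R = 2 * M by rewrite /d mulfVK// gt_eqF.
have dC : d * C' <= e / 2.
  have : 4 * M * C' / e <= N%:R.
    apply: (@le_trans _ _ (Num.bound (4 * M * C' / e))%:R); last by rewrite ler_nat.
    apply/ltW/archi_boundP; apply: divr_ge0; last exact: ltW.
    by apply: mulr_ge0; [apply: mulr_ge0 => //; exact: ltW|exact: ltW].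
  rewrite ler_pdivrMr// => h.
  by rewrite /d mulrAC ler_pdivrMr//; lra.
pose h0 := Num.min 1 (e / (2 * C')).
have h00 : 0 < h0 by rewrite lt_min ltr01 divr_gt0// mulr_gt0.
pose c j := q.[- M + d * j.+1%:R].
exists d, c, N, h0; split=> // [j|h x hge hle]; first by eexists.
have h1 : h <= 1 by apply: (le_trans hle); rewrite ge_min lexx.
have h2 : h * C' <= e / 2.
  have : h <= e / (2 * C') by apply: (le_trans hle); rewrite ge_min lexx orbT.
  rewrite invfM mulrA ler_pdivlMr//; lra.
have aN : - M + h + d * N%:R = M + h by rewrite dN; lra.
split=> hx.
  have [|j [jN jx ->]] := @stepf_cell _ (- M + h) d c N x d0; first by rewrite aN.
  rewrite /c; set y := - M + d * j.+1%:R.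
  have dj : d * j.+1%:R <= 2 * M by rewrite -dN ler_pM2l// ler_nat.
  have dj0 : 0 <= d * j.+1%:R by rewrite mulr_ge0// ltW.
  have djS : d * j.+1%:R = d * j%:R + d by rewrite -natr1 mulrDr mulr1.
  have xM : `|x| <= M + 1 by rewrite ler_norml; lra.
  have yM : `|y| <= M + 1 by rewrite ler_norml /y; lra.
  have xy : `|x - y| <= d + h by rewrite ler_norml /y; lra.
  have [hq _] := hC x y xM yM.
  apply: (le_trans hq).
  apply: (@le_trans _ _ (C' * (d + h))); last by lra.
  by rewrite ler_pM// /C'; lra.
split; first by apply: stepf_out => //; rewrite aN.
have nM : n.+1%:R = M - 1 by rewrite /M -[in RHS]natr1 addrK.
rewrite nM leNgt; apply/negP => /ltr_normlP[x1 x2]; apply: hx.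
by apply/andP; split; lra.
Qed.

Variable mu : {measure set (mT R) -> \bar R}.
Hypothesis muG : forall u v, u <= v ->
  mu `]u, v]%classic = (right_limit lcdf v - right_limit lcdf u)%:E.

(** [Lam] of the step function on cells shifted by [h] is close to
    [mlin gamma q] by positivity, uniformly in [h], and tends to the integral of
    the unshifted one as [h] decreases to 0. *)
Lemma step_approximation q n : exists g v, [/\ tame g,
  (\int[mu]_x (g x)%:E = v%:E)%E,
  `|mlin gamma q - v| <= n.+1%:R^-1 * (gamma 0%N + mlin gamma (tail q)),
  forall x, (- n.+2%:R < x <= n.+2%:R -> `|q.[x] - g x| <= n.+1%:R^-1) /\
    (~ (- n.+2%:R < x <= n.+2%:R) -> g x = 0)
  & (forall x, 0 <= q.[x]) -> forall x, 0 <= g x].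
Proof.
have [d [c [N [h0 [d0 h00 cq dN H]]]]] := step_pointwise q n.
set M : R := n.+2%:R in dN H *; set e : R := n.+1%:R^-1 in H *.
have e0 : 0 < e by rewrite invr_gt0.
have e1 : e <= 1 by rewrite invf_le1// ler1n.
exists (stepf (- M) d c N), (\sum_(0 <= j < N) c j *
  (right_limit lcdf (- M + d * j.+1%:R) - right_limit lcdf (- M + d * j%:R))).
have g00 : 0 <= gamma 0%N.
  by rewrite -(ig_monomial 0 rep0); apply: ig_ge0 => x; rewrite expr0.
have t0 : 0 <= mlin gamma (tail q).
  apply: (mlin_ge0 rep0) => x; rewrite /tail hornerM hornerXn hornerD hornerC horner_exp.
  by rewrite mulr_ge0 ?addr_ge0 ?sqr_ge0.
split.
- exact: stepf_tame.
- exact: stepf_integral.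
- set v := \sum_(_ <= _ < _) _.
  pose S h := \sum_(0 <= j < N) c j *
    (lcdf (- M + d * j.+1%:R + h) - lcdf (- M + d * j%:R + h)).
  have cS : S h @[h --> 0^'+] --> v.
    apply: cvg_sum_nat => j; apply: cvgM; first exact: cvg_cst.
    by apply: cvgB; exact: (cvg_right_limit (m := 0) lcdf_nd lcdf_ge0).
  have close h : 0 < h -> h <= h0 -> `|mlin gamma q - S h| <= e * (gamma 0%N + mlin gamma (tail q)).
    move=> hh0 hle.
    have -> : S h = Lam (stepf (- M + h) d c N).
      rewrite Lam_stepf//; apply: eq_bigr => j _.
      by rewrite ![- M + h + _]addrAC.
    have pw x : `|q.[x] - stepf (- M + h) d c N x| <= e + n.+1%:R ^- 2 * (tail q).[x].
      have tx : 0 <= n.+1%:R ^- 2 * (tail q).[x].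
        rewrite mulr_ge0 ?invr_ge0 ?exprn_ge0//.
        rewrite /tail hornerM hornerXn hornerD hornerC horner_exp.
        by rewrite mulr_ge0 ?addr_ge0 ?sqr_ge0.
      have [h1 h2] := H h x (ltW hh0) hle.
      have [hx|hx] := pselect (- M + h < x <= M + h).
        by apply: (le_trans (h1 hx)); rewrite lerDl.
      have [-> nx] := h2 hx; rewrite subr0.
      have n0 : 0 < n.+1%:R :> R by [].
      by apply: (le_trans (tail_ge q n0 nx)); rewrite lerDr ltW.
    have := Lam_close (ltr0Sn R n) (stepf_tame _ _ _ _) pw.
    move/le_trans; apply; rewrite mulrDr lerD2l ler_wpM2r//.
    by rewrite -exprVn -/e expr2 ler_piMr// ltW.
  apply/ler_addgt0Pl => z z0.
  near (0 : R)^'+ => h.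
  have hh0 : 0 < h by near: h; exact: nbhs_right_gt.
  have hle : h <= h0 by near: h; exact: nbhs_right_le.
  have hv : `|v - S h| < z by near: h; move/cvgrPdist_lt: cS; apply.
  have -> : mlin gamma q - v = (mlin gamma q - S h) - (v - S h) by ring.
  rewrite (le_trans (ler_normB _ _))// addrC lerD//; first exact: ltW.
  exact: close.
- move=> x; have [] := H 0 x (lexx 0) (ltW h00); rewrite !addr0 => h1 h2; split=> //.
  by move=> /h2[].
- move=> q0 x; rewrite /stepf; apply: sumr_ge0 => j _; rewrite mulr_ge0//.
  by have [y ->] := cq j.
Unshelve. all: by end_near. Qed.

Lemma step_sequence q : exists (g : nat -> R -> R) (v : nat -> R), [/\ forall n, tame (g n),
  forall n, (\int[mu]_x (g n x)%:E = (v n)%:E)%E,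
  v @ \oo --> mlin gamma q,
  forall n x, `|g n x| <= `|q.[x]| + 1
  & (forall x, g ^~ x @ \oo --> q.[x]) /\
    ((forall x, 0 <= q.[x]) -> forall n x, 0 <= g n x)].
Proof.
have /choice[g /choice[v H]] := step_approximation q.
exists g, v; split.
- by move=> n; have [] := H n.
- by move=> n; have [] := H n.
- set B := gamma 0%N + mlin gamma (tail q).
  have cB : (fun n => n.+1%:R^-1 * B) @ \oo --> (0 : R).
    by rewrite -[X in _ --> X](mul0r B); apply: cvgM; [exact: cvg_harmonic|exact: cvg_cst].
  apply/cvgrPdist_le => e e0; move/cvgrPdist_le: cB => /(_ _ e0).
  apply: filterS => n; rewrite sub0r normrN => h.
  have [_ _ h2 _ _] := H n.
  by apply: (le_trans h2); apply: le_trans h; exact: ler_norm.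
- move=> n x; have [_ _ _ h _] := H n; have [h1 h2] := h x.
  have [hx|hx] := pselect (- n.+2%:R < x <= n.+2%:R); last first.
    by rewrite (h2 hx) normr0 addr_ge0.
  have -> : g n x = q.[x] - (q.[x] - g n x) by ring.
  rewrite (le_trans (ler_normB _ _))// lerD2l (le_trans (h1 hx))//.
  by rewrite invf_le1// ler1n.
split.
  move=> x; apply/cvgrPdist_le => e e0.
  have := @cvg_harmonic R => /cvgrPdist_le/(_ _ e0)[n1 _ hn1].
  exists (maxn n1 (Num.bound `|x|)) => // n /=; rewrite geq_max => /andP[n1n xn].
  have [_ _ _ h _] := H n; have [h1 _] := h x.
  have xb : `|x| < n.+2%:R.
    apply: lt_le_trans (archi_boundP (normr_ge0 x)) _.
    by rewrite ler_nat; apply: (leq_trans xn); rewrite -addn2 leq_addr.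
  apply: (le_trans (h1 _)).
    by move/ltr_normlP: xb => [x1 x2]; apply/andP; split; [lra|exact: ltW].
  have := hn1 n n1n; rewrite sub0r normrN.
  by apply: le_trans; exact: ler_norm.
by move=> q0 n x; have [_ _ _ _] := H n; exact.
Qed.

(** Fatou's lemma for the step functions approximating [(1 + x ^ 2) ^ n]. *)
Lemma stieltjes_moments : all_moments mu.
Proof.
move=> n; pose q : {poly R} := (1 + 'X^2) ^+ n.
have qE x : q.[x] = (1 + x ^+ 2) ^+ n by rewrite /q horner_exp hornerD hornerXn hornerC.
have q0 x : 0 <= q.[x] by rewrite qE exprn_ge0// addr_ge0 ?sqr_ge0.
have [g [v [tg ig_g cv _ [cg /(_ q0) g0]]]] := step_sequence q.
apply: (@le_lt_trans _ _ (\int[mu]_x (q.[x])%:E)%E).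
  apply: ge0_le_integral => //.
  - by apply/measurable_EFinP; exact: (tameX n (tame_norm (tame_id R))).1.
  - by apply/measurable_EFinP; exact: (tame_poly q).1.
  - move=> x _; rewrite lee_fin qE lerXn2r ?nnegrE ?addr_ge0 ?sqr_ge0//.
    rewrite -(real_normK (num_real x)); have := normr_ge0 x.
    by move: `|x| => u u0; nra.
have mg k : measurable_fun [set: mT R] (fun x : mT R => (g k x)%:E).
  by apply/measurable_EFinP; exact: (tg k).1.
have g0' k (x : mT R) : [set: mT R] x -> (0 <= (g k x)%:E)%E by rewrite lee_fin.
have := fatou mu measurableT mg g0'.
rewrite [X in (_ <= limn_einf X)%E](_ : _ = (fun k => (v k)%:E)); last first.
  by apply/funext => k; exact: ig_g.
have cvE : (fun k => (v k)%:E) @ \oo --> (mlin gamma q)%:E.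
  by apply/fine_cvgP; split; [exact: nearW|exact: cv].
rewrite (is_cvg_limn_einfE (u := fun k => (v k)%:E)); last first.
  by apply/cvg_ex; exists (mlin gamma q)%:E.
rewrite (cvg_lim _ cvE)// => h; apply: (@le_lt_trans _ _ (mlin gamma q)%:E); last exact: ltry.
apply: le_trans h; rewrite le_eqVlt; apply/orP; left; apply/eqP.
apply: eq_integral => x _.
have cgx : (fun k => (g k x)%:E) @ \oo --> (q.[x])%:E.
  by apply/fine_cvgP; split; [exact: nearW|exact: cg].
rewrite (is_cvg_limn_einfE (u := fun k => (g k x)%:E)); last first.
  by apply/cvg_ex; exists (q.[x])%:E.
by rewrite (cvg_lim _ cgx).
Qed.

Lemma stieltjes_represents : represents gamma mu.
Proof.
have mom := stieltjes_moments; split=> // n.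
have tn : tame (fun x : R => x ^+ n) by tame_tac.
rewrite (ig_EFin mom tn); congr (_%:E).
have [g [v [tg ig_g cv gb [cg _]]]] := step_sequence 'X^n.
have tb : tame (fun x => `|('X^n : {poly R}).[x]| + 1) by tame_tac.
have [_ cI] := ig_dct mom tg tb gb cg.
have E : (fun k => ig mu (g k)) = v.
  by apply/funext => k; apply: EFin_inj; rewrite -ig_EFin.
rewrite E in cI; rewrite -mlinXn -(cvg_lim _ cv)// (cvg_lim _ cI)//.
by congr ig; apply/funext => x; rewrite hornerXn.
Qed.

(** Right limits can only enlarge a jump: to the left of [t] they are dominated
    by the values of [lcdf] closer to [t]. *)
Lemma stieltjes_mass t : Lam \1_[set t] <= fine (mu [set t]).
Proof.
have mom := stieltjes_moments.
pose F n : set (mT R) := `]t - n.+1%:R^-1, t]%classic.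
have mF n : measurable (F n) by exact: measurable_itv.
have Fb n : ((Lam \1_[set t])%:E <= mu (F n))%E.
  have hn : 0 < n.+1%:R^-1 :> R by rewrite invr_gt0.
  rewrite /F muG ?lee_fin; last by rewrite gerBl ltW.
  have [y0 yt] := midf_lt (ltac:(by rewrite gtrBl) : t - n.+1%:R^-1 < t).
  move: (_ / 2) y0 yt => y y0 yt.
  have := right_limit_le lcdf_ge0 y0; have := le_right_limit lcdf_nd t.
  have : Lam \1_[set t] <= lcdf t - lcdf y.
    rewrite -lcdf_itv; last exact: ltW.
    apply: Lam_mono; [exact: poly_bounded_indic|exact: poly_bounded_indic|move=> x].
    rewrite !indicE; have [->|/eqP xt] := eqVneq x t.
      by rewrite !mem_set//= in_itv/= yt lexx.
    by rewrite memNset.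
  lra.
have FE : \bigcap_n F n = [set t].
  apply/seteqP; split=> [x Fx|x -> n _]; last first.
    by rewrite /F /= in_itv/= lexx andbT gtrBl invr_gt0.
  have xt : x <= t by have := Fx 0%N Logic.I; rewrite /F /= in_itv/= => /andP[].
  apply/eqP; rewrite eq_le xt /= leNgt; apply/negP => tx.
  have tx0 : 0 < t - x by rewrite subr_gt0.
  have := @cvg_harmonic R => /cvgrPdist_lt/(_ _ tx0)[n _ /(_ n (leqnn n))].
  rewrite sub0r normrN gtr0_norm//= => h.
  have := Fx n Logic.I; rewrite /F /= in_itv/= => /andP[h2 _].
  rewrite ltrBlDr addrC -ltrBlDr in h2.
  by have := lt_trans h h2; rewrite ltxx.
have := @nonincreasing_cvg_mu _ _ _ mu F.
rewrite FE => /(_ _ mF (measurable_set1 t)) cF.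
have {}cF : mu \o F @ \oo --> mu [set t].
  apply: cF; first by rewrite ltey_eq measure_fin.
  apply/nonincreasing_seqP => n; rewrite subsetEset => x; rewrite /F /= !in_itv/= => /andP[h ->].
  rewrite andbT; apply: le_lt_trans h; rewrite lerD2l lerN2.
  by rewrite lef_pV2 ?posrE// ler_nat.
rewrite -lee_fin fineK; last exact: measure_fin.
rewrite -(cvg_lim _ cF)//; apply: lime_ge; first by apply/cvg_ex; exists (mu [set t]).
exact: nearW.
Qed.

End representation.

Lemma extremal_mass_exists (R : realType) (gamma : nat -> R) mu0 (t : R) :
  represents gamma mu0 ->
  exists nu : borelMeasure R, represents gamma nu /\ rho gamma t <= fine (nu [set t]).
Proof.
move=> rep0; have [Lam [LD LZ Lle Lt]] := positive_extension rep0 t.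
have [mu muG] := stieltjes_measure (lcdf_nd rep0 LD LZ Lle) (lcdf_ge0 rep0 LD LZ Lle).
have rmu := stieltjes_represents rep0 LD LZ Lle muG.
have [nu nuE] := borelMeasure_repr mu.
exists nu; split; last first.
  rewrite nuE//; apply: (le_trans Lt).
  exact: (stieltjes_mass rep0 LD LZ Lle muG).
have same (f : mT R -> \bar R) : (\int[nu]_x f x = \int[mu]_x f x)%E.
  by apply: eq_measure_integral => A mA _; exact: nuE.
by split=> n; rewrite same; [exact: rmu.1|exact: rmu.2].
Qed.

(** * Least support points of N-extremal solutions *)

Section minimum_of_support.
Context (R : realType).
Implicit Types (nu : borelMeasure R) (t : R).

Definition min_supp nu t := supp nu t /\ forall x, supp nu x -> t <= x.

Lemma min_suppE nu t : min_supp nu t -> inf_supp nu = t%:E.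
Proof.
move=> [st tm]; apply/le_anti/andP; split.
  by apply: ereal_inf_lbound; exists t.
by apply: le_ereal_inf_tmp => _ [x sx <-]; rewrite lee_fin tm.
Qed.

Lemma min_supp_exists nu x0 m : supp nu x0 -> (forall x, supp nu x -> m <= x) ->
  exists t, min_supp nu t.
Proof.
move=> s0 sm; have hi : has_inf (supp nu) by split; [exists x0|exists m].
exists (inf (supp nu)); split; last by move=> x sx; apply: ge_inf => //; case: hi.
apply: supp_closed => U /nbhs_ballP[e /= e0 eU].
have [x sx xe] := inf_adherent e0 hi; exists x; split=> //; apply: eU.
have := ge_inf hi.2 sx; rewrite /ball/= distrC => ix.
by rewrite ger0_norm ?subr_ge0// ltrBlDl.
Qed.

Lemma inf_suppP nu t : inf_supp nu = t%:E <-> min_supp nu t.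
Proof.
split; last exact: min_suppE.
move=> it; have lbt x : supp nu x -> t <= x.
  by move=> sx; rewrite -lee_fin -it; apply: ereal_inf_lbound; exists x.
have [[x0 s0]|s0] := pselect (exists x, supp nu x).
  have [i im] := min_supp_exists s0 lbt.
  by have := min_suppE im; rewrite it => -[->].
have e : supp nu = set0 by rewrite -subset0 => x sx; apply: s0; exists x.
by move: it; rewrite /inf_supp e image_set0 ereal_inf0.
Qed.

Lemma min_supp_inj nu s t : min_supp nu s -> min_supp nu t -> s = t.
Proof. by move=> [ss sm] [st tm]; apply/le_anti; rewrite sm ?tm. Qed.

Lemma min_supp_plus gamma nu t : N_extremal gamma nu -> min_supp nu t -> 0 <= t ->
  N_extremal_plus gamma nu.
Proof.
move=> ne [_ tm] t0; split=> //; split; first by have [_ [mom _] _] := ne.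
by move=> x sx; rewrite /= in_itv/= andbT (le_trans t0)// tm.
Qed.

End minimum_of_support.

Section pencil.
Context (R : realType) (gamma : nat -> R).
Hypothesis ind : H_indeterminate gamma.
Implicit Types (mu nu : borelMeasure R) (s t x y : R).

Let lb := indeterminate_bounded ind.

Lemma n_extremal_at t : exists2 nu, N_extremal gamma nu & supp nu t.
Proof.
have [[mu0 rmu0] _] := ind.
have [nu [rnu nt]] := extremal_mass_exists t (represents_H rmu0).
exists nu; first exact: (extremal_of_mass ind rnu nt).
apply: (supp_of_mass rnu); apply: lt_le_trans nt.
exact: rho_gt0.
Qed.

Lemma n_extremal_represents nu : N_extremal gamma nu -> represents gamma nu.
Proof. by move=> [_ rnu _]; exact: represents_H. Qed.

Lemma enclosed mu nu s t : N_extremal gamma mu -> represents gamma nu ->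
  supp mu s -> supp mu t -> s < t -> exists2 x, s <= x <= t & supp nu x.
Proof.
move=> mu_e rnu ss st st_lt; have rmu := n_extremal_represents mu_e.
apply: (interlacing rmu rnu (rho_gt0 s lb) (mass_of_supp mu_e ss) _ st_lt).
exact: lt_le_trans (rho_gt0 t lb) (mass_of_supp mu_e st).
Qed.

Lemma strictly_enclosed mu nu s t : N_extremal gamma mu -> N_extremal gamma nu ->
  mu <> nu -> supp mu s -> supp mu t -> s < t -> exists2 x, s < x < t & supp nu x.
Proof.
move=> mu_e nu_e mn ss st st_lt.
have [x /andP[sx xt] xnu] := enclosed mu_e (n_extremal_represents nu_e) ss st st_lt.
exists x => //; rewrite !lt_neqAle sx xt !andbT; apply/andP; split; apply/eqP => E; apply: mn.
  by apply: (extremal_eq mu_e nu_e ss); rewrite E.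
by apply: (extremal_eq mu_e nu_e st); rewrite -E.
Qed.

(** Otherwise [(X - t) ^ 2] would have integral 0, although it is 1 at [t + 1]
    and [rho gamma (t + 1)] is positive. *)
Lemma supp_not_sub1 nu t : represents gamma nu -> exists2 x, supp nu x & x != t.
Proof.
move=> rnu; apply: contrapT => h.
have st x : supp nu x -> x = t.
  by move=> sx; apply: contrapT => /eqP xt; apply: h; exists x.
have := rho_sqr_le rnu ('X - t%:P) (t + 1).
have -> : ('X - t%:P).[t + 1] = 1 by rewrite !hornerE addrAC subrr add0r.
rewrite expr1n mulr1 leNgt => /negP; apply.
apply: le_lt_trans (rho_gt0 (t + 1) lb).
rewrite -(ig_poly _ rnu).
have := ig_le_on_supp (mu := nu) rnu.1 (tame_poly (('X - t%:P) ^+ 2)) (tame_cst 0).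
rewrite (ig_cst rnu.1 0) mul0r; apply => x /st ->.
by rewrite horner_exp !hornerE subrr expr0n.
Qed.

Definition lowest t := exists2 nu, N_extremal gamma nu & min_supp nu t.

(** A support point below [s] would enclose, together with [s], a support point
    of the solution with least point [t], which is too low. *)
Lemma lowest_lower s t : lowest t -> s <= t -> lowest s.
Proof.
move=> [nu nu_e [st tm]]; rewrite le_eqVlt => /orP[/eqP->|s_lt]; first by exists nu.
have [mu mu_e ss] := n_extremal_at s; exists mu => //; split=> // y sy.
rewrite leNgt; apply/negP => ys.
have [x /andP[_ xs] xnu] := enclosed mu_e (n_extremal_represents nu_e) sy ss ys.
by have := le_lt_trans (tm x xnu) (le_lt_trans xs s_lt); rewrite ltxx.
Qed.

Lemma lowest_eq nu t : lowest t -> N_extremal gamma nu -> supp nu t -> min_supp nu t.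
Proof.
move=> [mu mu_e tmin] nu_e st.
by rewrite (extremal_eq nu_e mu_e st tmin.1).
Qed.

Lemma lowest_bounded a : lowest a -> exists b, forall t, lowest t -> t <= b.
Proof.
move=> la; have [nu nu_e [sa am]] := la.
have [b sb ba] := supp_not_sub1 a (n_extremal_represents nu_e).
have ab : a < b by rewrite lt_neqAle eq_sym ba am.
exists b => t [mu mu_e [st tm]].
have [x /andP[_ xb] xmu] := enclosed nu_e (n_extremal_represents mu_e) sa sb ab.
exact: le_trans (tm x xmu) xb.
Qed.

(** The supremum [t1] is itself least: if the solution through [t1] had a
    support point [y < t1], that would be its least point; but the solution with
    least point [y - 1] has a support point [x] strictly between [y] and [t1],
    and [x < t1] must be its least point. *)
Lemma lowest_max a : lowest a -> exists t1, forall t, lowest t <-> t <= t1.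
Proof.
move=> la; have [b hb] := lowest_bounded la.
have hs : has_sup [set t | lowest t] by split; [exists a|exists b].
pose t1 := sup [set t | lowest t].
have le1 t : lowest t -> t <= t1 by move=> lt_; apply: ub_le_sup => //; exact: hs.2.
have below t : t < t1 -> lowest t.
  move=> tt1; have e0 : 0 < t1 - t by rewrite subr_gt0.
  have [z lz] := sup_adherent e0 hs; rewrite -/t1 subKr => tz.
  exact: lowest_lower lz (ltW tz).
exists t1 => t; split=> [|tt1]; first exact: le1.
suff l1 : lowest t1 by exact: lowest_lower l1 tt1.
have [mu mu_e s1] := n_extremal_at t1; exists mu => //; split=> // y sy.
rewrite leNgt; apply/negP => yt1.
have muy := lowest_eq (below y yt1) mu_e sy.
have [nu nu_e numin] : lowest (y - 1) by apply: below; apply: lt_trans yt1; rewrite gtrBl.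
have mn : mu <> nu.
  move=> E; rewrite -E in numin; have := min_supp_inj muy numin.
  by move/eqP; rewrite -subr_eq0 opprB addrC subrK oner_eq0.
have [x /andP[yx xt1] xnu] := strictly_enclosed mu_e nu_e mn sy s1 yt1.
have := min_supp_inj (lowest_eq (below x xt1) nu_e xnu) numin => E.
by move: yx; rewrite E ltNge gerBl ler01.
Qed.

(** Two negative support points would enclose a support point of a solution on
    the half-line. *)
Lemma stieltjes_lowest t : Stieltjes_seq gamma -> t < 0 -> lowest t.
Proof.
move=> [nu0 [[mom0 s0] h0]] t0; have [mu mu_e st] := n_extremal_at t.
exists mu => //; split=> // y sy; rewrite leNgt; apply/negP => yt.
have [x /andP[_ xt] /s0] := enclosed mu_e (conj mom0 h0) sy st yt.
by rewrite /= in_itv/= andbT leNgt (le_lt_trans xt).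
Qed.

Lemma stieltjes_lowest_max : Stieltjes_seq gamma ->
  exists2 t1, 0 <= t1 & forall t, lowest t <-> t <= t1.
Proof.
move=> st; have [t1 t1P] := lowest_max (stieltjes_lowest st (ltrN10 R)).
exists t1 => //; apply/ler_addgt0Pl => e e0; rewrite -lerBlDl sub0r.
by apply/t1P; apply: stieltjes_lowest => //; rewrite oppr_lt0.
Qed.

(** A support point not above [t1] is least; a support entirely above [t1]
    would have a least point too, contradicting the maximality of [t1]. *)
Lemma n_extremal_min nu t1 : (forall t, lowest t <-> t <= t1) ->
  N_extremal gamma nu -> exists2 t, t <= t1 & min_supp nu t.
Proof.
move=> t1P nu_e; have rnu := n_extremal_represents nu_e.
have [y sy yt1] : exists2 y, supp nu y & y <= t1.
  have [x0 s0 _] := supp_not_sub1 0 rnu.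
  apply: contrapT => h.
  have lbt x : supp nu x -> t1 <= x.
    by move=> sx; rewrite leNgt; apply/negP => xt; apply: h; exists x => //; exact: ltW.
  have [i im] := min_supp_exists s0 lbt.
  by apply: h; exists i; [exact: im.1|apply/t1P; exists nu].
by exists y => //; apply: lowest_eq => //; exact/t1P.
Qed.

Lemma S_of_plus nu : N_extremal_plus gamma nu -> S_representing gamma nu.
Proof. by move=> [[_ [_ h] _] mp]. Qed.

End pencil.

Section friedrichs.
Context (R : realType) (gamma : nat -> R) (beta : borelMeasure R) (t1 : R).
Hypothesis ind : H_indeterminate gamma.
Hypothesis t1_ge0 : 0 <= t1.
Hypothesis t1P : forall t, lowest gamma t <-> t <= t1.

Lemma plus_at t : 0 <= t <= t1 -> exists2 nu, N_extremal_plus gamma nu & min_supp nu t.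
Proof.
move=> /andP[t0 /t1P[nu nu_e tmin]]; exists nu => //.
exact: min_supp_plus tmin t0.
Qed.

Lemma determinate_bottom : S_determinate gamma -> S_representing gamma beta ->
  t1 = 0 /\ min_supp beta t1 /\ N_extremal_plus gamma beta.
Proof.
move=> [nu [_ uniq]] Sb.
have [mu0 e0 m0] := plus_at (ltac:(by rewrite lexx t1_ge0) : 0 <= 0 <= t1).
have [mu1 e1 m1] := plus_at (ltac:(by rewrite lexx t1_ge0) : 0 <= t1 <= t1).
have E0 : mu0 = beta by rewrite -(uniq _ (S_of_plus e0)) (uniq _ Sb).
have E1 : mu1 = beta by rewrite -(uniq _ (S_of_plus e1)) (uniq _ Sb).
rewrite E0 in m0 e0; rewrite E1 in m1.
by rewrite (min_supp_inj m1 m0); split=> //; split=> //; rewrite -(min_supp_inj m1 m0).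
Qed.

(** Any solution other than [alpha] and [beta], such as one with least point
    [c], makes [alpha] start at 0.  The solution starting at [t1] cannot start
    strictly below [beta], so it is [beta]. *)
Lemma friedrichs_bottom : Friedrichs_measure gamma beta ->
  0 < t1 /\ min_supp beta t1.
Proof.
move=> [alpha [[ae ap] [be bp] ab kf]].
have [a at1 am] := n_extremal_min ind t1P ae.
have [b bt1 bm] := n_extremal_min ind t1P be.
have a0 : 0 <= a by have := ap.2 _ am.1; rewrite /= in_itv/= andbT.
have b0 : 0 <= b by have := bp.2 _ bm.1; rewrite /= in_itv/= andbT.
have anb : a <> b.
  by move=> E; apply: ab; apply: (extremal_eq ae be am.1); rewrite E; exact: bm.1.
have t1_gt0 : 0 < t1.
  rewrite lt_neqAle t1_ge0 andbT; apply/eqP => E; apply: anb.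
  by apply/le_anti; rewrite (le_trans at1) -?E// (le_trans bt1) -?E.
have [c c0 [ct1 ca cb]] : exists2 c, 0 <= c & [/\ c < t1, c <> a & c <> b].
  have [h|h] := pselect (t1 / 2 <> a /\ t1 / 2 <> b).
    by exists (t1 / 2); [lra|split; [lra|exact: h.1|exact: h.2]].
  have [h'|h'] := pselect (t1 / 3 <> a /\ t1 / 3 <> b).
    by exists (t1 / 3); [lra|split; [lra|exact: h'.1|exact: h'.2]].
  exists (t1 / 4); first lra.
  have {}h : t1 / 2 = a \/ t1 / 2 = b by apply: contrapT => k; apply: h; split=> E; apply: k; auto.
  have {}h' : t1 / 3 = a \/ t1 / 3 = b by apply: contrapT => k; apply: h'; split=> E; apply: k; auto.
  by split; [lra|case: h => h; case: h' => h'; lra|case: h => h; case: h' => h'; lra].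
have other s nu : min_supp nu s -> N_extremal_plus gamma nu -> s <> a -> s <> b ->
    (N_extremal_plus gamma `\` [set alpha; beta]) nu.
  move=> sm ne sa sb; split=> // -[E|E]; rewrite E in sm.
    by apply: sa; exact: min_supp_inj sm am.
  by apply: sb; exact: min_supp_inj sm bm.
have [nuc nce ncm] := plus_at (ltac:(by rewrite c0 ltW) : 0 <= c <= t1).
have [Ea _ _] := kf _ (other _ _ ncm nce ca cb).
rewrite (min_suppE am) in Ea; have {}Ea : a = 0 by case: Ea.
split=> //; suff <- : b = t1 by [].
apply: contrapT => bn.
have [nu1 n1e n1m] := plus_at (ltac:(by rewrite lexx t1_ge0) : 0 <= t1 <= t1).
have ta : t1 <> a by rewrite Ea => E; move: t1_gt0; rewrite E ltxx.
have [_ _] := kf _ (other _ _ n1m n1e ta (fun E => bn (esym E))).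
by rewrite (min_suppE n1m) (min_suppE bm) lte_fin ltNge bt1.
Qed.

End friedrichs.

Section conclusion.
Context (R : realType) (gamma : nat -> R) (t1 : R).
Hypothesis ind : H_indeterminate gamma.
Hypothesis t1_ge0 : 0 <= t1.
Hypothesis t1P : forall t, lowest gamma t <-> t <= t1.
Implicit Types (mu nu : borelMeasure R) (t x : R).

Lemma unique_at t : t <= t1 -> exists! nu, N_extremal gamma nu /\ inf_supp nu = t%:E.
Proof.
move=> /t1P[nu nu_e tm]; exists nu; split; first by split=> //; exact: min_suppE.
move=> mu [mu_e /inf_suppP mm].
exact: (extremal_eq nu_e mu_e tm.1 mm.1).
Qed.

Lemma supp_cap nu t x : N_extremal gamma nu -> min_supp nu t -> supp nu x -> x <= t1 -> x = t.
Proof.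
move=> nu_e tm sx /t1P lx.
exact: min_supp_inj (lowest_eq lx nu_e sx) tm.
Qed.

Lemma high_point nu t : N_extremal gamma nu -> min_supp nu t ->
  exists2 x, supp nu x & t1 < x.
Proof.
move=> nu_e tm; have [x sx xt] := supp_not_sub1 ind t (n_extremal_represents nu_e).
exists x => //; rewrite ltNge; apply/negP => xt1.
by move/eqP: xt; apply; exact: supp_cap tm sx xt1.
Qed.

Lemma union_plus : `[0, t1] `<` \bigcup_(mu in N_extremal_plus gamma) supp mu.
Proof.
split=> [t|]; first rewrite /= in_itv/=.
  move=> t01; have [nu ne tm] := plus_at t1P t01.
  by exists nu => //; exact: tm.1.
have [nu ne tm] := plus_at t1P (ltac:(by rewrite lexx t1_ge0) : 0 <= 0 <= t1).
have [x sx tx] := high_point ne.1 tm.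
move=> /(_ x); rewrite /= in_itv/= => /(_ _)/andP[|_]; first by exists nu.
by rewrite leNgt tx.
Qed.

(** The solution with least point [- expR x] has a support point above [t1].
    Supports of distinct N-extremal solutions are disjoint, so these points are
    distinct for distinct [x], and the nonnegative solutions avoid them. *)
Lemma complement_card :
  (`[0, +oo[ `\` \bigcup_(mu in N_extremal_plus gamma) supp mu #= [set: R])%card.
Proof.
rewrite card_eq_le; apply/andP; split; first exact: subset_card_le.
have ex x : exists y, exists nu, [/\ N_extremal gamma nu, min_supp nu (- expR x), supp nu y & t1 < y].
  have [|nu nu_e m] := (t1P (- expR x)).2.
    by rewrite (le_trans _ t1_ge0)// oppr_le0 expR_ge0.
  by have [y sy ty] := high_point nu_e m; exists y, nu.
have [f fP] := choice ex.
have finj : injective f.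
  move=> x y E; have [nu [ne nm ns _]] := fP x; have [mu [me mm ms _]] := fP y.
  rewrite E in ns; have Enu := extremal_eq ne me ns ms; rewrite Enu in nm.
  by have := min_supp_inj nm mm => /oppr_inj/expR_inj.
have fsub : f @` [set: R] `<=` `[0, +oo[ `\` \bigcup_(mu in N_extremal_plus gamma) supp mu.
  move=> _ [x _ <-]; have [nu [ne nm ns ty]] := fP x; split.
    by rewrite /= in_itv/= andbT (le_trans t1_ge0)// ltW.
  move=> [mu [me [_ mp]] ms]; have E := extremal_eq me ne ms ns; rewrite E in mp.
  have := mp _ nm.1; rewrite /= in_itv/= andbT oppr_ge0 leNgt.
  by rewrite expR_gt0.
apply: card_le_trans (subset_card_le fsub).
have : (f @` [set: R] #= [set: R])%card by apply: inj_card_eq => x y _ _; exact: finj.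
by rewrite card_eq_le => /andP[].
Qed.

End conclusion.

Theorem theorem2p2p5 (R : realType) (gamma : nat -> R) (beta : borelMeasure R)
    (gammaS : Stieltjes_seq gamma) (gammaH : H_indeterminate gamma)
    (betaF : S_indeterminate gamma -> Friedrichs_measure gamma beta)
    (betaS : ~ S_indeterminate gamma -> S_representing gamma beta) :
  let t0 : R := fine (inf_supp beta) in
  (* (i) *)
  (S_determinate gamma -> t0 = 0 /\ N_extremal_plus gamma beta) /\
  (* (ii) *)
  (S_indeterminate gamma -> 0 < t0) /\
  (* (iii) *)
  (forall t : R, t <= t0 ->
     exists! nu, N_extremal gamma nu /\ inf_supp nu = t%:E) /\
  (forall nu_ : R -> borelMeasure R,
     (forall t : R, t <= t0 ->
        N_extremal gamma (nu_ t) /\ inf_supp (nu_ t) = t%:E) ->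
     (* (iv) *)
     set_bij `]-oo, t0] (N_extremal gamma) nu_ /\
     (* (v) *)
     N_extremal_plus gamma = nu_ @` `[0, t0] /\
     (* (vii) *)
     (forall t : R, t <= t0 -> supp (nu_ t) `&` `]-oo, t0] = [set t])) /\
  (* (vi) *)
  (forall nu, N_extremal gamma nu -> has_lbound (supp nu)) /\
  (* (viii) *)
  `[0, t0] `<` \bigcup_(mu in N_extremal_plus gamma) supp mu /\
  (`[0, +oo[ `\` \bigcup_(mu in N_extremal_plus gamma) supp mu
     #= [set: R])%card.
Proof.
move=> t0.
have [t1 t1_ge0 t1P] := stieltjes_lowest_max gammaH gammaS.
have Sdet : ~ S_indeterminate gamma -> S_determinate gamma.
  by move=> h; apply: contrapT => k; apply: h; split.
have bm : min_supp beta t1.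
  have [Si|Si] := pselect (S_indeterminate gamma).
    exact: (friedrichs_bottom gammaH t1_ge0 t1P (betaF Si)).2.
  exact: (determinate_bottom t1_ge0 t1P (Sdet Si) (betaS Si)).2.1.
have t0E : t0 = t1 by rewrite /t0 (min_suppE bm).
rewrite {}t0E {t0}; split.
  move=> Sd; have Sb : ~ S_indeterminate gamma by move=> [_].
  by have [t10 [_ ne]] := determinate_bottom t1_ge0 t1P Sd (betaS Sb).
split; first by move=> Si; exact: (friedrichs_bottom gammaH t1_ge0 t1P (betaF Si)).1.
split; first by move=> t; exact: unique_at.
split.
  move=> nu_ nuP.
  have nu_e t : t <= t1 -> N_extremal gamma (nu_ t) by move=> /nuP[].
  have nu_m t : t <= t1 -> min_supp (nu_ t) t by move=> /nuP[_ /inf_suppP].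
  split; [split|split].
  - by move=> t; rewrite /= in_itv/=; exact: nu_e.
  - move=> s t; rewrite !inE /= !in_itv/= => s1 tt1 E.
    by have := nu_m s s1; rewrite E => /min_supp_inj; apply; exact: nu_m.
  - move=> nu ne; have [t tt1 tm] := n_extremal_min gammaH t1P ne.
    exists t; first by rewrite /= in_itv.
    exact: (extremal_eq (nu_e t tt1) ne (nu_m t tt1).1 tm.1).
  - apply/seteqP; split=> [nu [ne np]|_ [t + <-]].
      have [t tt1 tm] := n_extremal_min gammaH t1P ne.
      have t00 : 0 <= t by have := np.2 _ tm.1; rewrite /= in_itv/= andbT.
      exists t; first by rewrite /= in_itv/= t00.
      exact: (extremal_eq (nu_e t tt1) ne (nu_m t tt1).1 tm.1).
    rewrite /= in_itv/= => /andP[t00 tt1].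
    exact: min_supp_plus (nu_e t tt1) (nu_m t tt1) t00.
  - move=> t tt1; apply/seteqP; split=> [x [sx]|x ->].
      rewrite /= in_itv/= => xt1.
      exact: (supp_cap t1P (nu_e t tt1) (nu_m t tt1) sx xt1).
    by split; [exact: (nu_m t tt1).1|rewrite /= in_itv].
split.
  move=> nu ne; have [t _ [_ tm]] := n_extremal_min gammaH t1P ne.
  by exists t => x; exact: tm.
split; first exact: (union_plus gammaH t1_ge0 t1P).
exact: (complement_card gammaH t1_ge0 t1P).
Qed.
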